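(* The following decision problem is NP-hard: given two bidders with independent valuation distributions, each with finite support and rational values and probabilities (encoded in binary), each distribution being regular, and given rationals $W,R$, decide whether there exists a deterministic mechanism $A$ with $\mathrm{SW}(A)\ge W$ and $\mathrm{Rev}(A)\ge R$.
   Context: Setting: a single indivisible item is sold to $n$ bidders. Bidder $i$ has a private valuation drawn from a finite support $v_i^1<v_i^2<\dots<v_i^{h_i}$; valuation profiles $(v_1^{i_1},\dots,v_n^{i_n})$ are drawn from a probability mass function $f$ (a product $\prod_i f_i$ in the independent case, with $f_i^k$ the probability of $v_i^k$). A deterministic (ex-post incentive compatible and individually rational) mechanism is given by an allocation matrix $A:[h_1]\times\dots\times[h_n]\to\{0,1,\dots,n\}$ ($A=j\ge1$ means bidder $j$ gets the item, $A=0$ means nobody does) satisfying monotonicity: if $A[i_1,\dots,i_j,\dots,i_n]=j$ then $A[i_1,\dots,k,\dots,i_n]=j$ for every $k\ge i_j$. On profile $(i_1,\dots,i_n)$ with $A=j\ge 1$, bidder $j$ pays $v_j^{k^*}$ where $k^*$ is the least $k$ with $A[i_1,\dots,k,\dots,i_n]=j$; all other payments are $0$. The welfare is $\mathrm{SW}(A)=\mathbb{E}[v_{\text{winner}}]$ (value $0$ if unallocated) and the revenue is $\mathrm{Rev}(A)=\mathbb{E}[\text{payment}]$. A discrete distribution on $v^1<\dots<v^h$ with masses $f^1,\dots,f^h>0$ is regular if its virtual values $\phi^j=v^j-(v^{j+1}-v^j)\frac{f^{j+1}+\dots+f^h}{f^j}$ (for $j<h$, and $\phi^h=v^h$) are non-decreasing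 in $j$. *)

(* Defs.v *)
From HB Require Import structures.
From mathcomp Require Import all_boot all_order all_algebra.
Set Implicit Arguments. Unset Strict Implicit. Unset Printing Implicit Defensive.
Import Order.TTheory GRing.Theory Num.Theory.

Inductive move := MLeft | MStay | MRight.

Record TM : Type := mkTM {
  tm_state : finType;
  tm_start : tm_state;
  tm_accept : pred tm_state;
  (* None = halt *)
  tm_delta : tm_state -> option bool -> option (tm_state * option bool * move)
}.

(* configuration: (state, left part of tape reversed, tape from the head on) *)
Definition config (M : TM) := (tm_state M * seq (option bool) * seq (option bool))%type.

Definition step (M : TM) (c : config M) : option (config M) :=
  let: (q, L, R) := c in
  match tm_delta q (head None R) with
  | None => None
  | Some (q', w, m) =>
      let R1 := w :: behead R in
      Some (match m with
            | MStay => (q', L, R1)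
            | MLeft => (q', behead L, head None L :: R1)
            | MRight => (q', w :: L, behead R)
            end)
  end.

Fixpoint exec (M : TM) (n : nat) (c : config M) : option (config M) :=
  match step c with
  | None => Some c
  | Some c' => if n is n'.+1 then exec n' c' else None
  end.

Definition init (M : TM) (x : seq bool) : config M := (tm_start M, [::], map Some x).

Fixpoint take_bits (s : seq (option bool)) : seq bool :=
  match s with
  | Some b :: s' => b :: take_bits s'
  | _ => [::]
  end.

Definition lang := seq bool -> Prop.

Definition polytime_fun (f : seq bool -> seq bool) : Prop :=
  exists (M : TM) (k : nat), forall x, exists c,
    exec (size x ^ k + k) (init M x) = Some c /\ take_bits c.2 = f x.

Definition polytime_dec (L : lang) : Prop :=
  exists (M : TM) (k : nat), forall x, exists c,
    exec (size x ^ k + k) (init M x) = Some c /\ (tm_accept c.1.1 <-> L x).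

(* injective pairing of words: bits of x doubled, separator 01, then w *)
Definition enc_pair (x w : seq bool) : seq bool :=
  flatten [seq [:: b; b] | b <- x] ++ [:: false; true] ++ w.

Definition inNP (L : lang) : Prop :=
  exists (V : lang) (k : nat), polytime_dec V /\
    forall x, L x <-> exists w, size w <= size x ^ k + k /\ V (enc_pair x w).

Definition NP_hard (P : lang) : Prop :=
  forall L, inNP L -> exists f, polytime_fun f /\ forall x, L x <-> P (f x).

Fixpoint bitsn (fuel n : nat) : seq bool :=
  if fuel is fuel'.+1 then (if n == 0 then [::] else odd n :: bitsn fuel' n./2)
  else [::].
Definition bits (n : nat) : seq bool := bitsn n n.

Definition encnat (n : nat) : seq bool :=
  flatten [seq [:: b; b] | b <- bits n] ++ [:: false; true].
Definition encint (z : int) : seq bool := (z < 0)%R :: encnat `|z|%N.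
Definition encrat (q : rat) : seq bool := encint (numq q) ++ encnat `|denq q|%N.

Local Open Scope ring_scope.

(* a finite distribution: list of (value, probability), index k = v^{k+1} *)
Definition dist := seq (rat * rat).
Definition dval (d : dist) (k : nat) : rat := (nth (0, 0) d k).1.
Definition dprob (d : dist) (k : nat) : rat := (nth (0, 0) d k).2.

Definition encdist (d : dist) : seq bool :=
  encnat (size d) ++ flatten [seq encrat p.1 ++ encrat p.2 | p <- d].

Definition enc_instance (d1 d2 : dist) (W R : rat) : seq bool :=
  encdist d1 ++ encdist d2 ++ encrat W ++ encrat R.

Definition virtual_value (d : dist) (k : nat) : rat :=
  if (k.+1 < size d)%N then
    dval d k - (dval d k.+1 - dval d k) * (\sum_(k.+1 <= j < size d) dprob d j) / dprob d k
  else dval d k.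

Definition regular (d : dist) : Prop :=
  forall k, (k.+1 < size d)%N -> virtual_value d k <= virtual_value d k.+1.

Definition valid_dist (d : dist) : Prop :=
  [/\ (0 < size d)%N,
      (forall k, (k < size d)%N -> 0 <= dval d k /\ 0 < dprob d k),
      (forall k, (k.+1 < size d)%N -> dval d k < dval d k.+1),
      \sum_(k < size d) dprob d k = 1
    & regular d].

(* deterministic two-bidder mechanism: A i j in {0,1,2} (0 = unallocated) *)
Definition monotone2 (h1 h2 : nat) (A : nat -> nat -> nat) : Prop :=
  forall i j, (i < h1)%N -> (j < h2)%N ->
    [/\ (A i j <= 2)%N,
        (A i j = 1%N -> forall k, (i <= k < h1)%N -> A k j = 1%N)
      & (A i j = 2%N -> forall k, (j <= k < h2)%N -> A i k = 2%N)].

Definition SW (d1 d2 : dist) (A : nat -> nat -> nat) : rat :=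
  \sum_(i < size d1) \sum_(j < size d2)
    dprob d1 i * dprob d2 j *
    (if A i j == 1%N then dval d1 i else if A i j == 2%N then dval d2 j else 0).

(* threshold payments: least index keeping the allocation *)
Definition pay1 (d1 : dist) (A : nat -> nat -> nat) (j : nat) : rat :=
  dval d1 (find (fun k => A k j == 1%N) (iota 0 (size d1))).
Definition pay2 (d2 : dist) (A : nat -> nat -> nat) (i : nat) : rat :=
  dval d2 (find (fun k => A i k == 2%N) (iota 0 (size d2))).

Definition Rev (d1 d2 : dist) (A : nat -> nat -> nat) : rat :=
  \sum_(i < size d1) \sum_(j < size d2)
    dprob d1 i * dprob d2 j *
    (if A i j == 1%N then pay1 d1 A j else if A i j == 2%N then pay2 d2 A i else 0).

Definition SW_Rev_problem : lang := fun x =>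
  exists (d1 d2 : dist) (W R : rat),
    [/\ x = enc_instance d1 d2 W R, valid_dist d1, valid_dist d2
      & exists A, [/\ monotone2 (size d1) (size d2) A, W <= SW d1 d2 A & R <= Rev d1 d2 A]].

(* Main.v *)
(** Every NP language is reduced directly, in four steps.

    (1) An accepting run of the verifier is a tiling: the rows of its space-time diagram are laid one
    after the other on a helix of G cells, so that tiles at distance 1 match horizontally and tiles at
    distance Wd match vertically.

    (2) Choosing a tile type for each cell is choosing a subset of the G * K pairs (cell, type), and
    all the matching conditions are equations between digits in a base too large for carries: a single
    subset-sum equation.

    (3) Subset sum is an auction.  Bidder 1 has value 2 or 6 with probability 1/2; bidder 2 has
    huge values, the top one carrying almost all the mass.  The revenue threshold forces bidder 2
    to win at the top value and only there.  For each lower value j of bidder 2, selling to bidder 1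
    at price 6 gives expected welfare 3 and revenue 3, at price 2 it gives welfare 4 and revenue 2.
    Hence the two thresholds bound from both sides the total probability of the values sold at price 2.

    (4) The instance is printed by a program of a loop language with growing unary counters, which is
    compiled to Turing machines with a polynomial slowdown. *)

Require Import Defs.
From mathcomp Require Import all_boot all_order all_algebra.
From mathcomp Require Import zify ring lra.
From Stdlib Require Import FunctionalExtensionality.
From Stdlib Require Classical_Prop.
Set Implicit Arguments. Unset Strict Implicit. Unset Printing Implicit Defensive.
Import Order.TTheory GRing.Theory Num.Theory.

(** * Words and encodings *)

(** The problem is a language of words, and a word fixes every rational by its reduced fraction. A
    program that counts in unary cannot cancel common factors, so all probabilities and both
    thresholds get odd numerators over powers of two, and the values of the bidders are integers.
    These numbers are exponentially large, but their bits are blocks of constant width, runs of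
    equal bits and complements of these, which nested loops can print.

    Regularity ties each probability to the next one, whereas the numbers of a subset sum are
    arbitrary. A common leading bit makes them agree up to a factor of two, a ratio that the
    geometric values of bidder 2 tolerate. The same leading bit counts the chosen numbers.

    The helix has no left or right border: all cells obey one rule, and the target of the subset sum
    stays uniform. The price is that a row can be disturbed through its ends. The blank margins are
    wide enough to keep this disturbance away from the head until the run halts. *)

(* Least significant bit first. *)
Definition val (s : seq bool) : nat := foldr (fun (b : bool) n => b + n.*2) 0 s.

Lemma val_cat s1 s2 : val (s1 ++ s2) = val s1 + 2 ^ size s1 * val s2.
Proof. by elim: s1 => [|b s IH] /=; rewrite ?mul1n // IH expnS; lia. Qed.

Lemma val_cons b s : val (b :: s) = b + 2 * val s.
Proof. by rewrite /= mul2n. Qed.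

Lemma val_nseq0 n : val (nseq n false) = 0.
Proof. by elim: n => //= n ->. Qed.

Lemma val_nseq1 n : (val (nseq n true)).+1 = 2 ^ n.
Proof. elim: n => //= n IH; rewrite expnS -IH; lia. Qed.

Lemma val_lt s : val s < 2 ^ size s.
Proof. elim: s => //= b s IH; rewrite expnS; case: b => /=; lia. Qed.

Lemma val_flip s : (val s + val (map negb s)).+1 = 2 ^ size s.
Proof. elim: s => //= b s IH; rewrite expnS -IH; case: b => /=; lia. Qed.

Lemma val_gt0 s : s != [::] -> last true s -> 0 < val s.
Proof.
by case: s => // b s _; elim: s b => [|c s IH] b /=; [case: b | move=> /IH /=; lia].
Qed.

(** [last true s] forbids a leading zero and admits the empty word, which represents 0: these are
    the canonical words that [bits] produces. *)
Lemma bitsn_val s fuel : last true s -> val s <= fuel -> bitsn fuel (val s) = s.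
Proof.
elim: s fuel => [|b s IH] fuel; first by case: fuel.
move=> Hl Hf.
have Hp : 0 < val (b :: s) by apply: val_gt0.
case: fuel Hf => [|fuel] Hf; first by rewrite leqn0 in Hf; rewrite (eqP Hf) in Hp.
rewrite [LHS]/=; case: eqP => [E|_]; first by move: Hp; rewrite [val _]E.
have -> : odd (b + (val s).*2) = b by rewrite oddD odd_double addbF oddb.
rewrite half_bit_double IH //; first by move: Hl; clear; case: s.
by move: Hf Hp => /=; lia.
Qed.

Lemma bits_val s : last true s -> bits (val s) = s.
Proof. by move=> H; apply: bitsn_val. Qed.

Lemma val_bitsn fuel n : n <= fuel -> val (bitsn fuel n) = n.
Proof.
elim: fuel n => [|f IH] n; first by case: n.
by move=> Hn /=; case: eqP => [->//|/eqP n0] /=; rewrite IH ?odd_double_half //; lia.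
Qed.

Lemma val_bits n : val (bits n) = n.
Proof. exact: val_bitsn. Qed.

Definition dbl (s : seq bool) : seq bool := flatten [seq [:: b; b] | b <- s].

Lemma dbl_cat s1 s2 : dbl (s1 ++ s2) = dbl s1 ++ dbl s2.
Proof. by rewrite /dbl map_cat flatten_cat. Qed.

Lemma size_dbl s : size (dbl s) = 2 * size s.
Proof. by elim: s => //= b s ->; lia. Qed.

Lemma encnat_val s : last true s -> encnat (val s) = dbl s ++ [:: false; true].
Proof. by move=> H; rewrite /encnat bits_val. Qed.

(** Read two bits at a time, a doubled word consists of equal pairs, and the separator is the first
    unequal pair. The code is therefore prefix-free. *)
Lemma dbl_inj s s' u u' :
  dbl s ++ [:: false; true] ++ u = dbl s' ++ [:: false; true] ++ u' -> s = s' /\ u = u'.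
Proof.
elim: s s' => [|b s IH] [|b' s'] //=.
- by case.
- by case=> <-.
- by case=> ->.
by case=> -> _ /IH[-> ->].
Qed.

Lemma encnat_inj n n' u u' : encnat n ++ u = encnat n' ++ u' -> n = n' /\ u = u'.
Proof.
rewrite /encnat -!catA => /dbl_inj[E ->]; split=> //.
by rewrite -(val_bits n) E val_bits.
Qed.

Lemma encint_inj z z' u u' : encint z ++ u = encint z' ++ u' -> z = z' /\ u = u'.
Proof. by rewrite /encint /= => -[Es /encnat_inj[Ea ->]]; split=> //; lia. Qed.

Lemma encrat_inj q q' u u' : encrat q ++ u = encrat q' ++ u' -> q = q' /\ u = u'.
Proof.
rewrite /encrat -!(catA (encint _)) => /encint_inj[En] /encnat_inj[Ed ->]; split=> //.
rewrite -(divq_num_den q) -(divq_num_den q') En; congr (_ / _%:~R)%R.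
by move: (denq_gt0 q) (denq_gt0 q'); lia.
Qed.

Lemma encdist_inj d d' u u' : encdist d ++ u = encdist d' ++ u' -> d = d' /\ u = u'.
Proof.
rewrite /encdist -!(catA (encnat _)) => /encnat_inj[].
elim: d d' => [|p d IH] [|p' d'] // [Es].
have fl (x : seq bool) xs v : flatten (x :: xs) ++ v = x ++ (flatten xs ++ v).
  by rewrite catA.
rewrite !map_cons !fl -!(catA (encrat _)).
move=> /encrat_inj[E1 /encrat_inj[E2 /(IH _ Es)[-> ->]]].
by rewrite (surjective_pairing p) E1 E2 -surjective_pairing.
Qed.

(** The language quantifies over all decodings of a word; injectivity makes the word produced by the
    reduction stand for the intended instance only. *)
Lemma enc_instance_inj d1 d2 W R d1' d2' W' R' :
  enc_instance d1 d2 W R = enc_instance d1' d2' W' R' ->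
  [/\ d1 = d1', d2 = d2', W = W' & R = R'].
Proof.
rewrite /enc_instance => /encdist_inj[-> /encdist_inj[-> /encrat_inj[->]]].
by rewrite -[encrat R]cats0 -[encrat R']cats0 => /encrat_inj[->].
Qed.

Lemma encrat_nat (n : nat) :
  encrat n%:R%R = false :: encnat n ++ [:: true; true; false; true].
Proof.
have -> : (n%:R : rat)%R = (Posz n)%:~R%R by [].
by rewrite /encrat numq_int denq_int.
Qed.

(** An odd numerator is coprime to a power of two, so nothing cancels; the denominator is written as
    [D] zeros followed by a one. *)
Lemma encrat_odd (n D : nat) : odd n ->
  encrat (n%:R / 2%:R ^+ D)%R =
  false :: encnat n ++ dbl (rcons (nseq D false) true) ++ [:: false; true].
Proof.
move=> on.
have cop : coprime `|(Posz n)|%N `|(Posz (2 ^ D))|%N by rewrite /= coprimeXr // coprimen2.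
have -> : (n%:R / 2%:R ^+ D : rat)%R = ((Posz n)%:~R / ((Posz (2 ^ D)))%:~R)%R.
  by rewrite -!pmulrn natrX.
have D0 : 0 < 2 ^ D by rewrite expn_gt0.
rewrite /encrat coprimeq_num // coprimeq_den //.
have -> : (((Posz (2 ^ D)) == 0) = false)%R by lia.
rewrite gtr0_sg; last lia.
rewrite mul1r /encint /=; congr (_ :: _).
congr (_ ++ _).
have -> : 2 ^ D = val (rcons (nseq D false) true).
  by rewrite -cats1 val_cat val_nseq0 size_nseq /=; lia.
by rewrite encnat_val ?last_rcons.
Qed.

(** * From subset sum to auctions *)

Section Mechanism.
Local Open Scope ring_scope.

Lemma find_iota_le (a : pred nat) m j : (j < m)%N -> a j -> (find a (iota 0 m) <= j)%N.
Proof.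
move=> jm aj; rewrite leqNgt; apply/negP => /(before_find 0%N).
by rewrite nth_iota // add0n aj.
Qed.

Lemma find_iota_eq (a : pred nat) m j : (j < m)%N -> a j ->
  (forall k, (k < j)%N -> ~~ a k) -> find a (iota 0 m) = j.
Proof.
move=> jm aj H; apply/eqP; rewrite eqn_leq find_iota_le // leqNgt; apply/negP => lt.
have ha : has a (iota 0 m).
  by rewrite has_find size_iota; apply: leq_trans lt _; apply: ltnW.
have := nth_find 0%N ha; rewrite nth_iota ?add0n; last by apply: leq_trans jm; apply: ltnW.
by move=> /(negP (H _ lt)).
Qed.

(** The virtual values are -2 and 6. Lowering the price from 6 to 2 adds 1 to the expected welfare
    and takes 1 from the expected revenue, so each probability enters both totals with coefficient
    of modulus one. *)
Definition dlow : dist := [:: (2%:R, 1 / 2%:R); (6%:R, 1 / 2%:R)].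

Variables (ps : seq nat) (D t : nat).
Let n := size ps.

(* The gaps between consecutive values halve, so that regularity follows as soon as no probability
   exceeds twice the next one. *)
Definition bval (m j : nat) : rat := 2%:R ^+ (m + 3) - 2%:R ^+ (m + 2 - j).

Definition dhigh : dist :=
  mkseq (fun j => (bval (size ps) j,
                   if (j < size ps)%N then (nth 0%N ps j)%:R / 2%:R ^+ D
                   else 1 - 1 / 2%:R ^+ (size ps + 3))) (size ps).+1.

(* Expected welfare and revenue if bidder 1 always buys at price 6 below the top value of bidder 2.
   The slack of one unit in the thresholds makes the numerators odd, so that the encoded fractions are
   already in lowest terms; the items are built so that a subset sum within 1 of t is t. *)
Definition base (m : nat) : rat := 2%:R ^+ (m + 3) - 5%:R + 7%:R / 2%:R ^+ (m + 3).
Definition Wthr : rat := base (size ps) + (t%:R - 1) / 2%:R ^+ D.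
Definition Rthr : rat := base (size ps) - (t%:R + 1) / 2%:R ^+ D.

Hypothesis ps_pos : forall j, (j < size ps)%N -> (0 < nth 0 ps j)%N.
Hypothesis ps_ratio : forall j, (j.+1 < size ps)%N -> (nth 0 ps j <= 2 * nth 0 ps j.+1)%N.
Hypothesis ps_sum : ((\sum_(j < size ps) nth 0 ps j) * 2 ^ (size ps + 3) = 2 ^ D)%N.
Hypothesis t_small : (t.+1 <= \sum_(j < size ps) nth 0 ps j)%N.

Let F (j : nat) : rat := (nth 0%N ps j)%:R / 2%:R ^+ D.
Let X : rat := 2%:R ^+ (n + 3).

Let pow2_gt0 k : 0 < (2%:R : rat) ^+ k.
Proof. by rewrite exprn_gt0. Qed.

Lemma n_gt0 : (0 < n)%N.
Proof. by rewrite /n; move: t_small; case: (size ps) => //; rewrite big_ord0. Qed.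

Lemma X_ge16 : 16%:R <= X.
Proof.
rewrite /X -natrX ler_nat (_ : 16%N = 2 ^ 4)%N // leq_exp2l //.
by have := n_gt0; lia.
Qed.

Lemma F_gt0 j : (j < n)%N -> 0 < F j.
Proof. by move=> h; rewrite divr_gt0 // ltr0n ps_pos. Qed.

Lemma F_sum : \sum_(j < n) F j = 1 / X.
Proof.
rewrite -mulr_suml -natr_sum /X.
have /(congr1 (fun k : nat => k%:R : rat)) := ps_sum.
rewrite natrM !natrX -/n => <-; field.
rewrite lt0r_neq0 ?pow2_gt0 //= pnatr_eq0 -lt0n.
by apply: leq_trans t_small.
Qed.

Lemma size_dhigh : size dhigh = n.+1. Proof. by rewrite size_mkseq. Qed.

Lemma dval_dhigh j : (j <= n)%N -> dval dhigh j = bval n j.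
Proof. by move=> h; rewrite /dval nth_mkseq. Qed.

Lemma dprob_dhigh j : (j < n)%N -> dprob dhigh j = F j.
Proof. by move=> h; rewrite /dprob nth_mkseq /= ?ltnS ?h // ltnW. Qed.

Lemma dprob_top : dprob dhigh n = 1 - 1 / X.
Proof. by rewrite /dprob nth_mkseq //= ltnn. Qed.

Lemma bval_lt m j k : (j < k <= m)%N -> bval m j < bval m k.
Proof.
move=> h; rewrite /bval ltrD2l ltrN2 -!natrX ltr_nat ltn_exp2l //; lia.
Qed.

Lemma bval_top m : bval m m = 2%:R ^+ (m + 3) - 4%:R.
Proof. by rewrite /bval addKn -natrX. Qed.

Lemma bval_le j : (j < n)%N -> bval n j <= X - 8%:R.
Proof.
move=> h; rewrite /bval -/X lerD2l lerN2 -natrX ler_nat.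
rewrite (_ : 8 = 2 ^ 3)%N // leq_exp2l //; lia.
Qed.

Lemma bval_leT j : (j <= n)%N -> bval n j <= X - 4%:R.
Proof.
move=> h; rewrite /bval -/X lerD2l lerN2 -natrX ler_nat.
rewrite (_ : 4 = 2 ^ 2)%N // leq_exp2l //; lia.
Qed.

(** Common form of [SW] and [Rev], where [g] is the realised value or the payment: the two equally
    likely rows are averaged and the top column is split off. *)
Lemma sum_cells (g : nat -> nat -> rat) :
  \sum_(i < size dlow) \sum_(j < size dhigh) dprob dlow i * dprob dhigh j * g i j =
  \sum_(j < n) F j * ((g 0%N j + g 1%N j) / 2%:R)
  + (1 - 1 / X) * ((g 0%N n + g 1%N n) / 2%:R).
Proof.
rewrite size_dhigh (_ : size dlow = 2%N) //.
under eq_bigr => i _ do rewrite big_ord_recr dprob_top.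
rewrite !big_ord_recl big_ord0 addr0 {1 3}/dprob /=.
rewrite addrACA -big_split /=; congr (_ + _); last first.
  by move: (1 - 1 / X) => a; rewrite /dprob /= /bump /=; field.
apply: eq_bigr => j _; rewrite dprob_dhigh // /dprob /= /bump /=.
by move: (F j) => a; field.
Qed.

Lemma dlow_valid : valid_dist dlow.
Proof.
split=> //.
- by case=> [|[|]].
- by case.
- by rewrite !big_ord_recl big_ord0 /dprob /=; field.
case=> [_|k]; last by [].
by rewrite /virtual_value big_nat1; vm_compute.
Qed.

Lemma dprob_gt0 k : (k <= n)%N -> 0 < dprob dhigh k.
Proof.
rewrite leq_eqVlt => /predU1P[->|h]; last by rewrite dprob_dhigh // F_gt0.
have X16 := X_ge16; rewrite dprob_top subr_gt0 ltr_pdivrMr; lra.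
Qed.

Lemma bval_ge0 k : 0 <= bval n k.
Proof. rewrite subr_ge0 -!natrX ler_nat leq_exp2l //; lia. Qed.

Lemma bvalS k : (k < n)%N -> bval n k.+1 - bval n k = 2%:R ^+ (n + 1 - k).
Proof.
move=> h; rewrite /bval (_ : n + 2 - k = (n + 1 - k).+1)%N; last lia.
rewrite (_ : n + 2 - k.+1 = n + 1 - k)%N; last lia.
by rewrite exprS; ring.
Qed.

Lemma dhigh_valid : valid_dist dhigh.
Proof.
rewrite /valid_dist /regular size_dhigh; split=> //.
- move=> k; rewrite ltnS => h; rewrite dval_dhigh // bval_ge0; split=> //.
  exact: dprob_gt0.
- by move=> k h; rewrite !dval_dhigh ?bval_lt //; lia.
- rewrite big_ord_recr /= dprob_top.
  under eq_bigr => j _ do rewrite dprob_dhigh //.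
  by rewrite F_sum; ring.
move=> k; rewrite ltnS => kn; rewrite /virtual_value size_dhigh ltnS kn.
rewrite (dval_dhigh kn) (dval_dhigh (ltnW kn)).
rewrite bvalS //.
have tail_ge0 i : 0 <= \sum_(i <= j < n.+1) dprob dhigh j.
  rewrite big_nat; apply: sumr_ge0 => j h; apply: ltW; apply: dprob_gt0; lia.
have p2 : 0 < (2%:R : rat) ^+ (n + 1 - k) by rewrite exprn_gt0.
have Fk : 0 < dprob dhigh k by apply: dprob_gt0; lia.
have lev : bval n k < bval n k.+1 by apply: bval_lt; lia.
case: ltnP => [k1n|_]; last first.
  apply: le_trans (ltW lev); rewrite lerBlDr lerDl divr_ge0 // ?mulr_ge0 // ltW //.
rewrite dval_dhigh // bvalS //.
(* The values increase, so it remains to see that the subtracted terms decrease: the gap halves, the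
   tail does not grow, and [ps_ratio] lets the dividing probability shrink by a factor of at most
   two. *)
apply: lerB (ltW lev) _.
have -> : (2%:R : rat) ^+ (n + 1 - k) = 2%:R * 2%:R ^+ (n + 1 - k.+1).
  by rewrite -exprS; congr (_ ^+ _); lia.
have q2 : 0 < (2%:R : rat) ^+ (n + 1 - k.+1) by rewrite exprn_gt0.
have Fk1 : 0 < dprob dhigh k.+1 by apply: dprob_gt0; lia.
have FF : dprob dhigh k <= 2%:R * dprob dhigh k.+1.
  rewrite !dprob_dhigh // mulrA ler_pM2r ?invr_gt0 //.
  by rewrite -natrM ler_nat ps_ratio.
have TT : \sum_(k.+2 <= j < n.+1) dprob dhigh j <= \sum_(k.+1 <= j < n.+1) dprob dhigh j.
  by rewrite [leRHS]big_ltn ?lerDr 1?ltW //; lia.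
move: (tail_ge0 k.+2) TT q2 Fk Fk1 FF.
set T := \sum_(_ <= _ < _) _; set T' := \sum_(_ <= _ < _) _.
set p := dprob _ k; set q := dprob _ k.+1; set e := _ ^+ _.
move: T T' p q e => T T' p q e T0 TT e0 p0 q0 pq.
rewrite ler_pdivrMr // mulrAC ler_pdivlMr //.
have h1 : 0 <= e * T by rewrite mulr_ge0 // ltW.
have h2 : 0 <= e * q by rewrite mulr_ge0 // ltW.
have := ler_wpM2l h1 pq; have := ler_wpM2l h2 TT; lra.
Qed.

Lemma pay2_le A i j : (j < n)%N -> A i j = 2%N -> pay2 dhigh A i <= X - 8%:R.
Proof.
move=> jn Aij; rewrite /pay2 size_dhigh.
have le : (find (fun k => A i k == 2%N) (iota 0 n.+1) <= j)%N.
  by apply: find_iota_le; rewrite ?Aij //; lia.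
by rewrite dval_dhigh ?bval_le //; lia.
Qed.

Lemma pay2_leT A i : (A i n = 2)%N -> pay2 dhigh A i <= X - 4%:R.
Proof.
move=> Ain; rewrite /pay2 size_dhigh.
have le : (find (fun k => A i k == 2%N) (iota 0 n.+1) <= n)%N.
  by apply: find_iota_le; rewrite ?Ain.
by rewrite dval_dhigh ?bval_leT.
Qed.

Lemma pay1_le A j : pay1 dlow A j <= 6%:R.
Proof. by rewrite /pay1 /=; case: eqP => _ //; case: eqP. Qed.

Definition payoff (A : nat -> nat -> nat) i j : rat :=
  if A i j == 1%N then pay1 dlow A j else if A i j == 2%N then pay2 dhigh A i else 0.

Definition gain (A : nat -> nat -> nat) i j : rat :=
  if A i j == 1%N then dval dlow i else if A i j == 2%N then dval dhigh j else 0.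

(* Only then does bidder 2 pay the top value on row i. *)
Definition good (A : nat -> nat -> nat) i :=
  A i n = 2%N /\ forall j, (j < n)%N -> A i j <> 2%N.

Lemma avg_le (g : nat -> nat -> rat) c : (forall j, (j <= n)%N -> g 0%N j + g 1%N j <= c) ->
  \sum_(j < n) F j * ((g 0%N j + g 1%N j) / 2%:R)
  + (1 - 1 / X) * ((g 0%N n + g 1%N n) / 2%:R) <= c / 2%:R.
Proof.
move=> H; rewrite [leRHS](_ : _ = (1 / X) * (c / 2%:R) + (1 - 1 / X) * (c / 2%:R)); last by ring.
rewrite -F_sum mulr_suml; apply: lerD.
  apply: ler_sum => j _; rewrite ler_pM2l ?F_gt0 //.
  by rewrite ler_pM2r ?invr_gt0 // H // ltnW.
rewrite F_sum ler_pM2l; last by rewrite -dprob_top dprob_gt0.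
by rewrite ler_pM2r ?invr_gt0 // H.
Qed.

(** By [t_small] the subtracted term is at most the total mass 1/X below the top value, which leaves
    6/X of the 7/X in [base]. *)
Lemma Rthr_ge : X - 5%:R + 6%:R / X <= Rthr.
Proof.
rewrite /Rthr /base -/n -/X.
have : (t%:R + 1) / 2%:R ^+ D <= 1 / X.
  rewrite -F_sum -mulr_suml ler_pM2r ?invr_gt0 //.
  by rewrite natr1 -natr_sum ler_nat.
lra.
Qed.

(** If bidder 2 wins somewhere in a row, monotonicity makes him win in its top column too. Winning
    already in a lower column caps his threshold payment on the whole row at the second highest
    value, at most X - 8. *)
Lemma pay_le A i j : monotone2 2 n.+1 A -> (i < 2)%N -> (j <= n)%N ->
  payoff A i j <= X - 4%:R /\ (~ good A i -> payoff A i j <= X - 8%:R).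
Proof.
move=> mon i2 jn; have X16 := X_ge16; rewrite /payoff.
case: eqP => [_|_]; first by have := pay1_le A j; split; lra.
case: eqP => [E|_]; last by split; lra.
have Ain : A i n = 2%N.
  have [_ _ H] := mon i j i2 jn; apply: H => //; lia.
split; first exact: pay2_leT.
have [/existsP[k /eqP Aik] _|/existsPn H ng] := boolP [exists k : 'I_n, A i k == 2%N].
  exact: pay2_le Aik.
by case: ng; split=> // k kn; apply/eqP; apply: (H (Ordinal kn)).
Qed.

(** A bad row loses 4 against the maximum X - 4 in every column, hence 2 on average over the rows:
    the revenue would be at most X - 6, below the threshold. *)
Lemma good_rows A : monotone2 2 n.+1 A -> Rthr <= Rev dlow dhigh A -> good A 0 /\ good A 1.
Proof.
move=> mon; rewrite /Rev (sum_cells (payoff A)) => HR.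
have Rge := Rthr_ge.
have X0 : 0 < X by exact: pow2_gt0.
have bad : ~ (forall j, (j <= n)%N -> payoff A 0 j + payoff A 1 j <= X - 4%:R + (X - 8%:R)).
  move=> /avg_le; have : 0 < 6%:R / X by rewrite divr_gt0.
  by move: HR Rge; lra.
split; apply: Classical_Prop.NNPP => ng; apply: bad => j jn.
  by have [p1 p2] := pay_le (i := 0) mon isT jn; have [q1 q2] := pay_le (i := 1) mon isT jn; have p3 := p2 ng; lra.
by have [p1 p2] := pay_le (i := 0) mon isT jn; have [q1 q2] := pay_le (i := 1) mon isT jn; have q3 := q2 ng; lra.
Qed.

Lemma Xn0 : X != 0. Proof. by rewrite expf_neq0. Qed.

Lemma baseE : base (size ps) = 3%:R / X + (1 - 1 / X) * (X - 4%:R).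
Proof. by rewrite /base -/n -/X; field; exact: Xn0. Qed.

Definition pick_sum (S : nat -> bool) : nat := \sum_(j < size ps) S j * nth 0%N ps j.

Lemma sum_F (S : nat -> bool) : \sum_(j < n) F j * (S j)%:R = (pick_sum S)%:R / 2%:R ^+ D.
Proof.
rewrite natr_sum mulr_suml; apply: eq_bigr => j _.
by rewrite natrM /F mulrC mulrA.
Qed.

(** [S] marks the columns sold to bidder 1 at price 2 and [Z] those that he never wins; [a] is 1 for
    welfare and -1 for revenue. Price 6 is the reference case counted in [base]. *)
Lemma sum_cells_affine (g : nat -> nat -> rat) (S Z : nat -> bool) (a : rat) :
  (forall j, (j < n)%N -> g 0%N j + g 1%N j = 2%:R * (3%:R + a * (S j)%:R - 3%:R * (Z j)%:R)) ->
  g 0%N n + g 1%N n = 2%:R * (X - 4%:R) ->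
  \sum_(i < size dlow) \sum_(j < size dhigh) dprob dlow i * dprob dhigh j * g i j =
  base (size ps) + (a * (pick_sum S)%:R - 3%:R * (pick_sum Z)%:R) / 2%:R ^+ D.
Proof.
move=> H1 H2; rewrite sum_cells H2 baseE.
have -> : \sum_(j < n) F j * ((g 0%N j + g 1%N j) / 2%:R) =
    \sum_(j < n) (F j * 3%:R + (a * (F j * (S j)%:R) - 3%:R * (F j * (Z j)%:R))).
  by apply: eq_bigr => j _; rewrite H1 //; field.
rewrite big_split sumrB /= -mulr_suml -!mulr_sumr F_sum !sum_F.
by field; rewrite Xn0 expf_neq0.
Qed.

(** With both rows good, a lower column is sold at price 2, at price 6 or not at all. The columns of
    [S] count with opposite signs in the two totals, while an unsold column costs 3 in both. Unsold
    columns thus only tighten the inequalities, which leave a window of width two around [t] for the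
    sum over [S]. *)
Lemma SW_thresholdP :
  (exists A, [/\ monotone2 (size dlow) (size dhigh) A, Wthr <= SW dlow dhigh A
                & Rthr <= Rev dlow dhigh A]) <->
  exists S, (t <= (pick_sum S).+1)%N /\ (pick_sum S <= t.+1)%N.
Proof.
have D0 := pow2_gt0 D.
split=> [[A []]|[S [tS St]]].
  rewrite size_dhigh => mon HW HR.
  have [[A0n A0] [A1n A1]] := good_rows mon HR.
  pose S j := A 0%N j == 1%N; pose Z j := A 1%N j != 1%N.
  have SZ j : (j < n)%N -> S j -> ~~ Z j.
    move=> jn /eqP E; have [_ H _] := mon 0%N j isT (ltnW jn).
    by rewrite /Z (H E 1%N).
  have p2 i : good A i -> pay2 dhigh A i = X - 4%:R.
    move=> [An Aj]; rewrite /pay2 size_dhigh (@find_iota_eq _ _ n) //; last 2 first.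
    - by rewrite An.
    - by move=> k /Aj /eqP.
    by rewrite dval_dhigh // bval_top.
  move: HW HR; rewrite /SW /Rev.
  rewrite (@sum_cells_affine (gain A) S Z 1); last 2 first.
  - move=> j jn; have := SZ j jn; rewrite /gain /S /Z.
    have /eqP/negbTE -> := A0 j jn; have /eqP/negbTE -> := A1 j jn.
    case: (A 0%N j == 1%N); case: (A 1%N j == 1%N) => // h; rewrite /dval /=; lra.
  - rewrite /gain A0n A1n /= dval_dhigh // bval_top -/X; ring.
  rewrite (@sum_cells_affine (payoff A) S Z (-1)); last 2 first.
  - move=> j jn; have := SZ j jn; rewrite /payoff /S /Z /pay1 /=.
    have /eqP/negbTE -> := A0 j jn; have /eqP/negbTE -> := A1 j jn.
    case: (A 0%N j == 1%N); case: (A 1%N j == 1%N) => // h; rewrite /dval /=; lra.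
  - by rewrite /payoff A0n A1n /= !p2 //; lra.
  rewrite /Wthr /Rthr !lerD2l -!mulNr !ler_pM2r ?invr_gt0 //.
  have : 0 <= (pick_sum Z)%:R :> rat by [].
  move=> Z0 h1 h2; exists S; split.
    by rewrite -(ler_nat rat) -natr1; lra.
  by rewrite -(ler_nat rat) -[t.+1%:R]natr1; lra.
(* Bidder 2 wins in the top column only; in a lower column the price for bidder 1 is 2 on [S] and 6
   elsewhere. *)
pose A (i j : nat) : nat := if (j == n) then 2 else if (i == 0%N) && ~~ S j then 0 else 1.
exists A; rewrite size_dhigh.
have gA i : good A i.
  split; first by rewrite /A eqxx.
  by move=> j jn; rewrite /A (ltn_eqF jn); case: ifP.
have p2 i : pay2 dhigh A i = X - 4%:R.
  have [An Aj] := gA i; rewrite /pay2 size_dhigh (@find_iota_eq _ _ n) //; last 2 first.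
  - by rewrite An.
  - by move=> k /Aj /eqP.
  by rewrite dval_dhigh // bval_top.
have mon : monotone2 2 n.+1 A.
  move=> i j i2 jn; split.
  - by rewrite /A; case: ifP => // _; case: ifP.
  - rewrite /A; case: ifP => // _; case: ifP => // H _ k /andP[ik _].
    by move: H; case: i i2 ik => [|i] _ //=; case: k => [|k] //= _ -> .
  - rewrite {1}/A; case: ifP => [/eqP-> _ k h|]; last by case: ifP.
    by rewrite /A (_ : k = n) ?eqxx //; lia.
split=> //; rewrite /SW /Rev.
  rewrite (@sum_cells_affine (gain A) S (fun=> false) 1); last 2 first.
  - move=> j jn; rewrite /gain /A (ltn_eqF jn).
    by case: (S j); rewrite /dval /=; lra.
  - rewrite /gain /A eqxx /= dval_dhigh // bval_top -/X; ring.
  rewrite /Wthr lerD2l ler_pM2r ?invr_gt0 //.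
  rewrite {2}/pick_sum big1 ?mulr0 ?subr0 ?mul1r //.
  by move: tS; rewrite -(ler_nat rat) -natr1; lra.
rewrite (@sum_cells_affine (payoff A) S (fun=> false) (-1)); last 2 first.
- move=> j jn; rewrite /payoff /pay1 /A (ltn_eqF jn) /=.
  by case: (S j); rewrite /dval /=; lra.
- by rewrite /payoff !p2 /A eqxx /=; ring.
rewrite /Rthr lerD2l -!mulNr ler_pM2r ?invr_gt0 //.
rewrite {2}/pick_sum big1 ?mulr0 ?subr0 ?mulN1r //.
by rewrite lerN2 natr1 ler_nat.
Qed.

End Mechanism.

(** * Tilings as subset sums *)

Lemma digits_uniq (w n : nat) (x y : nat -> nat) :
  (forall c, c < n -> x c < w) -> (forall c, c < n -> y c < w) ->
  \sum_(c < n) w ^ c * x c = \sum_(c < n) w ^ c * y c ->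
  forall c, c < n -> x c = y c.
Proof.
elim: n x y => [//|n IH] x y hx hy.
rewrite !big_ord_recl !expn0 !mul1n /bump /=.
have E z : \sum_(i < n) w ^ (1 + i) * z (1 + i) = w * \sum_(i < n) w ^ i * z i.+1.
  by rewrite big_distrr /=; apply: eq_bigr => i _; rewrite expnS mulnA.
rewrite !E => H.
have x0 := hx 0 isT; have y0 := hy 0 isT.
have w0 : 0 < w by lia.
have E0 : x 0 = y 0.
  by rewrite -(modn_small x0) -(modn_small y0) -(modnMDl (\sum_(i < n) w ^ i * x i.+1) (x 0))
    -(modnMDl (\sum_(i < n) w ^ i * y i.+1) (y 0)) ![_ * w + _]addnC ![_ * w]mulnC H.
case=> [|c] // hc.
apply: (IH (fun i => x i.+1) (fun i => y i.+1)) => //; [by move=> i hi; apply: hx | by move=> i hi; apply: hy|].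
by move: H; rewrite E0; move/eqP; rewrite eqn_add2l eqn_pmul2l // => /eqP.
Qed.

(** Contributions that land [e] positions further on are reindexed by the position where they land,
    so that all digits of one position can be collected. *)
Lemma shift_sum (w G e N : nat) (g : nat -> nat) : G + e <= N ->
  \sum_(a < G) w ^ (a + e) * g a =
  \sum_(c < N) w ^ c * (if (e <= c) && (c < G + e) then g (c - e) else 0).
Proof.
move=> h; rewrite -(big_mkord xpredT (fun a => w ^ (a + e) * g a)).
rewrite -(big_mkord xpredT (fun c => w ^ c * (if (e <= c) && (c < G + e) then g (c - e) else 0))).
set F := fun c => w ^ c * (if (e <= c) && (c < G + e) then g (c - e) else 0).
have z1 : \sum_(0 <= c < e) F c = 0.
  by rewrite big_nat big1 // => c hc; rewrite /F; case: ifP; lia.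
have z2 : \sum_(G + e <= c < N) F c = 0.
  by rewrite big_nat big1 // => c hc; rewrite /F; case: ifP; lia.
rewrite (big_cat_nat (n := e) (m := 0) (p := N)) ?z1 ?add0n //=; last lia.
rewrite (big_cat_nat (n := G + e) (m := e) (p := N)) ?z2 ?addn0 //=; last lia.
rewrite add0n -{2}[e]add0n big_addn addnK addn0 big_nat [RHS]big_nat.
by apply: eq_bigr => a ha; rewrite /F addnK; case: ifP => //; lia.
Qed.

Lemma sum_ord_mul (G K : nat) (F : nat -> nat) :
  \sum_(j < G * K) F j = \sum_(a < G) \sum_(k < K) F (a * K + k).
Proof.
elim: G => [|G IH]; first by rewrite !big_ord0.
rewrite big_ord_recr /= -IH -!(big_mkord xpredT F) mulSn addnC.
rewrite (big_cat_nat (n := G * K)) //=; last lia.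
congr (_ + _); rewrite -{1}[G * K]add0n big_addn.
rewrite (_ : G * K + K - G * K = K); last lia.
by rewrite big_mkord; apply: eq_bigr => k _; rewrite addnC.
Qed.

Lemma sum_select (n k : nat) (S g : nat -> nat) : k < n ->
  (forall i, i < n -> S i = (i == k)) -> \sum_(i < n) S i * g i = g k.
Proof.
move=> kn H; rewrite (bigD1 (Ordinal kn)) //= H // eqxx mul1n big1 ?addn0 // => i ne.
rewrite H // (_ : (i == k :> nat) = false) //; apply/negbTE.
by apply: contra ne => /eqP e; apply/eqP/val_inj.
Qed.

Lemma sum1_unique (n : nat) (S : nat -> bool) : \sum_(i < n) S i = 1 ->
  exists2 k, k < n & forall i, i < n -> S i = (i == k).
Proof.
move=> H.
have [/existsP[k Sk]|/existsPn h] := boolP [exists k : 'I_n, S k]; last first.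
  by move: H; rewrite big1 // => i _; rewrite (negbTE (h i)).
exists k => // i hi; have [->//|ne] := eqVneq i k.
have ne' : Ordinal hi != k by apply: contra ne => /eqP <-.
move: H; rewrite (bigD1 k) //= Sk => -[] /eqP.
by rewrite sum_nat_eq0 => /forallP /(_ (Ordinal hi)) /=; rewrite ne' /= eqb0 => /negbTE.
Qed.

Fixpoint fw (b v : nat) : seq bool := if b is b'.+1 then odd v :: fw b' v./2 else [::].

Lemma size_fw b v : size (fw b v) = b.
Proof. by elim: b v => //= b IH v; rewrite IH. Qed.

Lemma val_fw b v : v < 2 ^ b -> val (fw b v) = v.
Proof.
elim: b v => [|b IH] v /=; first by case: v.
by rewrite expnS => h; rewrite IH ?odd_double_half //; lia.
Qed.

Definition blk (b x y z : nat) := fw b x ++ fw b y ++ fw b z.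

Lemma size_blk b x y z : size (blk b x y z) = 3 * b.
Proof. rewrite !size_cat !size_fw; lia. Qed.

Lemma val_blk b x y z : x < 2 ^ b -> y < 2 ^ b -> z < 2 ^ b ->
  val (blk b x y z) = x + 2 ^ b * (y + 2 ^ b * z).
Proof. by move=> hx hy hz; rewrite !val_cat !size_fw !val_fw. Qed.

Lemma blk_inj b x y z x' y' z' : x < 2 ^ b -> y < 2 ^ b -> z < 2 ^ b ->
  x' < 2 ^ b -> y' < 2 ^ b -> z' < 2 ^ b ->
  x + 2 ^ b * (y + 2 ^ b * z) = x' + 2 ^ b * (y' + 2 ^ b * z') ->
  [/\ x = x', y = y' & z = z'].
Proof.
move=> hx hy hz hx' hy' hz' H.
have D := @digits_uniq (2 ^ b) 3 (nth 0 [:: x; y; z]) (nth 0 [:: x'; y'; z']).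
have {}D : forall c, c < 3 -> nth 0 [:: x; y; z] c = nth 0 [:: x'; y'; z'] c.
  apply: D; try by case=> [|[|[|]]].
  rewrite !big_ord_recl !big_ord0 /= /bump /= expn0 expn1 expnS expn1; nia.
by split; [apply: (D 0) | apply: (D 1) | apply: (D 2)].
Qed.

Lemma val_flatten (u n : nat) (T : nat -> seq bool) : (forall c, c < n -> size (T c) = u) ->
  val (flatten (mkseq T n)) = \sum_(c < n) (2 ^ u) ^ c * val (T c) /\
  size (flatten (mkseq T n)) = n * u.
Proof.
elim: n => [|n IH] h; first by rewrite big_ord0.
have [I1 I2] := IH (fun c hc => h c (ltnW hc)).
rewrite -addn1 /mkseq iotaD map_cat flatten_cat /= cats0 val_cat size_cat -/(mkseq T n) I1 I2.
rewrite add0n h // addn1 big_ord_recr /= -expnM [u * n]mulnC; split=> //; lia.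
Qed.

Section Select.
Variables (K b C G Wd : nat) (l r tp bo ini : nat -> nat).
Hypotheses (r_le : forall k, r k <= C) (bo_le : forall k, bo k <= C)
  (C_gt0 : 0 < C) (K_gt0 : 0 < K) (b_big : 2 * K * C < 2 ^ b) (Wd_gt1 : 1 < Wd) (Wd_le : Wd <= G).

(* A position of the helix owns three digits: the number of tiles, a horizontal edge and a vertical
   edge.  A tile adds the complements to C of its left and top colours at its own position, its right
   colour one position later and its bottom colour Wd positions later: matching means digit sum C. *)
Definition blkA k := blk b 1 (C - l k) (C - tp k).
Definition blkB k := blk b 0 (r k) 0.
Definition blkC k := blk b 0 0 (bo k).
Definition blkT c :=
  if c < Wd then blk b 1 C (C - ini c) else if c < G then blk b 1 C C else blk b 0 0 0.

(** [blkA] and [blkB] fill the positions [a] and [a + 1], so [Wd - 2] empty positions bring [blkC]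
    to [a + Wd]. The final padding gives all numbers the same length. *)
Definition num a k :=
  nseq (3 * b * a) false ++ blkA k ++ blkB k ++ nseq (3 * b * (Wd - 2)) false
  ++ blkC k ++ nseq (3 * b * (G - 1 - a)) false.

Definition tgt := flatten (mkseq blkT (G + Wd)).

Let w := 2 ^ (3 * b).

Let small x : x <= C -> x < 2 ^ b.
Proof. by move=> h; apply: leq_ltn_trans h _; apply: leq_ltn_trans b_big; nia. Qed.

Let small1 : 1 < 2 ^ b.
Proof. by apply: leq_ltn_trans b_big; nia. Qed.

Let small0 : 0 < 2 ^ b.
Proof. exact: ltnW small1. Qed.

Lemma size_num a k : a < G -> size (num a k) = 3 * b * (G + Wd).
Proof. by move=> h; rewrite !size_cat !size_nseq !size_fw; nia. Qed.

Lemma val_num a k :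
  val (num a k) = w ^ (a + 0) * val (blkA k) + w ^ (a + 1) * val (blkB k) + w ^ (a + Wd) * val (blkC k).
Proof.
rewrite /num.
have := size_blk b 1 (C - l k) (C - tp k); rewrite -/(blkA k); move: (blkA k) => A sA.
have := size_blk b 0 (r k) 0; rewrite -/(blkB k); move: (blkB k) => B sB.
have := size_blk b 0 0 (bo k); rewrite -/(blkC k); move: (blkC k) => Z sZ.
rewrite !val_cat !val_nseq0 !size_nseq sA sB sZ muln0 addn0.
have -> : w ^ (a + Wd) = 2 ^ (3 * b * a) * (w * (w * 2 ^ (3 * b * (Wd - 2)))).
  by rewrite /w -!expnM -!expnD; congr (2 ^ _); nia.
rewrite addn0 addn1 expnS /w -!expnM; ring.
Qed.

(** [X0], [X1] and [X2] are the three digits at position [c] of the sum of the numbers selected by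
    [S]. *)
Definition X0 (S : nat -> bool) c := if c < G then \sum_(k < K) S (c * K + k) else 0.
Definition X1 (S : nat -> bool) c :=
  (if c < G then \sum_(k < K) S (c * K + k) * (C - l k) else 0) +
  (if (0 < c) && (c <= G) then \sum_(k < K) S ((c - 1) * K + k) * r k else 0).
Definition X2 (S : nat -> bool) c :=
  (if c < G then \sum_(k < K) S (c * K + k) * (C - tp k) else 0) +
  (if (Wd <= c) && (c < G + Wd) then \sum_(k < K) S ((c - Wd) * K + k) * bo k else 0).

Let sum_le (S : nat -> bool) (f g : nat -> nat) : (forall k, g k <= C) ->
  \sum_(k < K) S (f k) * g k <= K * C.
Proof.
move=> h; rewrite -[K in K * C]card_ord -sum_nat_const; apply: leq_sum => k _.
by case: (S _) => //; rewrite mul1n h.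
Qed.

(** Whatever [S] is, even with several types chosen for one cell, a digit collects at most [2 * K]
    terms of size at most [C]. By [b_big] this is less than the base, so there are never carries. *)
Lemma X0_lt S c : X0 S c < 2 ^ b.
Proof.
rewrite /X0; case: ifP => // _.
have := @sum_le S (fun k => c * K + k) (fun=> 1) (fun=> C_gt0).
under eq_bigr => k _ do rewrite muln1.
move=> h; apply: leq_ltn_trans h _; apply: leq_ltn_trans b_big; nia.
Qed.

Lemma X1_lt S c : X1 S c < 2 ^ b.
Proof.
have h1 := @sum_le S (fun k => c * K + k) (fun k => C - l k) (fun k => leq_subr _ _).
have h2 := @sum_le S (fun k => (c - 1) * K + k) r r_le.
apply: (@leq_ltn_trans (K * C + K * C)); last by rewrite addnn -mul2n mulnA.
by rewrite /X1; apply: leq_add; case: ifP.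
Qed.

Lemma X2_lt S c : X2 S c < 2 ^ b.
Proof.
have h1 := @sum_le S (fun k => c * K + k) (fun k => C - tp k) (fun k => leq_subr _ _).
have h2 := @sum_le S (fun k => (c - Wd) * K + k) bo bo_le.
apply: (@leq_ltn_trans (K * C + K * C)); last by rewrite addnn -mul2n mulnA.
by rewrite /X2; apply: leq_add; case: ifP.
Qed.

Lemma num_sum (S : nat -> bool) :
  \sum_(j < G * K) S j * val (num (j %/ K) (j %% K)) =
  \sum_(c < G + Wd) w ^ c * (X0 S c + 2 ^ b * (X1 S c + 2 ^ b * X2 S c)).
Proof.
rewrite (sum_ord_mul G K (fun j => S j * val (num (j %/ K) (j %% K)))).
pose sA (a : nat) := \sum_(k < K) S (a * K + k) * val (blkA k).
pose sB (a : nat) := \sum_(k < K) S (a * K + k) * val (blkB k).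
pose sC (a : nat) := \sum_(k < K) S (a * K + k) * val (blkC k).
transitivity (\sum_(a < G) (w ^ (a + 0) * sA a + w ^ (a + 1) * sB a + w ^ (a + Wd) * sC a)).
  apply: eq_bigr => a _; rewrite !big_distrr -!big_split /=; apply: eq_bigr => k _.
  by rewrite divnMDl // divn_small // addn0 modnMDl modn_small // val_num !addn0; ring.
rewrite !big_split /=.
rewrite (@shift_sum _ _ _ (G + Wd)) ?leq_add2l //.
rewrite (@shift_sum _ _ 1 (G + Wd)) ?leq_add2l // 1?ltnW //.
rewrite (@shift_sum _ _ Wd (G + Wd)) //.
rewrite -!big_split /=; apply: eq_bigr => c _; rewrite -!mulnDr; congr (_ * _).
rewrite addn0 subn0 /= addn1 ltnS /X0 /X1 /X2.
have -> : sA c = \sum_(k < K) S (c * K + k) + 2 ^ b * (\sum_(k < K) S (c * K + k) * (C - l k)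
     + 2 ^ b * \sum_(k < K) S (c * K + k) * (C - tp k)).
  rewrite mulnDr !big_distrr -!big_split /=; apply: eq_bigr => k _.
  by rewrite val_blk ?small ?leq_subr //; ring.
have -> : sB (c - 1) = 2 ^ b * \sum_(k < K) S ((c - 1) * K + k) * r k.
  by rewrite big_distrr; apply: eq_bigr => k _; rewrite val_blk ?small //=; ring.
have -> : sC (c - Wd) = 2 ^ b * (2 ^ b * \sum_(k < K) S ((c - Wd) * K + k) * bo k).
  by rewrite !big_distrr; apply: eq_bigr => k _; rewrite val_blk ?small //=; ring.
case: ifP => _; case: ifP => _; case: ifP => _; ring.
Qed.

(** From [G] on, only bottom colours of the last cells contribute; the digit 0 forces them to be the
    border colour. *)
Definition T2 c := if c < Wd then C - ini c else if c < G then C else 0.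

Lemma val_tgt : val tgt = \sum_(c < G + Wd) w ^ c *
  ((c < G) + 2 ^ b * ((if c < G then C else 0) + 2 ^ b * T2 c)).
Proof.
have [] := @val_flatten (3 * b) (G + Wd) blkT.
  by move=> c _; rewrite /blkT; case: ifP => _; [|case: ifP => _]; rewrite size_blk.
move=> E _; rewrite /tgt E; apply: eq_bigr => c _; congr (_ * _).
rewrite /blkT /T2; have [h|h] := ltnP c Wd.
  have cG : c < G by apply: leq_trans Wd_le.
  by rewrite val_blk ?cG ?small ?leq_subr.
by case: (ltnP c G) => _; rewrite val_blk ?small.
Qed.

Lemma size_tgt : size tgt = 3 * b * (G + Wd).
Proof.
have [] := @val_flatten (3 * b) (G + Wd) blkT; last by move=> _ ->; rewrite mulnC.
by move=> c _; rewrite /blkT; case: ifP => _; [|case: ifP => _]; rewrite size_blk.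
Qed.

Definition Tiled (kap : nat -> nat) := [/\ forall a, a < G -> kap a < K,
  forall c, c <= G -> (if c < G then C - l (kap c) else 0) +
     (if 0 < c then r (kap (c - 1)) else 0) = if c < G then C else 0 &
  forall c, c < G + Wd -> (if c < G then C - tp (kap c) else 0) +
     (if Wd <= c then bo (kap (c - Wd)) else 0) = T2 c].

(** Without carries the equation splits into digits. The first digit of each position says that
    exactly one type is chosen for the cell, which turns [S] into the function [kap]; the other two
    digits are the matching conditions. *)
Lemma subset_sum_tiled :
  (exists S : nat -> bool, \sum_(j < G * K) S j * val (num (j %/ K) (j %% K)) = val tgt
    /\ \sum_(j < G * K) S j = G) <->
  exists kap, Tiled kap.
Proof.
have pick (S : nat -> bool) (kap g : nat -> nat) a : a < G -> kap a < K ->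
    (forall i, i < K -> S (a * K + i) = (i == kap a)) ->
    \sum_(k < K) S (a * K + k) * g k = g (kap a).
  by move=> aG kK h; apply: (@sum_select K (kap a) (fun k => S (a * K + k))) => // i hi; rewrite h.
split=> [[S []]|[kap [kK hE hV]]].
  rewrite num_sum val_tgt => H _.
  have D c : c < G + Wd -> [/\ X0 S c = (c < G), X1 S c = (if c < G then C else 0) & X2 S c = T2 c].
    move=> hc.
    have hT : T2 c < 2 ^ b by rewrite /T2; case: ifP => _; [|case: ifP => _]; rewrite ?small ?leq_subr.
    have hC : (if c < G then C else 0) < 2 ^ b by case: ifP => _; rewrite ?small.
    have h1 : (c < G) < 2 ^ b by case: (c < G).
    apply: (@blk_inj b); rewrite ?X0_lt ?X1_lt ?X2_lt //.
    apply: (@digits_uniq w (G + Wd)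
      (fun c => X0 S c + 2 ^ b * (X1 S c + 2 ^ b * X2 S c))
      (fun c => (c < G) + 2 ^ b * ((if c < G then C else 0) + 2 ^ b * T2 c))) => // d hd.
      have := X0_lt S d; have := X1_lt S d; have := X2_lt S d.
      by rewrite /w (_ : 2 ^ (3 * b) = 2 ^ b * (2 ^ b * 2 ^ b)); [nia | rewrite -!expnD; congr (2 ^ _); lia].
    have hT' : T2 d < 2 ^ b by rewrite /T2; case: ifP => _; [|case: ifP => _]; rewrite ?small ?leq_subr.
    have hC' : (if d < G then C else 0) < 2 ^ b by case: ifP => _; rewrite ?small.
    have h1' : (d < G) < 2 ^ b by case: (d < G).
    move: hT' hC' h1'; set x := T2 d; set y := (if _ then _ else _); set z := nat_of_bool _.
    by rewrite /w (_ : 2 ^ (3 * b) = 2 ^ b * (2 ^ b * 2 ^ b)); [nia | rewrite -!expnD; congr (2 ^ _); lia].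
  have U a : exists k, a < G -> k < K /\ forall i, i < K -> S (a * K + i) = (i == k).
    have [aG|aG] := ltnP a G; last by exists 0.
    have [] := D a (ltn_addr _ aG); rewrite /X0 aG => /(@sum1_unique K (fun k => S (a * K + k)))[k kK h] _ _.
    by exists k.
  have [kap hk] : exists kap : nat -> nat, forall a, a < G ->
      kap a < K /\ forall i, i < K -> S (a * K + i) = (i == kap a).
    (* Decidability allows [kap a] to be defined as a least witness. *)
    have dec a k : decidable (a < G -> k < K /\ forall i, i < K -> S (a * K + i) = (i == k)).
      have [aG|aG] := ltnP a G; last by left.
      have [hb|hb] := boolP ((k < K) && [forall i : 'I_K, S (a * K + i) == (i == k :> nat)]).
        left=> _; move/andP: hb => [kK /forallP h]; split=> // i hi.
        by have /eqP := h (Ordinal hi).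
      right=> /(_ isT)[kK h]; case/negP: hb; rewrite kK; apply/forallP => i; apply/eqP.
      exact: h.
    pose P a := fun k => sumbool_rect (fun=> bool) (fun=> true) (fun=> false) (dec a k).
    have PP a k : reflect (a < G -> k < K /\ forall i, i < K -> S (a * K + i) = (i == k)) (P a k).
      by rewrite /P; case: (dec a k) => h /=; constructor.
    have ex a : exists k, P a k by have [k h] := U a; exists k; apply/PP.
    exists (fun a => ex_minn (ex a)) => a.
    by case: ex_minnP => k /PP.
  exists kap; split=> [a /hk[] //|c cG|c cG].
    have [_ + _] := D c (leq_ltn_trans cG (ltac:(lia) : G < G + Wd)).
    rewrite /X1 cG andbT => <-; congr (_ + _); case: ifP => // h.
      by have [h1 h2] := hk c h; exact: esym (pick S kap (fun k => C - l k) _ _ _ _).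
    have h3 : c - 1 < G by lia.
    by have [h1 h2] := hk _ h3; exact: esym (pick S kap r _ _ _ _).
  have [_ _ <-] := D c cG.
  rewrite /X2 cG andbT; congr (_ + _); case: ifP => // h.
    by have [h1 h2] := hk c h; exact: esym (pick S kap (fun k => C - tp k) _ _ _ _).
  have h3 : c - Wd < G by lia.
  by have [h1 h2] := hk _ h3; exact: esym (pick S kap bo _ _ _ _).
pose S j := (j %% K == kap (j %/ K)).
have hS a i : i < K -> S (a * K + i) = (i == kap a).
  by move=> iK; rewrite /S divnMDl // divn_small // addn0 modnMDl modn_small.
have pk a (g : nat -> nat) : a < G -> \sum_(k < K) S (a * K + k) * g k = g (kap a).
  by move=> aG; apply: (pick S kap) => //; [apply: kK | move=> i; apply: hS].
exists S; split; last first.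
  rewrite (sum_ord_mul G K S) -[RHS]card_ord -sum1_card; apply: eq_bigr => a _.
  by rewrite -[RHS](pk a (fun=> 1)) //; apply: eq_bigr => k _; rewrite muln1.
rewrite num_sum val_tgt; apply: eq_bigr => -[c cG] _ /=; congr (_ * _).
have -> : X0 S c = (c < G).
  rewrite /X0; case: ifP => // h.
  by rewrite -[RHS](pk c (fun=> 1) h); apply: eq_bigr => k _; rewrite muln1.
have -> : X2 S c = T2 c.
  rewrite /X2 -hV // cG andbT; congr (_ + _); case: ifP => h //.
    exact: (pk c (fun k => C - tp k)).
  by apply: (pk (c - Wd) bo); lia.
have -> // : X1 S c = if c < G then C else 0.
rewrite /X1; have [cG'|cG'] := leqP c G; last by rewrite andbF; case: ifP => //; lia.
rewrite -hE // andbT; congr (_ + _); case: ifP => h //.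
  exact: (pk c (fun k => C - l k)).
by apply: (pk (c - 1) r); lia.
Qed.

End Select.

(** * Padding the numbers into admissible probabilities *)

Lemma last_nseq (b : bool) n : last b (nseq n b) = b.
Proof. by elim: n. Qed.

Section Items.
Variables (m k0 L : nat) (num : nat -> nat -> seq bool) (tg : seq bool).
Hypotheses (m_gt0 : 0 < m) (size_num : forall a k, a < 2 ^ m -> size (num a k) = L)
  (size_tg : size tg = L).

Let K := 2 ^ k0.
Let G := 2 ^ m.
Let f := 2 * m + k0 + L + 3.
Let E := m + f + 2.
Let NK := G * K.
Definition nit := 2 * (2 ^ m * 2 ^ k0).
Definition Dexp := 4 * m + 2 * k0 + L + nit + 8.

(* The items with phi = true complement the others to 2 ^ E.  They make the total a power of two,
   as needed for the probabilities, and each of them exceeds the target. *)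
Definition pbits (phi : bool) a k :=
  true :: nseq m phi ++ map (addb phi) (num a k) ++ nseq (m + k0 + 2) phi
  ++ (if phi then false :: nseq m.+1 true else [:: true]).

Definition pnum phi j := val (pbits phi (j %/ 2 ^ k0) (j %% 2 ^ k0)).
Definition items := mkseq (pnum false) (2 ^ m * 2 ^ k0) ++ mkseq (pnum true) (2 ^ m * 2 ^ k0).
(** The sum of [2 ^ m] items of the first kind whose numbers add up to [val tg]: the lowest bits and
    the leading bits each count the items. *)
Definition target := 2 ^ m + 2 ^ m.+1 * val tg + 2 ^ (m + f).

Lemma last_pbits phi a k : last true (pbits phi a k).
Proof. by rewrite /pbits; case: phi; rewrite /= !last_cat //= last_nseq. Qed.

Lemma divK_lt j : j < NK -> j %/ K < 2 ^ m.
Proof. by move=> h; rewrite ltn_divLR ?expn_gt0. Qed.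

(** The lowest bit makes the item odd, and the [m] zeros after it leave room to count up to [2 ^ m]
    items. The [m + k0 + 2] zeros below the leading bit absorb the carries of all [2 ^ (m + k0)]
    items at once. *)
Lemma pnum0 j : j < NK ->
  pnum false j = 1 + 2 ^ m.+1 * val (num (j %/ K) (j %% K)) + 2 ^ f.
Proof.
move=> /divK_lt /size_num sz; rewrite /pnum /pbits val_cons !val_cat !size_map !size_nseq.
rewrite !val_nseq0 sz -/K (map_id_in (s := num _ _)) //= muln1 add0n.
rewrite expnS /f (_ : 2 * m + k0 + L + 3 = (m + (L + (m + k0 + 2))).+1); last lia.
rewrite [2 ^ (_.+1)]expnS !expnD; ring.
Qed.

(** Above their common lowest bit 1, the two words are complementary. *)
Lemma pnum_add j : j < NK -> pnum true j + pnum false j = 2 ^ E.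
Proof.
move=> /divK_lt /size_num sz.
pose rest := nseq m false ++ num (j %/ K) (j %% K) ++ nseq (m + k0 + 2) false ++ true :: nseq m.+1 false.
have -> : pnum true j = val (true :: map negb rest).
  by rewrite /pnum /pbits /rest !map_cat !map_nseq /= map_nseq.
have -> : pnum false j = val (true :: rest).
  have -> : rest = (nseq m false ++ num (j %/ K) (j %% K) ++ nseq (m + k0 + 2) false
      ++ [:: true]) ++ nseq m.+1 false by rewrite /rest -!catA.
  rewrite -cat_cons [in RHS]val_cat val_nseq0 muln0 addn0.
  by rewrite /pnum /pbits (map_id_in (s := num _ _)).
have := val_flip rest; rewrite !val_cons.
have -> : size rest = E.-1 by rewrite /rest !size_cat /= !size_nseq sz /E /f; lia.
rewrite (_ : E = E.-1.+1) ?expnS /=; last by rewrite /E; lia.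
by move=> <-; lia.
Qed.

Lemma num_lt j : j < NK -> val (num (j %/ K) (j %% K)) < 2 ^ L.
Proof. by move=> /divK_lt /size_num sz; rewrite -(sz (j %% K)) val_lt. Qed.

Lemma size_items : size items = nit.
Proof. by rewrite size_cat !size_mkseq /nit mul2n addnn. Qed.

Lemma nth_items1 j : j < NK -> nth 0 items j = pnum false j.
Proof. by move=> h; rewrite nth_cat size_mkseq -/G -/K -/NK h nth_mkseq. Qed.

Lemma nth_items2 j : j < NK -> nth 0 items (NK + j) = pnum true j.
Proof.
move=> h; rewrite nth_cat size_mkseq -/G -/K -/NK ltnNge leq_addr /= addKn nth_mkseq //.
Qed.

Lemma sum_items (F : nat -> nat -> nat) : \sum_(j < nit) F j (nth 0 items j) =
  \sum_(j < NK) F j (pnum false j) + \sum_(j < NK) F (NK + j) (pnum true j).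
Proof.
rewrite /nit -/G -/K -/NK mul2n -addnn big_split_ord /=; congr (_ + _).
  by apply: eq_bigr => j _; rewrite nth_items1.
by apply: eq_bigr => j _; rewrite nth_items2.
Qed.

Lemma NKE : NK = 2 ^ (m + k0). Proof. by rewrite expnD. Qed.

Lemma total_items : \sum_(j < nit) nth 0 items j = 2 ^ (m + k0) * 2 ^ E.
Proof.
rewrite (sum_items (fun _ x => x)) -big_split /=.
under eq_bigr => j _ do rewrite addnC pnum_add //.
by rewrite sum_nat_const card_ord NKE.
Qed.

Lemma items_sum : (\sum_(j < size items) nth 0 items j) * 2 ^ (size items + 3) = 2 ^ Dexp.
Proof. by rewrite size_items total_items -!expnD; congr (2 ^ _); rewrite /Dexp /E /f; lia. Qed.

Lemma pow_f : 2 ^ f = 8 * (2 ^ m * 2 ^ m * 2 ^ k0 * 2 ^ L).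
Proof. by rewrite (_ : 8 = 2 ^ 3) // -!expnD; congr (2 ^ _); rewrite /f; lia. Qed.

Lemma pow_E : 2 ^ E = 4 * (2 ^ m * 2 ^ f).
Proof. by rewrite (_ : 4 = 2 ^ 2) // -!expnD; congr (2 ^ _); rewrite /E; lia. Qed.

Lemma pnum0_lt j : j < NK -> pnum false j < 2 * 2 ^ f.
Proof.
move=> h; rewrite pnum0 //; have := num_lt h; rewrite pow_f expnS.
have a0 : 1 < 2 ^ m by rewrite -{1}(expn0 2) ltn_exp2l.
have k1 : 0 < 2 ^ k0 by rewrite expn_gt0.
set x := val _; set a := 2 ^ m in a0 *; set k := 2 ^ k0 in k1 *; set l := 2 ^ L => hx.
have : a * x < a * l by rewrite ltn_pmul2l; lia.
have : a * l <= a * l * (a * k) by rewrite leq_pmulr // muln_gt0; lia.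
nia.
Qed.

Lemma pnum0_ge j : j < NK -> 2 ^ f <= pnum false j.
Proof. by move=> h; rewrite pnum0 //; lia. Qed.

Lemma target_bound : 2 ^ m + 2 ^ m.+1 * val tg + 4 <= 2 ^ f.
Proof.
have := val_lt tg; rewrite size_tg pow_f expnS.
have a0 : 1 < 2 ^ m by rewrite -{1}(expn0 2) ltn_exp2l.
have k1 : 0 < 2 ^ k0 by rewrite expn_gt0.
set x := val _; set a := 2 ^ m in a0 *; set k := 2 ^ k0 in k1 *; set l := 2 ^ L => hx.
have : a * x < a * l by rewrite ltn_pmul2l; lia.
have : a * l <= a * l * (a * k) by rewrite leq_pmulr // muln_gt0; lia.
have : a <= a * l * (a * k) by rewrite -mulnA leq_pmulr // !muln_gt0; lia.
nia.
Qed.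

Lemma items_pos j : j < size items -> 0 < nth 0 items j.
Proof.
rewrite size_items /nit -/G -/K -/NK => h.
have [jl|jl] := ltnP j NK; first by rewrite nth_items1 // pnum0.
have jl' : j - NK < NK by lia.
by rewrite -(subnKC jl) nth_items2.
Qed.

(** Items of the first kind lie between [2 ^ f] and twice that, and those of the second kind within
    [2 * 2 ^ f] of [2 ^ E]. Placing the small kind first makes the one large jump an increase, which
    the condition permits. *)
Lemma items_ratio j : j.+1 < size items -> nth 0 items j <= 2 * nth 0 items j.+1.
Proof.
rewrite size_items /nit -/G -/K -/NK => h; have p0 : 0 < 2 ^ f by rewrite expn_gt0.
have a0 : 1 < 2 ^ m by rewrite -{1}(expn0 2) ltn_exp2l.
have aF : 2 * 2 ^ f <= 2 ^ m * 2 ^ f by rewrite leq_mul2r a0 orbT.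
have [jl|jl] := ltnP j.+1 NK.
  have jl' : j < NK by lia.
  by rewrite !nth_items1 //; have := pnum0_lt jl'; have := pnum0_ge jl; lia.
have hs : j.+1 - NK < NK by lia.
have eqs := pnum_add hs; have ls := pnum0_lt hs.
have -> : nth 0 items j.+1 = pnum true (j.+1 - NK) by rewrite -{1}(subnKC jl) nth_items2.
have [jl2|jl2] := ltnP j NK.
  by rewrite nth_items1 //; have := pnum0_lt jl2; move: eqs; rewrite pow_E; lia.
have hs2 : j - NK < NK by lia.
have eqs2 := pnum_add hs2.
have -> : nth 0 items j = pnum true (j - NK) by rewrite -{1}(subnKC jl2) nth_items2.
by move: eqs eqs2; rewrite pow_E; lia.
Qed.

Lemma target_small : target.+1 <= \sum_(j < size items) nth 0 items j.
Proof.
rewrite size_items total_items /target.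
have tb := target_bound; rewrite pow_E [2 ^ (m + f)]expnD.
have h1 : 2 ^ f <= 2 ^ m * 2 ^ f by rewrite leq_pmull // expn_gt0.
have h2 : 2 ^ m * 2 ^ f <= 2 ^ (m + k0) * (2 ^ m * 2 ^ f) by rewrite leq_pmull // expn_gt0.
by rewrite mulnCA; lia.
Qed.

(** A single item of the second kind overshoots, so none is chosen. The rest of the sum below the
    leading bits stays under [2 ^ f], slack included, so the leading bits show that exactly [2 ^ m]
    items are chosen. After that the slack of one is smaller than the unit [2 ^ m.+1] in which the
    numbers are counted. *)
Lemma pick_sum_target :
  (exists S, target <= (pick_sum items S).+1 /\ pick_sum items S <= target.+1) <->
  (exists S : nat -> bool, \sum_(j < NK) S j * val (num (j %/ K) (j %% K)) = val tg
     /\ \sum_(j < NK) S j = G).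
Proof.
have tb := target_bound; have p0 : 0 < 2 ^ f by rewrite expn_gt0.
have a1 : 1 < 2 ^ m by rewrite -{1}(expn0 2) ltn_exp2l.
have k1 : 0 < 2 ^ k0 by rewrite expn_gt0.
have sumE (S : nat -> bool) : \sum_(j < NK) S j * pnum false j =
    \sum_(j < NK) S j + 2 ^ m.+1 * (\sum_(j < NK) S j * val (num (j %/ K) (j %% K)))
    + 2 ^ f * \sum_(j < NK) S j.
  rewrite !big_distrr -!big_split /=; apply: eq_bigr => j _; rewrite pnum0 //; ring.
have pe (S : nat -> bool) : pick_sum items S = \sum_(j < NK) S j * pnum false j
    + \sum_(j < NK) S (NK + j) * pnum true j.
  by rewrite /pick_sum size_items (sum_items (fun j x => S j * x)).
split=> [[S]|[S [h1 h2]]].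
  rewrite pe => -[tS St]; exists S.
  have z : \sum_(j < NK) S (NK + j) * pnum true j = 0.
    apply: big1 => j _; case E1: (S (NK + j)) => //.
    have aF : 2 * 2 ^ f <= 2 ^ m * 2 ^ f by rewrite leq_mul2r a1 orbT.
    have : pnum true j <= \sum_(j < NK) S (NK + j) * pnum true j.
      by rewrite (bigD1 j) //= E1 mul1n leq_addr.
    have := pnum_add (ltn_ord j); have := pnum0_lt (ltn_ord j).
    move: St; rewrite /target pow_E expnD; set s1 := \sum_(_ < _) _; set s2 := \sum_(_ < _) _; lia.
  move: tS St; rewrite z addn0 sumE /target expnD -/G.
  have cb : \sum_(j < NK) S j <= NK.
    by rewrite -[X in _ <= X]card_ord -sum1_card; apply: leq_sum => j _; case: (S j).
  have nb : \sum_(j < NK) S j * val (num (j %/ K) (j %% K)) <= NK * 2 ^ L.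
    rewrite -[X in _ <= X * _]card_ord -sum_nat_const; apply: leq_sum => j _.
    by case: (S j) => //; rewrite mul1n ltnW // num_lt.
  move: cb nb; set cnt := \sum_(j < NK) S j; set N := \sum_(j < NK) _ * _ => cb nb tS St.
  have low : cnt + 2 ^ m.+1 * N + 2 < 2 ^ f.
    have : 0 < 2 ^ L by rewrite expn_gt0.
    move: cb nb; rewrite pow_f /NK /G /K expnS.
    move: (2 ^ L) (2 ^ k0) (2 ^ m) a1 k1 => l k a a1' k1' cb nb l0.
    have h3 : a * N <= a * (a * k * l) by rewrite leq_mul2l nb orbT.
    have h4 : a * k <= a * k * l by rewrite leq_pmulr.
    have h5 : a * k * l * 2 <= a * k * l * a by rewrite leq_mul2l a1' orbT.
    have h6 : 0 < a * k * l by rewrite !muln_gt0; lia.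
    nia.
  have cG : cnt = G.
    move: tb low tS St; move: (2 ^ m.+1 * N) (2 ^ m.+1 * val tg) => x y.
    move: (2 ^ f) p0 => F F0; rewrite -/G => tb low tS St.
    case: (ltngtP cnt G) => // hlt.
      have h : F * cnt.+1 <= F * G by rewrite leq_mul2l hlt orbT.
      by move: h; rewrite mulnS; lia.
    have h : F * G.+1 <= F * cnt by rewrite leq_mul2l hlt orbT.
    by move: h; rewrite mulnS; lia.
  split=> //; move: tS St; rewrite cG expnS; move: a1; rewrite -/G; nia.
exists (fun j => S j && (j < NK)); rewrite pe.
rewrite [X in _ + X]big1; last by move=> j _; rewrite ltnNge leq_addr andbF.
under eq_bigr => j _ do rewrite ltn_ord andbT.
by rewrite addn0 sumE h1 h2 /target expnD -/G; lia.
Qed.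

End Items.

(** * The instance as an explicit word *)

Section RatVal.
Local Open Scope ring_scope.

Definition vr (s : seq bool) : rat := (val s)%:R.

Lemma vr_cat s1 s2 : vr (s1 ++ s2) = vr s1 + 2%:R ^+ size s1 * vr s2.
Proof. by rewrite /vr val_cat natrD natrM natrX. Qed.

Lemma vr_cons b s : vr (b :: s) = b%:R + 2%:R * vr s.
Proof. by rewrite /vr val_cons natrD natrM. Qed.

Lemma vr_nil : vr [::] = 0. Proof. by []. Qed.

Lemma vr_nseq0 n : vr (nseq n false) = 0.
Proof. by rewrite /vr val_nseq0. Qed.

Lemma vr_nseq1 n : vr (nseq n true) = 2%:R ^+ n - 1.
Proof. by rewrite /vr -natrX -val_nseq1 -natr1 addrK. Qed.

Lemma vr_flip s : vr (map negb s) = 2%:R ^+ size s - 1 - vr s.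
Proof. by rewrite /vr -natrX -val_flip -natr1 natrD; ring. Qed.

Lemma bval_bits (n j : nat) : (j <= n)%N ->
  bval n j = vr (nseq (n + 2 - j) false ++ nseq j.+1 true).
Proof.
move=> h; rewrite /bval vr_cat vr_nseq0 vr_nseq1 size_nseq add0r mulrBr mulr1 -exprD.
by congr (_ ^+ _ - _); lia.
Qed.

Section Thr.
Variables (m k0 L n : nat) (tg : seq bool).
Hypothesis (size_tg : size tg = L).
Let D := (4 * m + 2 * k0 + L + n + 8)%N.

(** The numerator of a threshold over $2^D$. At the low end stand the bits of $t-1$ for welfare, or
    the complement of $t$ for revenue, because $7\cdot 2^q-(t+1)=6\cdot 2^q+(2^q-1-t)$ with
    $q=D-n-3$. Then come the 7 or 6 left from $7/2^{n+3}$, and above $2^D$ the bits of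
    $2^{n+3}-5$. *)
Definition thr (phi : bool) : seq bool :=
  nseq m true ++ false :: map (addb phi) tg ++ nseq (2 * m + k0 + 2) phi ++
  (if phi then [:: false; true] else [:: true; false]) ++ nseq (m + k0) phi ++
  (if phi then [:: false; true; true] else [:: true; true; true]) ++ nseq n false ++
  [:: true; true; false] ++ nseq n true.

Let a : rat := 2%:R ^+ m.
Let k : rat := 2%:R ^+ k0.
Let l : rat := 2%:R ^+ L.
Let U : rat := 2%:R ^+ n.

Lemma powD : 2%:R ^+ D = 256%:R * (a * a * a * a * k * k * l * U) :> rat.
Proof.
rewrite /D (_ : 4 * m + 2 * k0 + L + n + 8 = m + m + m + m + k0 + k0 + L + n + 8)%N; last lia.
by rewrite !exprD -/a -/k -/l -/U; ring.
Qed.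

Lemma pow2mk : 2%:R ^+ (2 * m + k0 + 2) = 4%:R * (a * a * k) :> rat.
Proof.
rewrite (_ : 2 * m + k0 + 2 = m + m + k0 + 2)%N; last lia.
by rewrite !exprD -/a -/k; ring.
Qed.

Lemma target_rat : (target m k0 L tg)%:R = a + 2%:R * a * vr tg + 8%:R * (a * a * a * k * l).
Proof.
rewrite /target (_ : m + (2 * m + k0 + L + 3) = m + m + m + k0 + L + 3)%N; last lia.
rewrite !natrD natrM !natrX exprS !exprD -/a -/k -/l /vr; ring.
Qed.

Lemma thr_false : vr (thr false) / 2%:R ^+ D = base n + ((target m k0 L tg)%:R - 1) / 2%:R ^+ D.
Proof.
have a0 : a != 0 by rewrite expf_neq0.
have k0' : k != 0 by rewrite expf_neq0.
have l0 : l != 0 by rewrite expf_neq0.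
have U0 : U != 0 by rewrite expf_neq0.
rewrite /base target_rat powD.
have -> : 2%:R ^+ (n + 3) = 8%:R * U by rewrite exprD -/U; ring.
rewrite /thr (map_id_in (s := tg)) // !(vr_cat, vr_cons, vr_nil) !vr_nseq0 !vr_nseq1.
rewrite !size_nseq size_tg pow2mk [2%:R ^+ (m + k0)]exprD -/a -/k -/l -/U /=.
rewrite !exprS expr0; field.
by rewrite a0 k0' l0 U0.
Qed.

Lemma thr_true : vr (thr true) / 2%:R ^+ D = base n - ((target m k0 L tg)%:R + 1) / 2%:R ^+ D.
Proof.
have a0 : a != 0 by rewrite expf_neq0.
have k0' : k != 0 by rewrite expf_neq0.
have l0 : l != 0 by rewrite expf_neq0.
have U0 : U != 0 by rewrite expf_neq0.
rewrite /base target_rat powD.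
have -> : 2%:R ^+ (n + 3) = 8%:R * U by rewrite exprD -/U; ring.
rewrite /thr (eq_map (g := negb)) // !(vr_cat, vr_cons, vr_nil) !vr_nseq0 !vr_nseq1 vr_flip.
rewrite !size_nseq size_map size_tg pow2mk [2%:R ^+ (m + k0)]exprD -/a -/k -/l -/U /=.
rewrite !exprS expr0; field.
by rewrite a0 k0' l0 U0.
Qed.

End Thr.
End RatVal.

Definition encval n j : seq bool :=
  false :: dbl (nseq (n + 2 - j) false ++ nseq j.+1 true) ++ [:: false; true]
  ++ [:: true; true; false; true].
Definition encprob (s : seq bool) D : seq bool :=
  false :: dbl s ++ [:: false; true] ++ dbl (rcons (nseq D false) true) ++ [:: false; true].

Lemma encrat_bval n j : j <= n -> encrat (bval n j) = encval n j.
Proof.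
move=> h; rewrite bval_bits // encrat_nat encnat_val /encval; last first.
  by rewrite last_cat /= last_nseq.
by rewrite -catA.
Qed.

Lemma encrat_prob s D : last true s -> head false s ->
  encrat ((val s)%:R / 2%:R ^+ D)%R = encprob s D.
Proof.
move=> h h0; rewrite encrat_odd; last by case: s h0 {h} => [|[] s] //= _; rewrite odd_double.
by rewrite encnat_val // -catA.
Qed.

Lemma last_thr m k0 n tg phi : 0 < n -> last true (thr m k0 n tg phi).
Proof.
move=> n0; rewrite /thr !(last_cat, last_cons) /=.
by case: n n0 => // n _; rewrite /= last_nseq.
Qed.

Lemma head_thr m k0 n tg phi : 0 < m -> head false (thr m k0 n tg phi).
Proof. by case: m. Qed.

(** The encoded instance with all arithmetic done symbolically, so that it can be printed without
    computing any of the numbers in it. *)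
Definition instance_word m k0 L (num : nat -> nat -> seq bool) (tg : seq bool) : seq bool :=
  let n := nit m k0 in let K := 2 ^ k0 in let NK := 2 ^ m * K in let D := Dexp m k0 L in
  encdist dlow ++ dbl (true :: nseq (m + k0) false ++ [:: true]) ++ [:: false; true] ++
  flatten (mkseq (fun j => encval n j ++ encprob (pbits m k0 num false (j %/ K) (j %% K)) D) NK) ++
  flatten (mkseq (fun j => encval n (NK + j) ++ encprob (pbits m k0 num true (j %/ K) (j %% K)) D) NK) ++
  encval n n ++ encprob (nseq (n + 3) true) (n + 3) ++
  encprob (thr m k0 n tg false) D ++ encprob (thr m k0 n tg true) D.

Definition encpair (p : rat * rat) := encrat p.1 ++ encrat p.2.

Lemma encpairE x y : encpair (x, y) = encrat x ++ encrat y.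
Proof. by []. Qed.

Lemma encdistE d : encdist d = encnat (size d) ++ flatten (map encpair d).
Proof. by []. Qed.

Section Instance.
Variables (m k0 L : nat) (num : nat -> nat -> seq bool) (tg : seq bool).
Hypotheses (m_gt0 : 0 < m) (size_num : forall a k, a < 2 ^ m -> size (num a k) = L)
  (size_tg : size tg = L).
Let its := items m k0 num.
Let D := Dexp m k0 L.
Let t := target m k0 L tg.

Lemma nit_gt0 : 0 < nit m k0.
Proof. by rewrite /nit !muln_gt0 !expn_gt0. Qed.

Lemma instance_wordE :
  enc_instance dlow (dhigh its D) (Wthr its D t) (Rthr its D t) = instance_word m k0 L num tg.
Proof.
have n0 := nit_gt0.
have sz : size its = nit m k0 by apply: size_items.
have -> : (Wthr its D t = (val (thr m k0 (nit m k0) tg false))%:R / 2%:R ^+ D)%R.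
  by rewrite /Wthr sz -(@thr_false m k0 L (nit m k0) tg size_tg).
have -> : (Rthr its D t = (val (thr m k0 (nit m k0) tg true))%:R / 2%:R ^+ D)%R.
  by rewrite /Rthr sz -(@thr_true m k0 L (nit m k0) tg size_tg).
rewrite /enc_instance !encrat_prob ?last_thr ?head_thr // /instance_word -/D.
congr (_ ++ _).
rewrite encdistE size_mkseq sz -(catA (encnat _)).
have -> : (nit m k0).+1 = val (true :: nseq (m + k0) false ++ [:: true]).
  rewrite val_cons val_cat val_nseq0 size_nseq /= /nit expnD; lia.
rewrite encnat_val; last by rewrite /= last_cat.
rewrite -(catA (dbl _)); congr (_ ++ (_ ++ _)).
have iS : iota 0 (nit m k0).+1 = iota 0 (2 ^ m * 2 ^ k0)
    ++ map (addn (2 ^ m * 2 ^ k0)) (iota 0 (2 ^ m * 2 ^ k0)) ++ [:: nit m k0].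
  by rewrite -iotaDl addn0 -addn1 iotaD add0n {1}/nit mul2n -addnn iotaD -catA.
rewrite /dhigh sz /mkseq -(map_comp encpair) iS !map_cat !flatten_cat -map_comp.
set h := fun j : nat => (bval _ j, _).
have Dj j : j < 2 ^ m * 2 ^ k0 -> j < nit m k0 by rewrite /nit; lia.
have -> : map (encpair \o h) (iota 0 (2 ^ m * 2 ^ k0)) = mkseq (fun j => encval (nit m k0) j ++
    encprob (pbits m k0 num false (j %/ 2 ^ k0) (j %% 2 ^ k0)) D) (2 ^ m * 2 ^ k0).
  apply/eq_in_map => j; rewrite mem_iota => /andP[_ hj].
  rewrite [LHS]encpairE encrat_bval ?(ltnW (Dj _ hj)) // Dj // nth_items1 //; congr (_ ++ _).
  by rewrite encrat_prob // last_pbits.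
have -> : map ((encpair \o h) \o addn (2 ^ m * 2 ^ k0)) (iota 0 (2 ^ m * 2 ^ k0)) =
    mkseq (fun j => encval (nit m k0) (2 ^ m * 2 ^ k0 + j) ++
    encprob (pbits m k0 num true (j %/ 2 ^ k0) (j %% 2 ^ k0)) D) (2 ^ m * 2 ^ k0).
  apply/eq_in_map => j; rewrite mem_iota => /andP[_ hj].
  have hj' : 2 ^ m * 2 ^ k0 + j < nit m k0.
    by move: hj; rewrite /nit add0n; move: (_ * _) => x; lia.
  rewrite [LHS]encpairE encrat_bval ?(ltnW hj') // hj' nth_items2 //; congr (_ ++ _).
  by rewrite encrat_prob // last_pbits.
have -> : flatten (map (encpair \o h) [:: nit m k0]) =
    encval (nit m k0) (nit m k0) ++ encprob (nseq (nit m k0 + 3) true) (nit m k0 + 3).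
  have -> : flatten (map (encpair \o h) [:: nit m k0]) = encpair (h (nit m k0)) by exact: cats0.
  rewrite encpairE ltnn encrat_bval //; congr (_ ++ _).
  have -> : (1 - 1 / 2%:R ^+ (nit m k0 + 3) = (val (nseq (nit m k0 + 3) true))%:R / 2%:R ^+ (nit m k0 + 3) :> rat)%R.
    by rewrite -/(vr _) vr_nseq1 mulrBl divff // expf_neq0.
  by rewrite encrat_prob ?last_nseq // addnC.
by rewrite -!(catA (flatten _)) -!(catA (encval _ _)).
Qed.

Lemma instance_wordP : SW_Rev_problem (instance_word m k0 L num tg) <->
  exists S : nat -> bool,
    \sum_(j < 2 ^ m * 2 ^ k0) S j * val (num (j %/ 2 ^ k0) (j %% 2 ^ k0)) = val tg
     /\ \sum_(j < 2 ^ m * 2 ^ k0) S j = 2 ^ m.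
Proof.
rewrite -(@pick_sum_target m k0 L num tg) // -instance_wordE.
have hs := items_sum k0 m_gt0 size_num size_tg; have ht := target_small k0 m_gt0 size_num size_tg.
have hp : forall j, j < size its -> 0 < nth 0 its j by move=> j; apply: items_pos size_tg _.
have hr : forall j, j.+1 < size its -> nth 0 its j <= 2 * nth 0 its j.+1.
  by move=> j; apply: items_ratio size_tg _.
rewrite -(SW_thresholdP hp hs ht); split.
  by move=> [d1 [d2 [W [R [/enc_instance_inj[<- <- <- <-] _ _ h]]]]].
move=> h; exists dlow, (dhigh its D), (Wthr its D t), (Rthr its D t); split=> //.
  exact: dlow_valid.
exact: dhigh_valid hp hr hs ht.
Qed.

End Instance.

(** * Runs as tilings *)

Section Tiles.
Variable M : TM.
Let Q := tm_state M.

(* A horizontal colour carries the head moving to the right or to the left neighbour; hmark forces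
   the certificate cells to stay blank after its end.  A vertical colour is a tape cell, possibly with
   the head; launch spawns the head and guess a certificate bit; None is an erased cell. *)
Definition hcol : finType := option (unit + bool * Q)%type.
Definition vcol : finType := option (bool + option bool * option Q)%type.
Definition tile : finType := (hcol * hcol * vcol * vcol)%type.

Definition hmark : hcol := Some (inl tt).
Definition hright (q : Q) : hcol := Some (inr (true, q)).
Definition hleft (q : Q) : hcol := Some (inr (false, q)).
Definition launch : vcol := Some (inl true).
Definition guess : vcol := Some (inl false).
Definition cell (s : option bool) (oq : option Q) : vcol := Some (inr (s, oq)).

Definition lft (t : tile) := t.1.1.1.
Definition rgt (t : tile) := t.1.1.2.
Definition top (t : tile) := t.1.2.
Definition bot (t : tile) := t.2.

(* A cell without head can be erased at any time, but the cell with the head only in an accepting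
   halted configuration: a tiling of the whole helix needs an accepting run. *)
Definition okt (t : tile) : bool :=
  let: (l, r, u, b) := t in
  match u with
  | None => [&& l == None, r == None & b == None]
  | Some (inl true) => [&& l == None, r == hright (tm_start M) & b == cell None None]
  | Some (inl false) =>
      [&& l == None, r == None & (b == cell (Some true) None) || (b == cell (Some false) None)]
      || [&& (l == None) || (l == hmark), r == hmark & b == cell None None]
  | Some (inr (s, None)) =>
      [|| [&& l == None, r == None & (b == u) || (b == None)],
          [&& s == None, l == hmark, r == None & b == u],
          (r == None) && [exists q, (l == hright q) && (b == cell s (Some q))]
        | (l == None) && [exists q, (r == hleft q) && (b == cell s (Some q))]]
  | Some (inr (s, Some q)) =>
      match tm_delta q s with
      | None => [&& @tm_accept M q, l == None, r == None & b == None]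
      | Some (q', w, MStay) => [&& l == None, r == None & b == cell w (Some q')]
      | Some (q', w, MRight) => [&& l == None, r == hright q' & b == cell w None]
      | Some (q', w, MLeft) => [&& l == hleft q', r == None & b == cell w None]
      end
  end.

(** The head that a cell sends to its right neighbour, read off from its top colour alone. With
    [emitL], this makes the head on an edge a function of the contents of the two adjacent cells. *)
Definition emitR (v : vcol) : option Q :=
  match v with
  | Some (inl true) => Some (tm_start M)
  | Some (inr (s, Some q)) => if tm_delta q s is Some (q', _, MRight) then Some q' else None
  | _ => None
  end.

Definition emitL (v : vcol) : option Q :=
  match v with
  | Some (inr (s, Some q)) => if tm_delta q s is Some (q', _, MLeft) then Some q' else None
  | _ => None
  end.

Ltac tile_cases :=
  move=> [[[? ?] [[[|]|[? [?|]]]|]] ?]; rewrite /okt /lft /rgt /top /bot /=;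
  try (case: (tm_delta _ _) => [[[? ?] [| |]]|] //=); intros;
  repeat match goal with
  | H : is_true (_ && _) |- _ => apply (elimT andP) in H; destruct H
  | H : is_true (_ || _) |- _ => apply (elimT orP) in H; destruct H
  | H : is_true (_ == _) |- _ => apply (elimT eqP) in H
  | H : is_true [exists _, _] |- _ => apply (elimT existsP) in H; destruct H
  end;
  unfold hright, hleft, hmark, launch, guess, cell in *; subst; try discriminate;
  repeat match goal with H : Some _ = Some _ |- _ => injection H; clear H; intros; subst end;
  try reflexivity; try discriminate.

Lemma okt_rgtR t q : okt t -> rgt t = hright q -> emitR (top t) = Some q.
Proof. by move: t; tile_cases. Qed.

Lemma okt_lftL t q : okt t -> lft t = hleft q -> emitL (top t) = Some q.
Proof. by move: t; tile_cases. Qed.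

Lemma okt_emitR t q : okt t -> emitR (top t) = Some q -> rgt t = hright q.
Proof. by move: t; tile_cases. Qed.

Lemma okt_emitL t q : okt t -> emitL (top t) = Some q -> lft t = hleft q.
Proof. by move: t; tile_cases. Qed.

Lemma okt_recvR t s q : okt t -> top t = cell s None -> lft t = hright q -> bot t = cell s (Some q).
Proof. by move: t; tile_cases. Qed.

Lemma okt_recvL t s q : okt t -> top t = cell s None -> rgt t = hleft q -> bot t = cell s (Some q).
Proof. by move: t; tile_cases. Qed.

Lemma okt_plain t s : okt t -> top t = cell s None ->
  (forall q, lft t <> hright q) -> (forall q, rgt t <> hleft q) ->
  bot t = None \/ bot t = cell s None.
Proof.
move: t; tile_cases; try (by left); try (by right).
all: by exfalso; match goal with H : forall _, _ <> _ |- _ => exact: (H _ (erefl _)) end.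
Qed.

Lemma okt_erased t : okt t -> top t = None -> bot t = None.
Proof. by move: t; tile_cases. Qed.

Lemma okt_launch t : okt t -> top t = launch -> bot t = cell None None.
Proof. by move: t; tile_cases. Qed.

Lemma okt_head t s q : okt t -> top t = cell s (Some q) ->
  match tm_delta q s with
  | None => @tm_accept M q
  | Some (q', w, MStay) => bot t = cell w (Some q')
  | Some (q', w, _) => bot t = cell w None
  end.
Proof.
move: t => [[[l r] u] b] /= + E; rewrite /top /= in E; rewrite E /=.
case: (tm_delta q s) => [[[q' w] []]|]; try by case/and3P => _ _ /eqP.
by case/and4P.
Qed.

Lemma okt_guess t : okt t -> top t = guess ->
  (exists b, [/\ bot t = cell (Some b) None, lft t = None & rgt t = None])
  \/ (bot t = cell None None /\ rgt t = hmark).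
Proof.
move: t => [[[l r] u] b] /= + E; rewrite /top /= in E; rewrite E /= /bot /lft /rgt /=.
case/orP => /and3P[]; last by move=> _ /eqP-> /eqP->; right.
by move=> /eqP-> /eqP-> h; left; case/orP: h => /eqP->; [exists true | exists false].
Qed.

Lemma okt_guess_mark t : okt t -> top t = guess -> lft t = hmark ->
  bot t = cell None None /\ rgt t = hmark.
Proof. by move=> ok tt lm; case: (okt_guess ok tt) => // -[b [_]]; rewrite lm. Qed.

(** A configuration is relative to its head; this reads it in absolute coordinates, the head being
    at cell [h]. The left part is stored reversed, and cells beyond the lists are blank. *)
Definition csym (c : config M) h i : option bool :=
  let: (_, L, R) := c in if i < h then nth None L (h - 1 - i) else nth None R (i - h).

Definition ccell (c : config M) h i : vcol := cell (csym c h i) (if i == h then Some c.1.1 else None).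

Definition nhead (m : move) h := match m with MLeft => h.-1 | MStay => h | MRight => h.+1 end.

Lemma csym_head (c : config M) h : csym c h h = head None c.2.
Proof. by case: c => [[q L] R]; rewrite /csym ltnn subnn nth0. Qed.

(** In absolute coordinates a step changes a single cell. With [0 < h], the truncated [h.-1] is a
    true move to the left. *)
Lemma step_delta (c : config M) h : 0 < h ->
  match tm_delta c.1.1 (csym c h h) with
  | None => step c = None
  | Some (q', w, m) => exists c', [/\ step c = Some c', c'.1.1 = q' &
      forall i, csym c' (nhead m h) i = if i == h then w else csym c h i]
  end.
Proof.
rewrite csym_head; case: c => [[q L] R] h0 /=.
case: (tm_delta q (head None R)) => [[[q' w] m]|] //.
eexists; split; first reflexivity; first by case: m.
move=> i; case: m => /=.
- have [->|ne] := eqVneq i h.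
    by rewrite ltnNge leq_pred /= (_ : h - h.-1 = 1) //; lia.
  have [h1|h1] := ltnP i h.-1.
    rewrite (_ : i < h = true) ?nth_behead; last by lia.
    by congr nth; lia.
  have [h2|h2] := ltnP i h.
    have -> : i = h.-1 by lia.
    by rewrite subnn /= (_ : h - 1 - h.-1 = 0) ?nth0 //; lia.
  by rewrite (_ : i - h.-1 = (i - h.+1).+2) /= ?nth_behead; [congr nth|]; lia.
- have [->|ne] := eqVneq i h; first by rewrite ltnn subnn.
  have [h2|h2] := ltnP i h => //.
  by rewrite (_ : i - h = (i - h.+1).+1) /= ?nth_behead //; lia.
have [->|ne] := eqVneq i h.
  by rewrite ltnSn (_ : h.+1 - 1 - h = 0) //; lia.
have [h2|h2] := ltnP i h.
  rewrite (_ : i < h.+1 = true); last by lia.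
  by rewrite (_ : h.+1 - 1 - i = (h - 1 - i).+1) //; lia.
rewrite (_ : i < h.+1 = false); last by lia.
by rewrite nth_behead; congr nth; lia.
Qed.

(* Consecutive rows are glued: the right edge of a row is the left edge of the next one. *)
Record tiling (G Wd : nat) (row : nat -> vcol) (tau : nat -> tile) : Prop := Tiling {
  tiling_ok : forall a, a < G -> okt (tau a);
  tiling_l0 : lft (tau 0) = None;
  tiling_h : forall a, a.+1 < G -> lft (tau a.+1) = rgt (tau a);
  tiling_hG : rgt (tau G.-1) = None;
  tiling_v0 : forall a, a < Wd -> top (tau a) = row a;
  tiling_v : forall a, a + Wd < G -> top (tau (a + Wd)) = bot (tau a);
  tiling_vG : forall a, a < G -> G <= a + Wd -> bot (tau a) = None }.

Section Codes.
(* Colour None has code 0: it also stands for the border. *)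
Definition code (T : finType) (o : option T) : nat := if o is Some y then (enum_rank y).+1 else 0.

Lemma code_inj (T : finType) : injective (@code T).
Proof. by case=> [x|] [y|] //= [] /ord_inj /enum_rank_inj ->. Qed.

Lemma code_le (T : finType) (o : option T) : code o <= #|T|.
Proof. by case: o => //= y; apply: ltn_ord. Qed.

(** The sum of the two numbers of colours, so that one bound [C] serves horizontal and vertical
    codes. *)
Definition ncol : nat := #|{: unit + bool * Q}| + #|{: bool + option bool * option Q}|.

Lemma hcode_le (c : hcol) : code c <= ncol.
Proof. by apply: leq_trans (code_le c) _; apply: leq_addr. Qed.

Lemma vcode_le (c : vcol) : code c <= ncol.
Proof. by apply: leq_trans (code_le c) _; apply: leq_addl. Qed.

Lemma ncol_gt0 : 0 < ncol.
Proof. by rewrite /ncol addn_gt0; apply/orP; left; apply/card_gt0P; exists (inl tt). Qed.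

(** This tile is itself permitted. As the default of [nth_tile] it fills the indices from [ktiles]
    to [2 ^ ktiles], so making the number of types a power of two introduces no illegal tile. *)
Definition etile : tile := (None, None, None, None).
Definition tiles : seq tile := [seq t <- enum tile | okt t].
Definition ktiles := size tiles.
Definition nth_tile k : tile := nth etile tiles k.

Lemma okt_nth_tile k : okt (nth_tile k).
Proof.
rewrite /nth_tile; have [h|h] := ltnP k (size tiles); last by rewrite nth_default.
by have := mem_nth etile h; rewrite mem_filter => /andP[].
Qed.

Lemma nth_tile_index t : okt t -> index t tiles < 2 ^ ktiles /\ nth_tile (index t tiles) = t.
Proof.
move=> ok; have tin : t \in tiles by rewrite mem_filter ok mem_enum.
split; last by rewrite /nth_tile nth_index.
by apply: leq_trans (ltn_expl _ _); rewrite // ltnW // ltnS index_mem.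
Qed.

Definition lcode k := code (lft (nth_tile k)).
Definition rcode k := code (rgt (nth_tile k)).
Definition tcode k := code (top (nth_tile k)).
Definition bcode k := code (bot (nth_tile k)).

(** For codes at most [C], the equation [C - l + r = C] says that [l = r]; at either end of the
    helix the absent colour counts as 0, the code of [None]. *)
Lemma tiled_tiling G Wd row : 0 < G -> 0 < Wd -> Wd <= G ->
  (exists kap, Tiled (2 ^ ktiles) ncol G Wd lcode rcode tcode bcode (fun c => code (row c)) kap)
  <-> exists tau, tiling G Wd row tau.
Proof.
move=> G0 W0 WG; split=> [[kap [kK hE hV]]|[tau [ok l0 hh hG v0 vv vG]]].
  exists (fun a => nth_tile (kap a)); split.
  - by move=> a _; apply: okt_nth_tile.
  - have := hE 0 (leq0n G); rewrite G0 /= addn0 => h; apply: code_inj.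
    by have := hcode_le (lft (nth_tile (kap 0))); rewrite -/(lcode _) /=; lia.
  - move=> a aG; apply: code_inj; have := hE a.+1 (ltnW aG); rewrite aG /= subn1 /=.
    by have := hcode_le (lft (nth_tile (kap a.+1))); rewrite -/(lcode _) -/(rcode _); lia.
  - have := hE G (leqnn G); rewrite ltnn G0 subn1 add0n => h; exact: code_inj.
  - move=> a aW; have aG : a < G by apply: leq_trans WG.
    apply: code_inj; have := hV a (ltn_addr _ aG); rewrite aG /T2 aW leqNgt aW /= addn0.
    have := vcode_le (top (nth_tile (kap a))); have := vcode_le (row a).
    by rewrite -/(tcode _); lia.
  - move=> a aG; apply: code_inj; have := hV (a + Wd) (ltn_addr _ aG).
    rewrite aG /T2 aG leq_addl addnK ltnNge leq_addl /=.
    have := vcode_le (top (nth_tile (kap (a + Wd)))).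
    by rewrite -/(tcode _) -/(bcode _); lia.
  - move=> a aG Ga; apply: code_inj; have := hV (a + Wd).
    rewrite ltn_add2r aG leq_addl addnK /T2 => /(_ isT).
    by rewrite [a + Wd < G]ltnNge Ga /= ltnNge leq_addl.
have [kap hk] : exists kap, forall a, a < G -> kap a < 2 ^ ktiles /\ nth_tile (kap a) = tau a.
  by exists (fun a => index (tau a) tiles) => a /ok /nth_tile_index.
have e a : a < G -> nth_tile (kap a) = tau a by case/hk.
exists kap; split=> [a /hk[] //|c cG|c cG].
  rewrite /lcode /rcode; case: ltnP => [cG'|Gc].
    rewrite e //; case: c cG cG' => [|c] cG cG'; first by rewrite l0 /= subn0 addn0.
    rewrite subn1 /= e ?(ltnW cG') // -hh //.
    by have := hcode_le (lft (tau c.+1)); lia.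
  have -> : c = G by lia.
  by rewrite G0 subn1 e ?hG // prednK.
rewrite /tcode /bcode /T2; case: ltnP => [cG'|Gc].
  rewrite e //; case: ltnP => [cW|Wc]; first by rewrite v0 // addn0.
  rewrite e; last by lia.
  have := vv (c - Wd); rewrite subnK // => /(_ cG') ->.
  by have := vcode_le (bot (tau (c - Wd))); lia.
have Wc : Wd <= c by lia.
by rewrite Wc ltnNge Wc /= e ?vG //; lia.
Qed.

End Codes.

Section Runs.
Variables (x : seq bool) (P T0 Tm : nat).
Hypotheses (Tm_big : 2 * T0 + 2 < Tm).

(** The known part of [enc_pair x w], preceded by the cell that releases the head and followed by
    the cells where [w] is guessed. The margins of width [Tm] separate the head from the ends of the
    row. *)
Definition row0 : seq vcol :=
  nseq Tm (cell None None) ++ launch :: [seq cell (Some b) None | b <- dbl x ++ [:: false; true]]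
  ++ nseq P guess ++ nseq Tm (cell None None).

Definition Wd := size row0.

Lemma WdE : Wd = Tm + 1 + (2 * size x + 2) + P + Tm.
Proof. clear Tm_big T0. rewrite /Wd /row0 !size_cat /= !size_cat !size_nseq size_map size_cat size_dbl /=; lia. Qed.

Definition rowc i := nth (cell None None) row0 i.

Let h0 := Tm.+1.
Let g0 := Tm + 1 + (2 * size x + 2).

Lemma rowc_left i : i < Tm -> rowc i = cell None None.
Proof. by move=> h; rewrite /rowc [LHS]nth_cat size_nseq h nth_nseq h. Qed.

Lemma rowc_launch : rowc Tm = launch.
Proof. by rewrite /rowc nth_cat size_nseq ltnn subnn. Qed.

Lemma rowc_x i : i < 2 * size x + 2 ->
  rowc (h0 + i) = cell (Some (nth false (dbl x ++ [:: false; true]) i)) None.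
Proof.
move=> h; rewrite /rowc [LHS]nth_cat size_nseq ltnNge (leq_trans (leqnSn _)) ?leq_addr //=.
rewrite (_ : h0 + i - Tm = i.+1) /=; last by rewrite /h0; lia.
rewrite [LHS]nth_cat size_map size_cat size_dbl /= h (nth_map false) // size_cat size_dbl //.
Qed.

Lemma rowc_guess i : i < P -> rowc (g0 + i) = guess.
Proof.
move=> h; rewrite /rowc [LHS]nth_cat size_nseq ifF; last by rewrite /g0; lia.
rewrite (_ : g0 + i - Tm = (2 * size x + 2 + i).+1) /=; last by rewrite /g0; lia.
rewrite nth_cat size_map size_cat size_dbl /= ltnNge leq_addr /= addKn.
by rewrite nth_cat size_nseq h nth_nseq h.
Qed.

Lemma rowc_right i : g0 + P <= i -> rowc i = cell None None.
Proof.
move=> h; rewrite /rowc [LHS]nth_cat size_nseq ifF; last by move: h; rewrite /g0; lia.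
rewrite (_ : i - Tm = (i - Tm.+1).+1) /=; last by move: h; rewrite /g0; lia.
rewrite nth_cat size_map size_cat size_dbl /= ifF; last by move: h; rewrite /g0; lia.
rewrite nth_cat size_nseq ifF; last by move: h; rewrite /g0; lia.
by rewrite nth_nseq; case: ifP.
Qed.

Lemma rowc_cases i : [\/ rowc i = cell None None /\ (i < Tm \/ g0 + P <= i),
  rowc i = launch /\ i = Tm,
  exists2 j, i = h0 + j /\ j < 2 * size x + 2 &
     rowc i = cell (Some (nth false (dbl x ++ [:: false; true]) j)) None |
  exists2 j, i = g0 + j /\ j < P & rowc i = guess].
Proof.
have [h|h] := ltnP i Tm; first by constructor 1; rewrite rowc_left //; auto.
have [->|ne] := eqVneq i Tm; first by constructor 2; rewrite rowc_launch.
have [h1|h1] := ltnP i g0.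
  have e : i = h0 + (i - h0) by rewrite /h0; lia.
  constructor 3; exists (i - h0); first by split=> //; move: h1; rewrite /g0 /h0; lia.
  by rewrite {1}e rowc_x //; move: h1; rewrite /g0 /h0; lia.
have [h2|h2] := ltnP i (g0 + P).
  have e : i = g0 + (i - g0) by lia.
  by constructor 4; exists (i - g0); [split=> //; lia | rewrite {1}e rowc_guess //; lia].
by constructor 1; rewrite rowc_right //; auto.
Qed.

Lemma emitR_rowc i q : emitR (rowc i) = Some q -> i = Tm /\ q = tm_start M.
Proof. by case: (rowc_cases i) => [[-> _]|[-> ->] [<-]|[j _ ->]|[j _ ->]]. Qed.

Lemma emitL_rowc i : emitL (rowc i) = None.
Proof. by case: (rowc_cases i) => [[-> _]|[-> _]|[j _ ->]|[j _ ->]]. Qed.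

Lemma csym_init w i : csym (init M (enc_pair x w)) h0 i =
  if i < h0 then None else
  if i - h0 < 2 * size x + 2 then Some (nth false (dbl x ++ [:: false; true]) (i - h0))
  else nth None (map Some w) (i - h0 - (2 * size x + 2)).
Proof.
have -> : enc_pair x w = (dbl x ++ [:: false; true]) ++ w by rewrite -catA.
rewrite /csym /init nth_nil; case: ifP => // _.
have sz : size (dbl x ++ [:: false; true]) = 2 * size x + 2 by rewrite size_cat size_dbl.
by rewrite map_cat nth_cat size_map sz; case: ifP => // h; rewrite (nth_map false) ?sz.
Qed.

(** * Every tiling contains an accepting run *)

Section Sound.
Variables (G : nat) (tau : nat -> tile).
Hypotheses (G_big : (T0 + 3) * Wd <= G) (til : tiling G Wd rowc tau).

Let ok a : a < G -> okt (tau a). Proof. by case: til => h *; apply: h. Qed.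

(** The first guess cell left blank emits [hmark], which forces all later guess cells to be blank:
    the guessed bits form a word followed by blanks. *)
Lemma guess_word n g : g + n < G -> (forall i, i < n -> top (tau (g + i)) = guess) ->
  exists2 w : seq bool, size w <= n &
    forall i, i < n -> bot (tau (g + i)) = cell (nth None (map Some w) i) None.
Proof.
have chain a : a.+1 < G -> lft (tau a.+1) = rgt (tau a) by case: til => _ _ h *; apply: h.
have marks k a : a + k < G -> (forall i, i < k -> top (tau (a + i)) = guess) ->
    (0 < k -> lft (tau a) = hmark) -> forall i, i < k -> bot (tau (a + i)) = cell None None.
  elim: k a => [//|k IH] a aG tg lm.
  have oka : okt (tau a) by apply: ok; lia.
  have ta : top (tau a) = guess by rewrite -[a]addn0 tg.
  have [b1 r1] := okt_guess_mark oka ta (lm isT).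
  case=> [|i] hi; first by rewrite addn0.
  rewrite addnS -addSn; apply: IH => //; first by lia.
    by move=> j hj; rewrite addSn -addnS tg.
  by move=> k0; rewrite chain //; lia.
elim: n g => [|n IH] g gG tg; first by exists [::].
have okg : okt (tau g) by apply: ok; lia.
have tg0 : top (tau g) = guess by rewrite -[g]addn0 tg.
have tg' i : i < n -> top (tau (g.+1 + i)) = guess by move=> hi; rewrite addSn -addnS tg.
have gG' : g.+1 + n < G by lia.
case: (okt_guess okg tg0) => [[b [bb _ _]]|[bb rr]].
  have [w sw hw] := IH g.+1 gG' tg'.
  exists (b :: w); first by rewrite ltnS.
  by case=> [|i] hi; rewrite ?addn0 // addnS -addSn hw.
exists [::] => // i hi; rewrite nth_nil; case: i hi => [|i] hi; first by rewrite addn0.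
rewrite addnS -addSn; apply: (marks n) => // n0; rewrite chain //; lia.
Qed.

(* Because of the glueing, spurious heads and erasures may enter from both ends of a row, but by
   at most one cell per row: after t rows only the cells at distance t from the ends are reliable. *)
Definition rowinv (t : nat) (c : config M) (h : nat) : Prop :=
  [/\ forall i, t <= i < Wd - t -> top (tau (t * Wd + i)) = None \/ top (tau (t * Wd + i)) = ccell c h i,
      top (tau (t * Wd + h)) = ccell c h h,
      Tm.+2 <= h + t & h <= Tm + t].

(** In row 0 only [launch] emits a head, and the cell [h0] receives it. The two end cells are left
    out because their outer neighbours belong to other rows. *)
Lemma rowinv1 : exists2 w, size w <= P & rowinv 1 (init M (enc_pair x w)) h0.
Proof.
have W1 : 1 < Wd by rewrite WdE; lia.
have GW : 3 * Wd <= G by apply: leq_trans G_big; rewrite leq_mul2r leq_addl orbT.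
case: (til) => _ _ chain _ v0 v _.
have [w sw hw] : exists2 w : seq bool, size w <= P &
    forall i, i < P -> bot (tau (g0 + i)) = cell (nth None (map Some w) i) None.
  apply: guess_word; first by rewrite /g0; move: GW W1; rewrite WdE; lia.
  by move=> i hi; rewrite v0 ?rowc_guess // WdE /g0; lia.
exists w => //; set c := init _ _.
have noL a : a < Wd.-1 -> forall q, rgt (tau a) <> hleft q.
  move=> aW q; rewrite -chain; last by lia.
  move=> /okt_lftL; rewrite v0; last by lia.
  by rewrite emitL_rowc => /(_ (ok _)) H; have := H ltac:(lia).
have noR a : 0 < a < Wd -> a != h0 -> forall q, lft (tau a) <> hright q.
  case: a => // a aW ne q; rewrite chain; last by lia.
  have okA : okt (tau a) by apply: ok; lia.
  move=> /(okt_rgtR okA); rewrite v0; last by lia.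
  by move=> /emitR_rowc[E _]; move: ne; rewrite E eqxx.
have topb i : i < Wd -> top (tau (1 * Wd + i)) = bot (tau i).
  by move=> iW; rewrite mul1n addnC v //; lia.
have sym i : 0 < i < Wd.-1 -> i != h0 ->
    bot (tau i) = None \/ bot (tau i) = ccell c h0 i.
  move=> iW ine; have okI : okt (tau i) by apply: ok; lia.
  rewrite /ccell (negbTE ine) csym_init.
  have plain s : rowc i = cell s None -> bot (tau i) = None \/ bot (tau i) = cell s None.
    move=> E; apply: okt_plain => //; first by rewrite v0 //; lia.
      by apply: noR => //; lia.
    by apply: noL; lia.
  case: (rowc_cases i) => [[E hi]|[E hi]|[j [ej hj] E]|[j [ej hj] E]].
  - have [h|h] := plain _ E; [by left | right; rewrite h].
    case: ifP => // ge; rewrite ifF; last by move: hi ge; rewrite /g0 /h0; lia.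
    by rewrite nth_default // size_map; move: hi ge; rewrite /g0 /h0; lia.
  - right; rewrite (okt_launch okI); first by rewrite hi /h0 ltnSn.
    by rewrite v0 //; lia.
  - have [h|h] := plain _ E; [by left | right; rewrite h].
    by rewrite ej ltnNge leq_addr addKn hj.
  - right; rewrite ej hw // ifF; last by rewrite /g0 /h0; lia.
    rewrite ifF; last by rewrite /g0 /h0; lia.
    by congr (cell (nth _ _ _) _); rewrite /g0 /h0; lia.
have hd : bot (tau h0) = ccell c h0 h0.
  have okH : okt (tau h0) by apply: ok; move: GW W1; rewrite WdE /h0; lia.
  have hW : h0 < Wd by rewrite WdE /h0; lia.
  have E : rowc h0 = cell (Some (nth false (dbl x ++ [:: false; true]) 0)) None.
    by rewrite -[h0 in LHS]addn0 rowc_x //; lia.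
  have lf : lft (tau h0) = hright (tm_start M).
    rewrite chain; last by lia.
    apply: okt_emitR; first by apply: ok; move: hW; rewrite /h0; lia.
    rewrite v0 ?rowc_launch //; move: hW; rewrite /h0; lia.
  rewrite (okt_recvR okH (s := Some (nth false (dbl x ++ [:: false; true]) 0)) (q := tm_start M)) //; last first.
    by rewrite v0.
  by rewrite /ccell eqxx csym_init ltnn subnn addn2.
split.
- move=> i hi; rewrite topb; last by lia.
  have [->|ne] := eqVneq i h0; first by right.
  by apply: sym => //; lia.
- by rewrite topb // WdE /h0; lia.
- by rewrite /h0; lia.
by rewrite /h0; lia.
Qed.

Lemma okt_erased_sides t : okt t -> top t = None -> lft t = None /\ rgt t = None.
Proof. by move: t => [[[l r] u] b] /= + E; rewrite /top /= in E; rewrite E => /and3P[/eqP-> /eqP->]. Qed.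

(** A cell showing a halted head fits a tile only if the state accepts. *)
Lemma rowinv_halt t c h : (t + 1) * Wd <= G -> 0 < t -> h < Wd -> 0 < h -> rowinv t c h ->
  step c = None -> @tm_accept M c.1.1.
Proof.
move=> tG t0 hW h0' [_ hh _ _] hs.
have okh : okt (tau (t * Wd + h)) by apply: ok; move: tG; rewrite mulnDl mul1n; lia.
have := okt_head okh (s := csym c h h) (q := c.1.1); rewrite hh /ccell eqxx => /(_ erefl).
have := step_delta c h0'; case: (tm_delta _ _) => [[[q' w] m]|] //.
by case=> c' []; rewrite hs.
Qed.

(** Between two reliable cells, the head on an edge is determined by the contents of these cells, so
    only the true head can travel there. A cell at the boundary of the reliable zone has an
    uncontrolled outer edge, hence the loss of one cell on each side. *)
Lemma rowinv_step t c h c' : (t + 2) * Wd <= G -> 0 < t -> t <= T0 + 1 -> rowinv t c h ->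
  step c = Some c' -> exists h', rowinv t.+1 c' h'.
Proof.
move=> tG t0 tT [inv hh hlo hhi] hs.
have WE := WdE.
have h1 : 0 < h by lia.
case: (til) => _ _ chain _ _ v _.
have okj j : j < Wd -> okt (tau (t * Wd + j)) by move=> jW; apply: ok; move: tG; rewrite mulnDl; lia.
have chj j : j.+1 < Wd -> lft (tau (t * Wd + j.+1)) = rgt (tau (t * Wd + j)).
  by move=> jW; rewrite addnS chain //; move: tG; rewrite mulnDl; lia.
have vj j : j < Wd -> top (tau (t.+1 * Wd + j)) = bot (tau (t * Wd + j)).
  move=> jW; rewrite (_ : t.+1 * Wd + j = t * Wd + j + Wd); last by rewrite mulSn; lia.
  by rewrite v //; move: tG; rewrite mulnDl; lia.
have := step_delta c h1; case D : (tm_delta _ _) => [[[q' w] m]|]; last by rewrite hs.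
rewrite hs => -[_ [[<-] c'q c'sym]].
have nR j q : t <= j < Wd - t -> emitR (top (tau (t * Wd + j))) = Some q -> [/\ j = h, m = MRight & q = q'].
  move=> jW; have [->|ne] := eqVneq j h.
    by rewrite hh /ccell eqxx /= D; case: m {D c'sym} => // -[->].
  by case: (inv j jW) => ->; rewrite /ccell ?(negbTE ne).
have nL j q : t <= j < Wd - t -> emitL (top (tau (t * Wd + j))) = Some q -> [/\ j = h, m = MLeft & q = q'].
  move=> jW; have [->|ne] := eqVneq j h.
    by rewrite hh /ccell eqxx /= D; case: m {D c'sym nR} => // -[->].
  by case: (inv j jW) => ->; rewrite /ccell ?(negbTE ne).
(* The head drifts by at most one cell per row, and so does the boundary of the reliable zone;
   [Tm_big] keeps them apart up to row [T0 + 1]. *)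
have hw : t < h < Wd - t by lia.
have sameR : m = MRight -> rgt (tau (t * Wd + h)) = hright q'.
  by move=> e; apply: okt_emitR; [apply: okj; lia | rewrite hh /ccell eqxx /= D e].
have sameL : m = MLeft -> lft (tau (t * Wd + h)) = hleft q'.
  by move=> e; apply: okt_emitL; [apply: okj; lia | rewrite hh /ccell eqxx /= D e].
exists (nhead m h).
have athead : bot (tau (t * Wd + h)) = ccell c' (nhead m h) h.
  have okh := okj h ltac:(lia).
  have := okt_head okh (s := csym c h h) (q := c.1.1); rewrite hh /ccell eqxx => /(_ erefl).
  rewrite D c'sym eqxx c'q; case: m {D c'sym nR nL sameR sameL} => /= ->.
  - by rewrite ifF //; lia.
  - by rewrite eqxx.
  - by rewrite ifF //; lia.
have newhead : nhead m h != h -> bot (tau (t * Wd + nhead m h)) = ccell c' (nhead m h) (nhead m h).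
  move=> nh; set h' := nhead m h in nh *.
  have hW : t <= h' < Wd - t by rewrite /h'; case: (m) => /=; lia.
  have okh : okt (tau (t * Wd + h')) by apply: okj; lia.
  rewrite /ccell eqxx c'sym (negbTE nh) c'q.
  have edge : lft (tau (t * Wd + h')) = hright q' \/ rgt (tau (t * Wd + h')) = hleft q'.
    move: nh hW; rewrite /h'; case E : m => /= nh hW.
    - right; rewrite -chj ?prednK ?sameL //; lia.
    - by rewrite eqxx in nh.
    - by left; rewrite chj ?sameR //; lia.
  (* An erased cell has empty edges and cannot receive the head, so the arriving head rules out an
     erasure at [h']. *)
  case: (inv h' hW) => tE.
    by have [l r] := okt_erased_sides okh tE; case: edge; rewrite ?l ?r.
  rewrite /ccell (negbTE nh) in tE.
  by case: edge => ed; [apply: okt_recvR ed | apply: okt_recvL ed].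
split.
- move=> i hi; rewrite vj; last by lia.
  have [->|ih] := eqVneq i h; first by right.
  have [e|ih'] := eqVneq i (nhead m h).
    by right; rewrite e; apply: newhead; rewrite -e.
  have iW : t <= i < Wd - t by lia.
  have oki : okt (tau (t * Wd + i)) by apply: okj; lia.
  case: (inv i iW) => tE; first by left; apply: okt_erased.
  rewrite /ccell c'sym (negbTE ih) (negbTE ih').
  rewrite /ccell (negbTE ih) in tE.
  apply: okt_plain => // q.
    case: i hi ih ih' iW oki tE => [|i] hi ih ih' iW oki tE; first by lia.
    rewrite chj; last by lia.
    move=> E; have H := okt_rgtR (okj i ltac:(lia)) E.
    have [e1 e2 _] := nR i q ltac:(lia) H.
    by move: ih'; rewrite e2 e1 /= eqxx.
  rewrite -chj; last by lia.
  move=> E; have H := okt_lftL (okj i.+1 ltac:(lia)) E.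
  have [e1 e2 _] := nL i.+1 q ltac:(lia) H.
  by move: ih'; rewrite e2 -e1 /= eqxx.
- rewrite vj; last by case: (m) => /=; lia.
  have [e|nh] := eqVneq (nhead m h) h; last exact: newhead.
  by move: athead; rewrite e.
- by case: (m) => /=; lia.
by case: (m) => /=; lia.
Qed.

Lemma sound_exec n t c h cf : t + n <= T0 + 1 -> 0 < t -> rowinv t c h ->
  exec n c = Some cf -> @tm_accept M cf.1.1.
Proof.
have WE := WdE.
elim: n t c h => [|n IH] t c h tn t0 inv /=.
  case E: (step c) => [c1|] // [<-].
  case: (inv) => _ _ hlo hhi; apply: (@rowinv_halt t c h) => //; try lia.
  by apply: leq_trans G_big; rewrite leq_mul2r; lia.
case E: (step c) => [c1|].
  move=> he; have [] := @rowinv_step t c h c1 _ t0 _ inv E; try lia.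
    by apply: leq_trans G_big; rewrite leq_mul2r; lia.
  by move=> h' inv'; apply: (IH t.+1 c1 h') => //; lia.
case=> <-; case: (inv) => _ _ hlo hhi; apply: (@rowinv_halt t c h) => //; try lia.
by apply: leq_trans G_big; rewrite leq_mul2r; lia.
Qed.

Lemma tiling_sound : exists2 w, size w <= P &
  forall n cf, n <= T0 -> exec n (init M (enc_pair x w)) = Some cf -> @tm_accept M cf.1.1.
Proof.
have [w sw inv] := rowinv1; exists w => // n cf nT he.
by apply: (sound_exec _ _ inv he) => //; lia.
Qed.

End Sound.

(** * Every accepting run gives a tiling *)

Definition nst (ch : config M * nat) : config M * nat :=
  if step ch.1 is Some c' then
    (c', if tm_delta ch.1.1.1 (head None ch.1.2) is Some (_, _, m) then nhead m ch.2 else ch.2)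
  else ch.

Lemma exec_halt n ch cf : exec n ch.1 = Some cf ->
  exists u, [/\ u <= n, (iter u nst ch).1 = cf, step cf = None
              & forall j, j < u -> step (iter j nst ch).1 <> None].
Proof.
elim: n ch => [|n IH] ch /=.
  by case E: (step ch.1) => // -[<-]; exists 0; split.
case E: (step ch.1) => [c'|]; last by case=> <-; exists 0; split.
have e1 : (nst ch).1 = c' by rewrite /nst E.
rewrite -e1 => /IH[u [un h1 h2 h3]]; exists u.+1; split=> //; first by rewrite iterSr.
by case=> [|j] hj; [rewrite /= E | rewrite iterSr; apply: h3].
Qed.

Section Complete.
Variables (G : nat) (w : seq bool) (n : nat) (cf : config M).
Hypotheses (G_big : (T0 + 3) * Wd <= G) (size_w : size w <= P) (n_le : n <= T0)
  (run : exec n (init M (enc_pair x w)) = Some cf) (acc : @tm_accept M cf.1.1).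

Let traj u := iter u nst (init M (enc_pair x w), h0).

Lemma traj_head u : u <= T0 -> h0 <= (traj u).2 + u /\ (traj u).2 <= h0 + u.
Proof.
elim: u => [|u IH] hu; first by rewrite /= /traj /=; lia.
have [] := IH (ltnW hu); rewrite /traj iterS -/(traj u) /nst.
case: (step _) => [c'|]; last by lia.
by case: (tm_delta _ _) => [[[q' w'] [||]]|] /=; lia.
Qed.

Lemma complete_stop : exists U, [/\ U <= T0, step (traj U).1 = None, @tm_accept M (traj U).1.1.1
  & forall j, j < U -> exists q' w' m, [/\
      tm_delta (traj j).1.1.1 (csym (traj j).1 (traj j).2 (traj j).2) = Some (q', w', m),
      (traj j.+1).2 = nhead m (traj j).2, (traj j.+1).1.1.1 = q' &
      forall i, csym (traj j.+1).1 (traj j.+1).2 i =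
        if i == (traj j).2 then w' else csym (traj j).1 (traj j).2 i]].
Proof.
have [U [Un e s hj]] := @exec_halt n (init M (enc_pair x w), h0) cf run.
exists U; split; [lia | by rewrite /traj e | by rewrite /traj e |] => j jU.
have [hlo hhi] := traj_head (ltac:(lia) : j <= T0).
have := step_delta (traj j).1 (ltac:(lia) : 0 < (traj j).2).
case D : (tm_delta _ _) => [[[q' w'] m]|]; last by move/(hj _ jU).
move=> [c' [sc cq csy]]; exists q', w', m.
have e' : traj j.+1 = (c', nhead m (traj j).2).
  by rewrite {1}/traj iterS -/(traj j) /nst sc -(csym_head _ (traj j).2) D.
by rewrite e'; split.
Qed.

Section Build.
Variable U : nat.
Hypotheses (U_le : U <= T0) (U_stop : step (traj U).1 = None) (U_acc : @tm_accept M (traj U).1.1.1)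
  (U_step : forall j, j < U -> exists q' w' m, [/\
      tm_delta (traj j).1.1.1 (csym (traj j).1 (traj j).2 (traj j).2) = Some (q', w', m),
      (traj j.+1).2 = nhead m (traj j).2, (traj j.+1).1.1.1 = q' &
      forall i, csym (traj j.+1).1 (traj j.+1).2 i =
        if i == (traj j).2 then w' else csym (traj j).1 (traj j).2 i]).

(* Row t > 0 shows the configuration after t - 1 steps; everything is erased after halting. *)
Definition cont t i : vcol :=
  if t == 0 then rowc i else if t <= U.+1 then ccell (traj t.-1).1 (traj t.-1).2 i else None.

(** The guess cells beyond the end of [w]; each of them sends [hmark] to its right. *)
Definition gblank j := (rowc j == guess) && (cont 1 j == cell None None).

(** A row has at most one head, so the emission from the left cell and that from the right cell
    never compete. The outer edges of every row are empty, which makes consecutive rows agree where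
    they are glued. *)
Definition edge t i : hcol :=
  if (i == 0) || (Wd <= i) then None else
  if (t == 0) && gblank i.-1 then hmark else
  if emitR (cont t i.-1) is Some q then hright q else
  if emitL (cont t i) is Some q then hleft q else None.

Definition tau a : tile :=
  (edge (a %/ Wd) (a %% Wd), edge (a %/ Wd) (a %% Wd).+1, cont (a %/ Wd) (a %% Wd),
   cont (a %/ Wd).+1 (a %% Wd)).

Lemma tau_row t i : i < Wd -> tau (t * Wd + i) = (edge t i, edge t i.+1, cont t i, cont t.+1 i).
Proof.
move=> iW; have W0 : 0 < Wd by lia.
by rewrite /tau divnMDl // divn_small // addn0 modnMDl modn_small.
Qed.

Lemma okt_row0 i : i < Wd -> okt (edge 0 i, edge 0 i.+1, cont 0 i, cont 1 i).
Proof.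
move=> iW; have WE := WdE.
have edgeE j : edge 0 j = if (0 < j) && gblank j.-1 then hmark
    else if j == h0 then hright (tm_start M) else None.
  rewrite /edge /cont /=; case: j => [|j] //=.
  case: leqP => [Wj|jW] /=.
    have -> : gblank j = false.
      rewrite /gblank; case: (rowc_cases j) => [[-> _]|[-> ->]|[k _ ->]|[k [e hk] ->]] //.
      by move: Wj; rewrite e WE /g0; lia.
    by rewrite ifF //; rewrite /h0; lia.
  case: ifP => // _; case E: (emitR (rowc j)) => [q|].
    by have [-> ->] := emitR_rowc E; rewrite eqxx.
  rewrite emitL_rowc; case: eqP => // -[ej]; move: E; by rewrite ej rowc_launch.
have bE : cont 1 i = ccell (init M (enc_pair x w)) h0 i by [].
have tE : cont 0 i = rowc i by [].
have ngb j : rowc j != guess -> gblank j = false by rewrite /gblank => /negbTE->.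
rewrite !edgeE tE; case: (rowc_cases i) => [[E hi]|[E hi]|[j [ej hj] E]|[j [ej hj] E]].
- have gi : gblank i = false by rewrite ngb // E.
  have bi : cont 1 i = cell None None.
    rewrite bE /ccell csym_init (_ : i == h0 = false); last by rewrite /h0; move: hi; rewrite /g0; lia.
    case: ifP => // ge; rewrite ifF; last by move: hi ge; rewrite /g0 /h0; lia.
    by rewrite nth_default // size_map; move: hi ge; rewrite /g0 /h0; lia.
  rewrite E gi andbF bi (_ : i.+1 == h0 = false); last by rewrite /h0; move: hi; rewrite /g0; lia.
  rewrite (_ : i == h0 = false); last by rewrite /h0; move: hi; rewrite /g0; lia.
  by case: ifP => _; rewrite /= ?eqxx ?orbT.
- have gi : gblank i = false by rewrite ngb // E.
  have gi' : gblank i.-1 = false by rewrite ngb // rowc_left //; lia.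
  rewrite E gi gi' !andbF hi eqxx (_ : Tm == h0 = false); last by rewrite /h0; lia.
  rewrite -hi bE /ccell csym_init hi ltnSn (_ : Tm == h0 = false) /= ?eqxx //.
  by rewrite /h0; lia.
- have gi : gblank i = false by rewrite ngb // E.
  have gi' : gblank i.-1 = false.
    rewrite ngb //; case: (rowc_cases i.-1) => [[-> _]|[-> _]|[k _ ->]|[k [e hk] _]] //.
    by move: e hk hj; rewrite ej /g0 /h0; lia.
  rewrite E gi gi' !andbF (_ : i.+1 == h0 = false); last by rewrite /h0; move: ej; rewrite /h0; lia.
  rewrite bE /ccell csym_init ej ltnNge leq_addr addKn hj.
  have [e0|ne0] := eqVneq (h0 + j) h0; last by rewrite /= !eqxx.
  apply/or4P; constructor 3; rewrite eqxx; apply/existsP; exists (tm_start M).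
  by rewrite !eqxx.
have i1 : i.+1 == h0 = false by rewrite ej /h0 /g0; lia.
have i2 : i == h0 = false by rewrite ej /h0 /g0; lia.
have b1 : cont 1 i = cell (nth None (map Some w) j) None.
  rewrite bE /ccell i2 csym_init ifF; last by rewrite ej /h0 /g0; lia.
  rewrite ifF; last by rewrite ej /h0 /g0; lia.
  by congr (cell (nth _ _ _) _); rewrite ej /h0 /g0; lia.
rewrite E b1 i1 i2 /=.
have [jw|jw] := ltnP j (size w).
  have gi : gblank i = false by rewrite /gblank b1 (nth_map false) // andbF.
  have gi' : (0 < i) && gblank i.-1 = false.
    apply/negP => /andP[i0]; rewrite /gblank => /andP[/eqP gg].
    case: (rowc_cases i.-1) gg => [[-> _]|[-> _]|[k _ ->]|[k [e hk] _ _]] //.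
    rewrite (_ : cont 1 i.-1 = ccell (init M (enc_pair x w)) h0 i.-1) // /ccell csym_init.
    rewrite (_ : i.-1 == h0 = false); last by rewrite e /h0 /g0; lia.
    rewrite ifF; last by rewrite e /h0 /g0; lia.
    rewrite ifF; last by rewrite e /h0 /g0; lia.
    rewrite (nth_map false); first by [].
    by move: e jw; rewrite ej /h0 /g0; lia.
  by rewrite gi gi' (nth_map false) //=; case: (nth _ _ _); rewrite /= ?eqxx ?orbT.
rewrite nth_default ?size_map // in b1 *.
have -> : gblank i by rewrite /gblank b1 E !eqxx.
by case: ifP => _; rewrite /= ?eqxx ?orbT.
Qed.

Lemma okt_rowS t i : i < Wd -> t < U -> okt (edge t.+1 i, edge t.+1 i.+1, cont t.+1 i, cont t.+2 i).
Proof.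
move=> iW tU; have WE := WdE.
have [q' [w' [m [D hm qq sy]]]] := U_step tU.
have [hlo hhi] := traj_head (ltac:(lia) : t <= T0).
have cE j : cont t.+1 j = ccell (traj t).1 (traj t).2 j by rewrite /cont /= ltnS ltnW.
have cE' j : cont t.+2 j = ccell (traj t.+1).1 (traj t.+1).2 j by rewrite /cont /= ltnS tU.
move: cE cE' D hm qq sy hlo hhi.
move: (traj t) (traj t.+1) => [c h] [c' h'] /= cE cE' D hm qq sy hlo hhi.
have eR j : emitR (ccell c h j) = if j == h then (if m is MRight then Some q' else None) else None.
  rewrite /ccell; case: eqP => [->|] //=; first by rewrite D; case: (m).
have eL j : emitL (ccell c h j) = if j == h then (if m is MLeft then Some q' else None) else None.
  rewrite /ccell; case: eqP => [->|] //=; first by rewrite D; case: (m).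
have edgeE j : j <= Wd -> edge t.+1 j = match m with
    | MRight => if j == h.+1 then hright q' else None
    | MLeft => if j == h then hleft q' else None | MStay => None end.
  move=> jW; rewrite /edge /= !cE eR eL.
  case: j jW => [|j] jW /=.
    by case: (m) => //; rewrite ifF //; rewrite /h0 in hlo; lia.
  case: leqP => [Wj|jW'] /=.
    by case: (m) => //; rewrite ifF //; move: hhi; rewrite /h0; lia.
  by rewrite eqSS; case: (m); do ?case: ifP.
rewrite !edgeE ?(ltnW iW) // cE cE' /ccell sy qq.
have [->|ih] := eqVneq i h.
  rewrite /= D hm; case: (m) => /=.
  - by rewrite !eqxx ifF ?ifF //=; rewrite /h0 in hlo; lia.
  - by rewrite !eqxx.
  by rewrite !eqxx ifF ?ifF //=; lia.
rewrite hm; case: (m) => /=.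
- rewrite (_ : (i == h.-1) = (i.+1 == h)); last by rewrite /h0 in hlo; lia.
  have [e0|ne0] := eqVneq i.+1 h; last by rewrite !eqxx.
  by apply/or4P; constructor 4; apply/existsP; exists q'; rewrite !eqxx.
- by rewrite (negbTE ih) !eqxx.
rewrite eqSS (negbTE ih); have [e0|ne0] := eqVneq i h.+1; last by rewrite !eqxx.
by apply/or4P; constructor 3; apply/existsP; exists q'; rewrite !eqxx.
Qed.

Lemma okt_row_stop i : i < Wd -> okt (edge U.+1 i, edge U.+1 i.+1, cont U.+1 i, cont U.+2 i).
Proof.
move=> iW; have WE := WdE.
have [hlo hhi] := traj_head U_le.
have cE j : cont U.+1 j = ccell (traj U).1 (traj U).2 j by rewrite /cont /= leqnn.
have cE' j : cont U.+2 j = None by rewrite /cont /= ltnn.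
move: cE U_stop U_acc hlo hhi; move: (traj U) => [c h] /= cE stop ac hlo hhi.
have D : tm_delta c.1.1 (csym c h h) = None.
  have := step_delta c (ltac:(move: hlo; rewrite /h0; lia) : 0 < h); case: (tm_delta _ _) => [[[q' w'] m]|] //.
  by case=> c' []; rewrite stop.
have eE j : edge U.+1 j = None.
  rewrite /edge /= !cE; case: ifP => // _.
  have -> : emitR (ccell c h j.-1) = None by rewrite /ccell; case: eqP => [->|] //=; rewrite D.
  by have -> : emitL (ccell c h j) = None by rewrite /ccell; case: eqP => [->|] //=; rewrite D.
rewrite !eE cE cE' /ccell; case: eqP => [->|_] /=; last by rewrite ?orbT.
by rewrite D ac.
Qed.

Lemma cont_late t i : U.+1 < t -> cont t i = None.
Proof. by move=> h; rewrite /cont; case: t h => // t h; rewrite leqNgt h. Qed.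

Lemma edge_late t i : U.+1 < t -> edge t i = None.
Proof. by move=> h; rewrite /edge !cont_late //; case: t h => // t h; case: ifP. Qed.

Lemma okt_tau t i : i < Wd -> okt (edge t i, edge t i.+1, cont t i, cont t.+1 i).
Proof.
move=> iW; case: t => [|t]; first exact: okt_row0.
have [tU|Ut] := ltnP t U; first exact: okt_rowS.
move: Ut; rewrite leq_eqVlt => /predU1P[<-|Ut]; first exact: okt_row_stop.
by rewrite !edge_late ?cont_late //; apply: ltnW.
Qed.

Lemma tiling_tau : tiling G Wd rowc tau.
Proof.
have WE := WdE; have W0 : 0 < Wd by lia.
have split_idx a : a = a %/ Wd * Wd + a %% Wd by apply: divn_eq.
have mW a : a %% Wd < Wd by rewrite ltn_mod.
(* As [U] is at most [T0], the [T0 + 3] rows that fit into [G] go beyond the run; the end of the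
   helix is erased even if [G] falls inside a row. *)
have late a : G <= a -> U.+1 < a %/ Wd.
  move=> Ga; rewrite leq_divRL //; apply: leq_trans Ga; apply: leq_trans G_big.
  by rewrite leq_mul2r; lia.
split.
- by move=> a _; rewrite /tau okt_tau.
- by rewrite /tau /lft /= mod0n /edge.
- move=> a _; rewrite {2}(split_idx a) tau_row // /rgt /=.
  have [h|h] := ltnP (a %% Wd).+1 Wd.
    by rewrite (_ : a.+1 = a %/ Wd * Wd + (a %% Wd).+1) ?tau_row // addnS -split_idx.
  have e : a.+1 = (a %/ Wd).+1 * Wd + 0 by rewrite {1}(split_idx a) mulSn; have := mW a; lia.
  by rewrite e tau_row // /lft /= /edge /= h.
- have h : U.+1 < G.-1 %/ Wd.
    rewrite leq_divRL //; have : U.+2 * Wd < (T0 + 3) * Wd by rewrite ltn_mul2r; lia.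
    by move: G_big; lia.
  by rewrite /tau /rgt /= edge_late.
- by move=> a aW; rewrite -[a]/(0 * Wd + a) tau_row.
- move=> a _; rewrite {2}(split_idx a) tau_row //.
  rewrite (_ : a + Wd = (a %/ Wd).+1 * Wd + a %% Wd) ?tau_row //.
  by rewrite {1}(split_idx a) mulSn; lia.
move=> a _ Ga; rewrite /tau /bot /= cont_late //.
by have := late _ Ga; rewrite divnDr // divnn W0 addn1.
Qed.

End Build.

Lemma tiling_complete : exists tau, tiling G Wd rowc tau.
Proof. by have [U [h1 h2 h3 h4]] := complete_stop; exists (tau U); apply: tiling_tau. Qed.

End Complete.
End Runs.
End Tiles.

(** * Turing machine combinators *)

(** Functions on the integers give cells absolute addresses, so the machines can be composed without
    tracking the shape of the two lists; [Rep] links them to configurations. *)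
Definition tape := int -> option bool.
Definition upd (T : tape) (p : int) (s : option bool) : tape := fun z => if z == p then s else T z.
Definition shift (m : move) (h : int) : int :=
  match m with MLeft => (h - 1)%R | MStay => h | MRight => (h + 1)%R end.

Lemma upd_id T p : upd T p (T p) = T.
Proof. by apply: functional_extensionality => z; rewrite /upd; case: eqP => [->|]. Qed.

Lemma upd_same T p s : upd T p s p = s.
Proof. by rewrite /upd eqxx. Qed.

Lemma upd_other T p s z : z != p -> upd T p s z = T z.
Proof. by rewrite /upd => /negbTE->. Qed.

Section Abstract.
Variable M : TM.

Definition acfg := (tm_state M * tape * int)%type.

Definition astep (c : acfg) : option acfg :=
  let: (q, T, h) := c in
  if tm_delta q (T h) is Some (q', w, m) then Some (q', upd T h w, shift m h) else None.

Inductive reach : nat -> acfg -> acfg -> Prop :=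
| reach0 c : reach 0 c c
| reachS n c c1 c2 : astep c = Some c1 -> reach n c1 c2 -> reach n.+1 c c2.

Lemma reach_trans n n' c c1 c2 : reach n c c1 -> reach n' c1 c2 -> reach (n + n') c c2.
Proof. by elim=> [//|{}n {}c c3 c4 s _ IH] /IH; apply: reachS. Qed.

Definition runs (T : tape) (h : int) (n : nat) (T' : tape) (h' : int) : Prop :=
  exists u q, [/\ u <= n, reach u (tm_start M, T, h) (q, T', h') & tm_delta q (T' h') = None].

Lemma runs_weak T h n n' T' h' : runs T h n T' h' -> n <= n' -> runs T h n' T' h'.
Proof. by move=> [u [q [un r d]]] nn; exists u, q; split=> //; apply: leq_trans nn. Qed.

Definition Rep (T : tape) (h : int) (L R : seq (option bool)) : Prop :=
  (forall i : nat, nth None R i = T (h + Posz i)%R) /\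
  (forall i : nat, nth None L i = T (h - 1 - Posz i)%R).

Lemma rep_step q T h L R q' T' h' : Rep T h L R -> astep (q, T, h) = Some (q', T', h') ->
  exists L' R', step (q, L, R) = Some (q', L', R') /\ Rep T' h' L' R'.
Proof.
move=> [rR rL] /=; have hd : head None R = T h by rewrite -nth0 rR addr0.
rewrite hd; case: (tm_delta q (T h)) => [[[q1 w] m]|] // [<- <- <-].
case: m; eexists; eexists; (split; [reflexivity|split]) => i /=.
- case: i => [|i] /=.
    by rewrite addr0 upd_other; [rewrite -nth0 rL subr0 | lia].
  case: i => [|i] /=; first by rewrite subrK upd_same.
  rewrite nth_behead rR upd_other; last by lia.
  by congr T; lia.
- by rewrite nth_behead rL upd_other; [congr T|]; lia.
- case: i => [|i] /=; first by rewrite addr0 upd_same.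
  by rewrite nth_behead rR upd_other //; lia.
- by rewrite rL upd_other //; lia.
- by rewrite nth_behead rR upd_other; [congr T|]; lia.
case: i => [|i] /=; first by rewrite subr0 addrK upd_same.
by rewrite rL upd_other; [congr T|]; lia.
Qed.

Lemma rep_halt q T h L R : Rep T h L R -> tm_delta q (T h) = None -> @step M (q, L, R) = None.
Proof. by move=> [rR _] d /=; rewrite -nth0 rR addr0 d. Qed.

Lemma reach_exec u n c c' L R : reach u c c' -> u <= n -> Rep c.1.2 c.2 L R ->
  tm_delta c'.1.1 (c'.1.2 c'.2) = None ->
  exists L' R', exec n (c.1.1, L, R) = Some (c'.1.1, L', R') /\ Rep c'.1.2 c'.2 L' R'.
Proof.
move=> r; elim: r n L R => {u c c'} [[[q T] h]|u [[q T] h] [[q1 T1] h1] c2 s r IH] n L R un rp d.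
  exists L, R; split=> //; case: n un => [|n] _ /=.
    by have /= := rep_halt rp d => ->.
  by have /= := rep_halt rp d => ->.
case: n un => // n un.
have [L' [R' [s' rp']]] := rep_step rp s.
have [L2 [R2 [e rp2]]] := IH n L' R' un rp' d.
by exists L2, R2; split=> //; move: s' e => /= ->.
Qed.

Definition input (x : seq bool) : tape :=
  fun z => if z is Posz i then nth None (map Some x) i else None.

Lemma runs_exec x n T h : runs (input x) 0 n T h ->
  exists c, exec n (init M x) = Some c /\ forall i : nat, nth None c.2 i = T (h + Posz i)%R.
Proof.
move=> [u [q [un r d]]].
have rp : Rep (input x) 0 [::] (map Some x).
  by split=> i; rewrite ?add0r // nth_nil; case E: (0 - 1 - Posz i)%R => [k|k] //; lia.
have [L' [R' [e [rR _]]]] := reach_exec r un rp d.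
by exists (q, L', R').
Qed.

End Abstract.

(** The index [size o] is included: the blank there is what ends the word. *)
Lemma take_bits_nth (o : seq bool) (R : seq (option bool)) :
  (forall i, i <= size o -> nth None R i = nth None (map Some o) i) -> take_bits R = o.
Proof.
elim: o R => [|b o IH] R h.
  by have := h 0 isT; case: R {h} => [|[c|] R].
have := h 0 isT; case: R h => [|[c|] R] //= h [->].
by rewrite (IH R) // => i hi; apply: (h i.+1).
Qed.

Section Combinators.
Variables (p : pred (option bool)) (A B : TM).

Definition actTM (f : option bool -> option bool) (m : move) : TM :=
  @mkTM bool false (fun=> true) (fun q s => if q then None else Some (true, f s, m)).

Definition seqTM : TM :=
  @mkTM (tm_state A + tm_state B)%type (inl (tm_start A)) (fun=> true)
    (fun q s => match q with
     | inl qa => match tm_delta qa s with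
                 | Some (q', w, m) => Some (inl q', w, m)
                 | None => Some (inr (tm_start B), s, MStay)
                 end
     | inr qb => match tm_delta qb s with
                 | Some (q', w, m) => Some (inr q', w, m)
                 | None => None
                 end
     end).

Definition ifTM : TM :=
  @mkTM (option (tm_state A + tm_state B))%type None (fun=> true)
    (fun q s => match q with
     | None => Some (Some (if p s then inl (tm_start A) else inr (tm_start B)), s, MStay)
     | Some (inl qa) => match tm_delta qa s with
                 | Some (q', w, m) => Some (Some (inl q'), w, m)
                 | None => None
                 end
     | Some (inr qb) => match tm_delta qb s with
                 | Some (q', w, m) => Some (Some (inr q'), w, m)
                 | None => None
                 end
     end).

Definition whileTM : TM :=
  @mkTM (option (tm_state A)) None (fun=> true)
    (fun q s => match q with
     | None => if p s then Some (Some (tm_start A), s, MStay) else None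
     | Some qa => match tm_delta qa s with
                 | Some (q', w, m) => Some (Some q', w, m)
                 | None => Some (None, s, MStay)
                 end
     end).

Lemma reach_emb (M N : TM) (e : tm_state M -> tm_state N) :
  (forall q s q' w m, tm_delta q s = Some (q', w, m) -> tm_delta (e q) s = Some (e q', w, m)) ->
  forall n (c c' : acfg M), reach n c c' ->
  reach n ((e c.1.1, c.1.2, c.2) : acfg N) (e c'.1.1, c'.1.2, c'.2).
Proof.
move=> he n c c'; elim=> {n c c'} [c|n [[q T] h] [[q1 T1] h1] c2 s _ IH]; first exact: reach0.
apply: reachS IH; move: s => /=.
by case E: (tm_delta q (T h)) => [[[q' w] m]|] // [<- <- <-]; rewrite (he _ _ _ _ _ E).
Qed.

Lemma runs_act f m T h : runs (actTM f m) T h 1 (upd T h (f (T h))) (shift m h).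
Proof. by exists 1, true; split=> //; apply: reachS (reach0 _). Qed.

Lemma reach_one (M : TM) (q q' : tm_state M) T h : tm_delta q (T h) = Some (q', T h, MStay) ->
  reach 1 (q, T, h) (q', T, h).
Proof. by move=> d; apply: reachS (reach0 _) => /=; rewrite d upd_id. Qed.

Lemma runs_seq T h n T1 h1 n' T2 h2 : runs A T h n T1 h1 -> runs B T1 h1 n' T2 h2 ->
  runs seqTM T h (n + n' + 1) T2 h2.
Proof.
move=> [u [q [un r d]]] [u' [q' [un' r' d']]].
exists (u + (1 + u')), (inr q' : tm_state seqTM); split; first lia; last by rewrite /= d'.
apply: reach_trans (reach_trans _ _).
- by apply: (@reach_emb A seqTM inl _ _ _ _ r) => a s a' w m /= ->.
- by apply: reach_one; rewrite /= d.
by apply: (@reach_emb B seqTM inr _ _ _ _ r') => a s a' w m /= ->.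
Qed.

Lemma runs_ifT T h n T1 h1 : p (T h) -> runs A T h n T1 h1 -> runs ifTM T h (n + 1) T1 h1.
Proof.
move=> pT [u [q [un r d]]]; exists (1 + u), (Some (inl q) : tm_state ifTM).
split; [lia | | by rewrite /= d].
apply: (@reach_trans _ 1 _ _ (Some (inl (tm_start A)) : tm_state ifTM, T, h)).
  by apply: reach_one; rewrite /= pT.
by apply: (@reach_emb A ifTM (fun a => Some (inl a)) _ _ _ _ r) => a s a' w m /= ->.
Qed.

Lemma runs_ifF T h n T1 h1 : ~~ p (T h) -> runs B T h n T1 h1 -> runs ifTM T h (n + 1) T1 h1.
Proof.
move=> pT [u [q [un r d]]]; exists (1 + u), (Some (inr q) : tm_state ifTM).
split; [lia | | by rewrite /= d].
apply: (@reach_trans _ 1 _ _ (Some (inr (tm_start B)) : tm_state ifTM, T, h)).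
  by apply: reach_one; rewrite /= (negbTE pT).
by apply: (@reach_emb B ifTM (fun a => Some (inr a)) _ _ _ _ r) => a s a' w m /= ->.
Qed.

Lemma runs_while0 T h : ~~ p (T h) -> runs whileTM T h 0 T h.
Proof. by move=> pT; exists 0, None; split=> //; [apply: reach0 | rewrite /= (negbTE pT)]. Qed.

Lemma runs_while1 T h n T1 h1 n' T2 h2 : p (T h) -> runs A T h n T1 h1 ->
  runs whileTM T1 h1 n' T2 h2 -> runs whileTM T h (n + n' + 2) T2 h2.
Proof.
move=> pT [u [q [un r d]]] [u' [q' [un' r' d']]].
exists (1 + (u + (1 + u'))), q'; split; [lia | | by []].
apply: (@reach_trans _ 1 _ _ (Some (tm_start A) : tm_state whileTM, T, h)).
  by apply: reach_one; rewrite /= pT.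
apply: reach_trans (reach_trans _ r').
  by apply: (@reach_emb A whileTM Some _ _ _ _ r) => a s a' w m /= ->.
by apply: reach_one; rewrite /= d.
Qed.

End Combinators.

Section Fast.
Variable Z : nat.

(* Time linear in the bound Z on all counters. *)
Definition fast (a : nat) (M : TM) T h T' h' := runs M T h (a * Z.+1) T' h'.

Lemma fast_weak a a' M T h T' h' : fast a M T h T' h' -> a <= a' -> fast a' M T h T' h'.
Proof. by move=> r le; apply: runs_weak r _; rewrite leq_mul2r le orbT. Qed.

Lemma fast_act f m T h T' h' : T' = upd T h (f (T h)) -> h' = shift m h ->
  fast 1 (actTM f m) T h T' h'.
Proof. by move=> -> ->; apply: runs_weak (runs_act _ _ _ _) _; rewrite mul1n. Qed.

Lemma fast_seq a b A B T h T1 h1 T2 h2 : fast a A T h T1 h1 -> fast b B T1 h1 T2 h2 ->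
  fast (a + b + 1) (seqTM A B) T h T2 h2.
Proof. by move=> r s; apply: runs_weak (runs_seq r s) _; rewrite !mulnDl; lia. Qed.

Lemma fast_ifT (p : pred (option bool)) a A B T h T1 h1 : p (T h) -> fast a A T h T1 h1 ->
  fast (a + 1) (ifTM p A B) T h T1 h1.
Proof. by move=> pT r; apply: runs_weak (runs_ifT B pT r) _; rewrite mulnDl; lia. Qed.

Lemma fast_ifF (p : pred (option bool)) b A B T h T1 h1 : ~~ p (T h) -> fast b B T h T1 h1 ->
  fast (b + 1) (ifTM p A B) T h T1 h1.
Proof. by move=> pT r; apply: runs_weak (runs_ifF A pT r) _; rewrite mulnDl; lia. Qed.

Definition skipTM := actTM id MStay.

Lemma fast_skip T h : fast 1 skipTM T h T h.
Proof. by apply: fast_act; rewrite ?upd_id. Qed.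

Fixpoint mvn (m : move) (n : nat) : TM := if n is n'.+1 then seqTM (actTM id m) (mvn m n') else skipTM.

Lemma runs_mvR n T h h' : h' = (h + Posz n)%R -> runs (mvn MRight n) T h (2 * n + 1) T h'.
Proof.
move=> ->; elim: n h => [|n IH] h /=.
  by rewrite addr0; have := @runs_act id MStay T h; rewrite upd_id.
have r := @runs_act id MRight T h; rewrite upd_id in r.
have -> : (h + Posz n.+1 = (h + 1) + Posz n)%R by lia.
by apply: runs_weak (runs_seq r (IH _)) _; lia.
Qed.

Lemma runs_mvL n T h h' : h' = (h - Posz n)%R -> runs (mvn MLeft n) T h (2 * n + 1) T h'.
Proof.
move=> ->; elim: n h => [|n IH] h /=.
  by rewrite subr0; have := @runs_act id MStay T h; rewrite upd_id.
have r := @runs_act id MLeft T h; rewrite upd_id in r.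
have -> : (h - Posz n.+1 = (h - 1) - Posz n)%R by lia.
by apply: runs_weak (runs_seq r (IH _)) _; lia.
Qed.

Lemma fast_mvR n T h h' : h' = (h + Posz n)%R -> fast (2 * n + 1) (mvn MRight n) T h T h'.
Proof. by move=> e; apply: runs_weak (runs_mvR _ e) _; rewrite leq_pmulr. Qed.

Lemma fast_mvL n T h h' : h' = (h - Posz n)%R -> fast (2 * n + 1) (mvn MLeft n) T h T h'.
Proof. by move=> e; apply: runs_weak (runs_mvL _ e) _; rewrite leq_pmulr. Qed.

Definition walk (m : move) (k : nat) : TM := whileTM isSome (mvn m k).

Lemma fast_walkR k n T h h' : n <= Z -> h' = (h + Posz (k * n))%R ->
  (forall j, j < n -> isSome (T (h + Posz (k * j))%R)) -> T h' = None ->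
  fast (2 * k + 3) (walk MRight k) T h T h'.
Proof.
move=> nZ e hs hN; apply: (@runs_weak _ _ _ (n * (2 * k + 3))); last first.
  by rewrite mulnC leq_mul2l ltnW ?orbT.
elim: n h h' e hs hN {nZ} => [|n IH] h h' e hs hN.
  have -> : h = h' by lia.
  by rewrite mul0n; apply: runs_while0; rewrite hN.
have h0 : isSome (T h) by have := hs 0 isT; rewrite muln0 addr0.
have r := @runs_mvR k T h _ erefl.
have r' : runs (walk MRight k) T (h + Posz k)%R (n * (2 * k + 3)) T h'.
  apply: IH => //; first by rewrite e mulnS; lia.
  move=> j hj; have := hs j.+1 hj; rewrite mulnS.
  by have -> : (h + Posz (k + k * j) = h + Posz k + Posz (k * j))%R by lia.
by apply: runs_weak (runs_while1 h0 r r') _; rewrite mulSn; lia.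
Qed.

Lemma fast_walkL k n T h h' : n <= Z -> h' = (h - Posz (k * n))%R ->
  (forall j, j < n -> isSome (T (h - Posz (k * j))%R)) -> T h' = None ->
  fast (2 * k + 3) (walk MLeft k) T h T h'.
Proof.
move=> nZ e hs hN; apply: (@runs_weak _ _ _ (n * (2 * k + 3))); last first.
  by rewrite mulnC leq_mul2l ltnW ?orbT.
elim: n h h' e hs hN {nZ} => [|n IH] h h' e hs hN.
  have -> : h = h' by lia.
  by rewrite mul0n; apply: runs_while0; rewrite hN.
have h0 : isSome (T h) by have := hs 0 isT; rewrite muln0 subr0.
have r := @runs_mvL k T h _ erefl.
have r' : runs (walk MLeft k) T (h - Posz k)%R (n * (2 * k + 3)) T h'.
  apply: IH => //; first by rewrite e mulnS; lia.
  move=> j hj; have := hs j.+1 hj; rewrite mulnS.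
  by have -> : (h - Posz (k + k * j) = h - Posz k - Posz (k * j))%R by lia.
by apply: runs_weak (runs_while1 h0 r r') _; rewrite mulSn; lia.
Qed.

End Fast.

(** * Unary counters on interleaved tracks *)

Section Tracks.
Variables (K : nat) (O : int) (x : seq bool) (Z : nat).
Hypothesis (K_gt0 : 0 < K).

(* To the right of O, tracks interleaved with period K: track 0 holds the input, track i > 0 the
   counter v i in unary.  The output grows leftwards from O - K - 1, the K blank cells in between
   serving as a left end for the walks along the tracks. *)
Definition addr p i : int := (O + Posz (K * p + i))%R.

Definition trk (v : nat -> nat) i p : option bool :=
  if i == 0 then nth None (map Some x) p else if p < v i then Some true else None.

Definition Enc (v : nat -> nat) (o : seq bool) (T : tape) : Prop :=
  (forall p i, i < K -> T (addr p i) = trk v i p) /\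
  (forall k : nat, T (O - 1 - Posz k)%R = if k < K then None else nth None (map Some (rev o)) (k - K)).

Definition set (v : nat -> nat) t n : nat -> nat := fun i => if i == t then n else v i.

Lemma addr_inj p i p' i' : i < K -> i' < K -> addr p i = addr p' i' -> p = p' /\ i = i'.
Proof.
move=> iK iK' e; have {}e : K * p + i = K * p' + i' by move: e; rewrite /addr; lia.
have := congr1 (divn^~ K) e; have := congr1 (modn^~ K) e.
by rewrite /= ![K * _]mulnC !modnMDl !divnMDl // !modn_small // !divn_small // !addn0.
Qed.

Lemma Enc_upd v o T t p n s : Enc v o T -> 0 < t < K ->
  (forall p', p' != p -> (p' < n) = (p' < v t)) -> s = (if p < n then Some true else None) ->
  Enc (set v t n) o (upd T (addr p t) s).
Proof.
move=> [h1 h2] /andP[t0 tK] hn ->; split=> [p' i iK|k]; last first.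
  by rewrite upd_other ?h2 // /addr; lia.
rewrite /trk /set /upd; case: eqP => [/(addr_inj iK tK)[-> ->]|ne].
  by rewrite eqxx (gtn_eqF t0).
rewrite h1 // /trk; case: (i == 0) => //; case: (i =P t) => // e.
rewrite e hn //; apply/eqP => e'; by case: ne; rewrite e e'.
Qed.

Lemma Enc_ext v v' o T : (forall i, i < K -> 0 < i -> v i = v' i) -> Enc v o T -> Enc v' o T.
Proof.
move=> e [h1 h2]; split=> // p i iK; rewrite h1 // /trk.
by case: posnP => // i0; rewrite e.
Qed.

Lemma to_end v o T t : Enc v o T -> 0 < t < K -> v t <= Z ->
  fast Z (4 * K + 5) (seqTM (mvn MRight t) (walk MRight K)) T O T (addr (v t) t).
Proof.
move=> [h1 _] /andP[t0 tK] vZ.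
have H := fast_seq (@fast_mvR Z t T O _ erefl)
  (@fast_walkR Z K (v t) T (O + Posz t)%R (addr (v t) t) vZ _ _ _).
apply: fast_weak (H _ _ _) _; [by rewrite /addr; lia | | | lia].
- move=> j hj; rewrite (_ : O + Posz t + Posz (K * j) = addr j t)%R; last by rewrite /addr; lia.
  by rewrite h1 // /trk (gtn_eqF t0) hj.
by rewrite h1 // /trk (gtn_eqF t0) ltnn.
Qed.

Lemma Enc_left v o T t : Enc v o T -> t < K -> T (addr 0 t - Posz K)%R = None.
Proof.
move=> [_ h2] tK; have := h2 (K - 1 - t).
rewrite (_ : (O - 1 - Posz (K - 1 - t))%R = (addr 0 t - Posz K)%R); last by rewrite /addr muln0; lia.
by move=> ->; rewrite ifT //; lia.
Qed.

(** The way back to [O]: along the track to the blank cell one period before its origin, then by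
    constant distances. It is entered one period left of position [p], which for [p = 0] is that
    blank cell already. *)
Definition from_end t : TM := seqTM (walk MLeft K) (seqTM (mvn MRight K) (mvn MLeft t)).

Lemma from_endP v o T t p : Enc v o T -> 0 < t < K -> p <= v t -> p <= Z ->
  fast Z (10 * K + 20) (from_end t) T (addr p t - Posz K)%R T O.
Proof.
move=> E /andP[t0 tK] pv pZ; case: (E) => [h1 _].
have H := fast_seq (@fast_walkL Z K p T (addr p t - Posz K)%R (addr 0 t - Posz K)%R pZ _ _ _)
  (fast_seq (@fast_mvR Z K T _ (addr 0 t) _) (@fast_mvL Z t T _ O _)).
apply: fast_weak (H _ _ _ _ _) _; last by lia.
- by rewrite /addr; lia.
- move=> j hj; rewrite (_ : addr p t - Posz K - Posz (K * j) = addr (p - j.+1) t)%R.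
    by rewrite h1 // /trk (gtn_eqF t0) ifT //; lia.
  by rewrite /addr mulnBr mulnS; have : K * j.+1 <= K * p by [rewrite leq_mul2l hj orbT]; rewrite mulnS; lia.
- exact: Enc_left E tK.
- by lia.
by rewrite /addr muln0; lia.
Qed.

Definition pushTM t : TM :=
  seqTM (seqTM (mvn MRight t) (walk MRight K)) (seqTM (actTM (fun=> Some true) MStay) (from_end t)).

Lemma push_ok v o T t : Enc v o T -> 0 < t < K -> v t < Z ->
  exists2 T', fast Z (20 * K + 40) (pushTM t) T O T' O & Enc (set v t (v t).+1) o T'.
Proof.
move=> E tK vZ.
exists (upd T (addr (v t) t) (Some true)); last first.
  by apply: Enc_upd => //; [move=> p' ne; lia | rewrite ltnSn].
have E' : Enc (set v t (v t).+1) o (upd T (addr (v t) t) (Some true)).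
  by apply: Enc_upd => //; [move=> p' ne; lia | rewrite ltnSn].
have vt : (v t).+1 <= set v t (v t).+1 t by rewrite /set eqxx.
have H := @from_endP _ _ _ t (v t).+1 E' tK vt vZ.
have e : (addr (v t).+1 t - Posz K = addr (v t) t)%R by rewrite /addr mulnS; lia.
rewrite e in H.
have A := @fast_act Z (fun=> Some true) MStay T (addr (v t) t) _ _ erefl erefl.
by apply: fast_weak (fast_seq (to_end E tK (ltnW vZ)) (fast_seq A H)) _; lia.
Qed.

Definition popTM t : TM :=
  seqTM (seqTM (mvn MRight t) (walk MRight K)) (seqTM (mvn MLeft K)
   (seqTM (actTM (fun=> None) MStay) (seqTM (mvn MLeft K) (from_end t)))).

Lemma pop_ok v o T t n : Enc v o T -> 0 < t < K -> v t = n.+1 -> n < Z ->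
  exists2 T', fast Z (20 * K + 40) (popTM t) T O T' O & Enc (set v t n) o T'.
Proof.
move=> E tK vt nZ.
have E' : Enc (set v t n) o (upd T (addr n t) None).
  by apply: Enc_upd => //; [move=> p' ne; rewrite vt; lia | rewrite ltnn].
exists (upd T (addr n t) None) => //.
have vn : n <= set v t n t by rewrite /set eqxx.
have H := @from_endP _ _ _ t n E' tK vn (ltnW nZ).
have A := @fast_act Z (fun=> None) MStay T (addr n t) _ _ erefl erefl.
have vZ : v t <= Z by rewrite vt.
have B := @fast_mvL Z K T (addr (v t) t) (addr n t).
have e : addr n t = (addr (v t) t - Posz K)%R by rewrite /addr vt mulnS; lia.
have C := @fast_mvL Z K (upd T (addr n t) None) (addr n t) _ erefl.
by apply: fast_weak (fast_seq (to_end E tK vZ) (fast_seq (B e) (fast_seq A (fast_seq C H)))) _; lia.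
Qed.

Definition outTM b : TM :=
  seqTM (mvn MLeft K.+1) (seqTM (walk MLeft 1) (seqTM (actTM (fun=> Some b) MStay)
   (seqTM (walk MRight 1) (mvn MRight K)))).

Lemma out_ok v o T b : Enc v o T -> size o < Z ->
  exists2 T', fast Z (20 * K + 40) (outTM b) T O T' O & Enc v (b :: o) T'.
Proof.
move=> [h1 h2] oZ; set q := (O - 1 - Posz (K + size o))%R.
have h3 (k : nat) : K <= k -> T (O - 1 - Posz k)%R = nth None (map Some (rev o)) (k - K).
  by move=> kK; rewrite h2 ltnNge kK.
exists (upd T q (Some b)); last first.
  split=> [p i iK|k]; first by rewrite upd_other ?h1 // /q /addr; lia.
  rewrite rev_cons map_rcons nth_rcons size_map size_rev /upd.
  case: eqP => e.
    have -> : k = K + size o by move: e; rewrite /q; lia.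
    by rewrite addKn ltnn eqxx ltnNge leq_addr.
  rewrite h2; case: ltnP => // kK; case: ltnP => // h.
  rewrite nth_default ?size_map ?size_rev //; case: eqP => // e'.
  by case: e; rewrite /q; lia.
have W : fast Z (2 * 1 + 3) (walk MLeft 1) T (O - Posz K.+1)%R T q.
  apply: (@fast_walkL Z 1 (size o)); [lia | by rewrite /q; lia | |].
    move=> j hj; have := h3 (K + j) (leq_addr _ _).
    have -> : (O - 1 - Posz (K + j) = O - Posz K.+1 - Posz (1 * j))%R by lia.
    by move=> ->; rewrite addKn (nth_map false) // size_rev.
  by rewrite /q h3 ?leq_addr // addKn nth_default // size_map size_rev.
have W' : fast Z (2 * 1 + 3) (walk MRight 1) (upd T q (Some b)) q (upd T q (Some b)) (O - Posz K)%R.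
  apply: (@fast_walkR Z 1 (size o).+1); [lia | by rewrite /q; lia | |].
    move=> j hj; rewrite /upd; case: eqP => // ne.
    have j0 : 0 < j by case: j hj ne => // _ []; lia.
    have := h3 (K + (size o - j)) (leq_addr _ _).
    have -> : (O - 1 - Posz (K + (size o - j)) = q + Posz (1 * j))%R by rewrite /q; lia.
    by move=> ->; rewrite addKn (nth_map false) // size_rev; lia.
  rewrite upd_other; last by rewrite /q; lia.
  have := h2 (K - 1); rewrite (_ : (O - 1 - Posz (K - 1))%R = (O - Posz K)%R); last by lia.
  by move=> ->; rewrite ifT //; lia.
have A := @fast_act Z (fun=> Some b) MStay T q _ _ erefl erefl.
have C : fast Z (2 * K + 1) (mvn MRight K) (upd T q (Some b)) (O - Posz K)%R (upd T q (Some b)) O.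
  by apply: fast_mvR; lia.
by apply: fast_weak (fast_seq (fast_mvL Z _ erefl) (fast_seq W (fast_seq A (fast_seq W' C)))) _; lia.
Qed.

(** The end of track [t] marks the position [v t]. Stepping across to track [u] at this position
    shows whether [v t < v u], or, on track 0, the input bit of index [v t]: one walk serves
    comparison and access, without changing the tape. *)
Definition testTM (p : pred (option bool)) t u (A B : TM) : TM :=
  let back := seqTM (mvn MRight t) (seqTM (mvn MLeft u) (seqTM (mvn MLeft K) (from_end t))) in
  seqTM (seqTM (mvn MRight t) (walk MRight K)) (seqTM (mvn MRight u) (seqTM (mvn MLeft t)
    (ifTM p (seqTM back A) (seqTM back B)))).

Lemma test_ok p v o T t u A B n T' h' : Enc v o T -> 0 < t < K -> u < K -> v t <= Z ->
  runs (if p (trk v u (v t)) then A else B) T O n T' h' ->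
  runs (testTM p t u A B) T O ((40 * K + 80) * Z.+1 + n) T' h'.
Proof.
move=> E tK uK vZ r; have [h1 _] := E.
have F1 := to_end E tK vZ.
have F2 : fast Z (2 * u + 1) (mvn MRight u) T (addr (v t) t) T (addr (v t) t + Posz u)%R.
  exact: fast_mvR.
have F3 : fast Z (2 * t + 1) (mvn MLeft t) T (addr (v t) t + Posz u)%R T (addr (v t) u).
  by apply: fast_mvL; rewrite /addr; lia.
set back := seqTM (mvn MRight t) (seqTM (mvn MLeft u) (seqTM (mvn MLeft K) (from_end t))).
have Bk : fast Z (20 * K + 30) back T (addr (v t) u) T O.
  have G1 : fast Z (2 * t + 1) (mvn MRight t) T (addr (v t) u) T (addr (v t) t + Posz u)%R.
    by apply: fast_mvR; rewrite /addr; lia.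
  have G2 : fast Z (2 * u + 1) (mvn MLeft u) T (addr (v t) t + Posz u)%R T (addr (v t) t).
    by apply: fast_mvL; lia.
  have G3 := @fast_mvL Z K T (addr (v t) t) _ erefl.
  have G4 := @from_endP _ _ _ t (v t) E tK (leqnn _) vZ.
  by apply: fast_weak (fast_seq G1 (fast_seq G2 (fast_seq G3 G4))) _; lia.
have Cc : runs (ifTM p (seqTM back A) (seqTM back B)) T (addr (v t) u)
    ((20 * K + 30) * Z.+1 + n + 1 + 1) T' h'.
  have e : T (addr (v t) u) = trk v u (v t) by rewrite h1.
  have := e; case: ifP r => pp r ee.
    by apply: runs_ifT; [rewrite e pp | apply: runs_seq Bk r].
  by apply: runs_ifF; [rewrite e pp | apply: runs_seq Bk r].
apply: runs_weak (runs_seq F1 (runs_seq F2 (runs_seq F3 Cc))) _.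
have : (2 * u + 1) * Z.+1 <= (2 * K) * Z.+1 by rewrite leq_mul2r; lia.
have : (2 * t + 1) * Z.+1 <= (2 * K) * Z.+1 by rewrite leq_mul2r; lia.
by rewrite !mulnDl; nia.
Qed.

End Tracks.

Section Copy.
Variables (K : nat) (O : int) (x : seq bool) (Z : nat).
Hypothesis (K_gt0 : 0 < K).

Definition copy_body J t : TM :=
  seqTM (mvn MLeft J) (seqTM (mvn MRight t) (seqTM (actTM (fun=> Some true) MStay)
   (seqTM (mvn MLeft t) (seqTM (mvn MRight J) (mvn MRight K))))).

Definition copyTM J t : TM :=
  seqTM (mvn MRight J) (seqTM (whileTM isSome (copy_body J t)) (seqTM (mvn MLeft K) (from_end K J))).

(** Both tracks use the same positions, so each mark is copied in constant time where the head
    stands; a trip to [O] for every mark would make the copy quadratic. *)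
Lemma copy_loop v o J t n p T : 0 < J < K -> 0 < t < K -> J != t -> p + n = v J ->
  Enc K O x (set v t p) o T ->
  exists2 T', runs (whileTM isSome (copy_body J t)) T (addr K O p J) (n * (20 * K + 20)) T' (addr K O (v J) J)
    & Enc K O x (set v t (v J)) o T'.
Proof.
move=> JK tK ne; case/andP: (JK) => J0 J1; case/andP: (tK) => t0 t1.
elim: n p T => [|n IH] p T pn E; have [h1 _] := E.
  have pv : p = v J by lia.
  exists T; last by rewrite -pv.
  rewrite mul0n pv; apply: runs_while0.
  by rewrite h1 // /trk /set (negbTE ne) (gtn_eqF J0) ltnn.
have E' : Enc K O x (set v t p.+1) o (upd T (addr K O p t) (Some true)).
  apply: Enc_ext (Enc_upd (n := p.+1) K_gt0 E tK _ _); last by rewrite ltnSn.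
    by move=> i _ _; rewrite /set; case: eqP.
  by move=> p' np; rewrite /set eqxx; lia.
have pn' : p.+1 + n = v J by lia.
have [T' r F] := IH p.+1 _ pn' E'.
exists T' => //.
have hs : isSome (T (addr K O p J)).
  by rewrite h1 // /trk /set (negbTE ne) (gtn_eqF J0) ifT //; lia.
have b1 : runs (mvn MLeft J) T (addr K O p J) (2 * J + 1) T (addr K O p 0).
  by apply: runs_mvL; rewrite /addr; lia.
have b2 : runs (mvn MRight t) T (addr K O p 0) (2 * t + 1) T (addr K O p t).
  by apply: runs_mvR; rewrite /addr; lia.
have b3 := runs_act (fun=> Some true) MStay T (addr K O p t).
set T1 := upd _ _ _ in b3 r *.
have b4 : runs (mvn MLeft t) T1 (addr K O p t) (2 * t + 1) T1 (addr K O p 0).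
  by apply: runs_mvL; rewrite /addr; lia.
have b5 : runs (mvn MRight J) T1 (addr K O p 0) (2 * J + 1) T1 (addr K O p J).
  by apply: runs_mvR; rewrite /addr; lia.
have b6 : runs (mvn MRight K) T1 (addr K O p J) (2 * K + 1) T1 (addr K O p.+1 J).
  by apply: runs_mvR; rewrite /addr mulnS; lia.
have b := runs_seq b1 (runs_seq b2 (runs_seq b3 (runs_seq b4 (runs_seq b5 b6)))).
by apply: runs_weak (runs_while1 hs b r) _; rewrite mulSn; lia.
Qed.

Lemma copy_ok v o J t T : Enc K O x v o T -> 0 < J < K -> 0 < t < K -> J != t ->
  v t = 0 -> v J <= Z ->
  exists2 T', runs (copyTM J t) T O ((50 * K + 60) * Z.+1) T' O & Enc K O x (set v t (v J)) o T'.
Proof.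
move=> E JK tK ne vt vJ.
have E0 : Enc K O x (set v t 0) o T.
  by apply: Enc_ext E => i _ _; rewrite /set; case: eqP => // ->.
have [T' r F] := copy_loop JK tK ne (add0n _) E0.
exists T' => //.
have b1 : runs (mvn MRight J) T O (2 * J + 1) T (addr K O 0 J).
  by apply: runs_mvR; rewrite /addr muln0; lia.
have b2 := @runs_mvL K T' (addr K O (v J) J) _ erefl.
have vJ' : v J <= set v t (v J) J by rewrite /set (negbTE ne).
have b3 := from_endP K_gt0 F JK vJ' vJ.
apply: runs_weak (runs_seq b1 (runs_seq r (runs_seq b2 b3))) _.
have : v J * (20 * K + 20) <= Z * (20 * K + 20) by rewrite leq_mul2r vJ orbT.
by case/andP: JK => J0 J1; rewrite !mulnS; nia.
Qed.

End Copy.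

(** * A loop language and its compilation *)

(* A variable is a counter (inl) or the index of an enclosing loop (inr, outermost first).  Counters only
   grow.  CFor j c runs c for the indices below counter j, read at entry, in decreasing order; accordingly
   COut prepends to the output.  CX tests a bit of the input. *)
Definition var := (nat + nat)%type.

Inductive cmd :=
| CSkip
| CPush (i : nat)
| COut (b : bool)
| CSeq (c1 c2 : cmd)
| CLt (u v : var) (c1 c2 : cmd)
| CX (u : var) (c1 c2 : cmd)
| CFor (j : nat) (c : cmd).

Definition state := ((nat -> nat) * seq bool)%type.

Definition get (cnt : nat -> nat) (ls : seq nat) (u : var) : nat :=
  match u with inl i => cnt i | inr l => nth 0 ls l end.

Fixpoint downto (S : Type) (f : nat -> S -> S) (n : nat) (st : S) : S :=
  if n is n'.+1 then downto f n' (f n' st) else st.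

Fixpoint dcost (S : Type) (f : nat -> S -> S) (g : nat -> S -> nat) (n : nat) (st : S) : nat :=
  if n is n'.+1 then 1 + g n' st + dcost f g n' (f n' st) else 0.

Lemma dcost_ge (S : Type) (f : nat -> S -> S) g n st : n <= dcost f g n st.
Proof. by elim: n st => //= n IH st; have := IH (f n st); lia. Qed.

Section Sem.
Variable x : seq bool.

Fixpoint sem (c : cmd) (ls : seq nat) (st : state) : state :=
  match c with
  | CSkip => st
  | CPush i => (set st.1 i (st.1 i).+1, st.2)
  | COut b => (st.1, b :: st.2)
  | CSeq c1 c2 => sem c2 ls (sem c1 ls st)
  | CLt u v c1 c2 => if get st.1 ls u < get st.1 ls v then sem c1 ls st else sem c2 ls st
  | CX u c1 c2 => if nth false x (get st.1 ls u) then sem c1 ls st else sem c2 ls st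
  | CFor j c => downto (fun q => sem c (rcons ls q)) (st.1 j) st
  end.

Fixpoint cost (c : cmd) (ls : seq nat) (st : state) : nat :=
  match c with
  | CSkip | CPush _ | COut _ => 1
  | CSeq c1 c2 => 1 + cost c1 ls st + cost c2 ls (sem c1 ls st)
  | CLt u v c1 c2 => 1 + (if get st.1 ls u < get st.1 ls v then cost c1 ls st else cost c2 ls st)
  | CX u c1 c2 => 1 + (if nth false x (get st.1 ls u) then cost c1 ls st else cost c2 ls st)
  | CFor j c => 1 + dcost (fun q => sem c (rcons ls q)) (fun q => cost c (rcons ls q)) (st.1 j) st
  end.

Definition bnd (m : nat) (st : state) : Prop := (forall i, st.1 i <= m) /\ size st.2 <= m.

Lemma bnd_weak m m' st : bnd m st -> m <= m' -> bnd m' st.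
Proof. by move=> [h1 h2] le; split=> [i|]; [apply: leq_trans (h1 i) le | apply: leq_trans h2 le]. Qed.

(** Each push and each printed bit is paid for by a unit of cost. *)
Lemma sem_bnd c ls st m : bnd m st -> bnd (m + cost c ls st) (sem c ls st).
Proof.
elim: c ls st m => [|i|b|c1 IH1 c2 IH2|u v c1 IH1 c2 IH2|u c1 IH1 c2 IH2|j c IH] ls st m B /=.
- exact: bnd_weak B (leq_addr _ _).
- case: (B) => h1 h2; split=> /= [k|]; last by lia.
  by rewrite /set; case: eqP => _; have := h1 k; have := h1 i; lia.
- by case: (B) => h1 h2; split=> /= [k|]; [have := h1 k; lia | lia].
- by apply: bnd_weak (IH2 _ _ _ (IH1 ls _ _ B)) _; lia.
- by case: ifP => _; [apply: bnd_weak (IH1 ls _ _ B) _ | apply: bnd_weak (IH2 ls _ _ B) _]; lia.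
- by case: ifP => _; [apply: bnd_weak (IH1 ls _ _ B) _ | apply: bnd_weak (IH2 ls _ _ B) _]; lia.
move: (st.1 j) => N; elim: N st m B => [|n IHn] st m B /=; first by apply: bnd_weak B _; lia.
by apply: bnd_weak (IHn _ _ (IH (rcons ls n) _ _ B)) _; lia.
Qed.

End Sem.

(** Odd tracks hold the counters and even positive tracks the loop indices, so neither family limits
    the other. *)
Definition vtrack (cnt : nat -> nat) (ls : seq nat) : nat -> nat :=
  fun i => if odd i then cnt i./2 else nth 0 ls i./2.-1.

Definition trv (u : var) : nat := match u with inl i => i.*2.+1 | inr l => l.*2.+2 end.

Lemma vtrack_trv cnt ls u : vtrack cnt ls (trv u) = get cnt ls u.
Proof. by case: u => i; rewrite /vtrack /= odd_double /= ?uphalf_double ?doubleK. Qed.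

Lemma half_level l : l.*2.+2./2.-1 = l.
Proof. by lia. Qed.

Lemma trv_gt0 u : 0 < trv u. Proof. by case: u. Qed.

Lemma cost_if k a a' b z : a <= a' -> b <= a' -> b * z + k * (a * z) <= (1 + k) * (a' * z).
Proof.
by move=> h1 h2; rewrite mulnDl mul1n leq_add ?leq_mul2l ?leq_mul2r ?h1 ?h2 ?orbT.
Qed.

Lemma cost_seq k1 k2 a1 a2 a z : a1 <= a -> a2 <= a -> 1 <= a * z ->
  k1 * (a1 * z) + k2 * (a2 * z) + 1 <= (1 + k1 + k2) * (a * z).
Proof.
move=> h1 h2 h; rewrite !mulnDl mul1n.
have : k1 * (a1 * z) <= k1 * (a * z) by rewrite leq_mul2l leq_mul2r h1 !orbT.
have : k2 * (a2 * z) <= k2 * (a * z) by rewrite leq_mul2l leq_mul2r h2 !orbT.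
by move: (k1 * _) (k2 * _) (k1 * _) (k2 * _) => *; lia.
Qed.

Section Compile.
Variable K : nat.

Fixpoint wfc (d : nat) (c : cmd) : bool :=
  match c with
  | CSkip | COut _ => true
  | CPush i => trv (inl i) < K
  | CSeq c1 c2 => wfc d c1 && wfc d c2
  | CLt u v c1 c2 => [&& trv u < K, trv v < K, wfc d c1 & wfc d c2]
  | CX u c1 c2 => [&& trv u < K, wfc d c1 & wfc d c2]
  | CFor j c => [&& trv (inl j) < K, trv (inr d) < K & wfc d.+1 c]
  end.

Fixpoint comp (d : nat) (c : cmd) : TM :=
  match c with
  | CSkip => skipTM
  | CPush i => pushTM K (trv (inl i))
  | COut b => outTM K b
  | CSeq c1 c2 => seqTM (comp d c1) (comp d c2)
  | CLt u v c1 c2 => testTM K isSome (trv u) (trv v) (comp d c1) (comp d c2)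
  | CX u c1 c2 => testTM K (fun s => s == Some true) (trv u) 0 (comp d c1) (comp d c2)
  | CFor j c =>
      let t := trv (inr d) in
      seqTM (copyTM K (trv (inl j)) t) (seqTM (mvn MRight t)
        (seqTM (whileTM isSome (seqTM (mvn MLeft t) (seqTM (popTM K t)
                 (seqTM (comp d.+1 c) (mvn MRight t))))) (mvn MLeft t)))
  end.

Hypothesis K_gt0 : 0 < K.

(** A unit of cost takes time linear in [Z]. Counters and output grow by at most the cost, so
    [m + cost x c ls st <= Z] keeps them below [Z] during the whole execution. *)
Definition okcomp d c a := forall x Z O ls st T m,
  size ls = d -> (forall l, nth 0 ls l <= Z) -> bnd m st -> m + cost x c ls st <= Z ->
  Enc K O x (vtrack st.1 ls) st.2 T ->
  exists2 T', runs (comp d c) T O (cost x c ls st * (a * Z.+1)) T' O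
    & Enc K O x (vtrack (sem x c ls st).1 ls) (sem x c ls st).2 T'.

Lemma set_counter cnt ls i n j : vtrack (set cnt i n) ls j = set (vtrack cnt ls) i.*2.+1 n j.
Proof.
rewrite /vtrack /set; case: ifP => oj.
  by have -> : (j./2 == i) = (j == i.*2.+1) by have := odd_double_half j; rewrite oj; lia.
by case: eqP oj => // ->; rewrite /= odd_double.
Qed.

Lemma set_level cnt ls n q j : 0 < j -> vtrack cnt (rcons ls q) j =
  set (vtrack cnt (rcons ls n)) (trv (inr (size ls))) q j.
Proof.
move=> j0; rewrite /vtrack /set /=; case: ifP => oj.
  by rewrite ifF //; apply/eqP => e; move: oj; rewrite e /= odd_double.
rewrite !nth_rcons; have hj := odd_double_half j; rewrite oj in hj.
have [->|ne] := eqVneq j (size ls).*2.+2; first by rewrite half_level ltnn eqxx.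
by case: ltngtP => // e; case/eqP: ne; rewrite -hj; lia.
Qed.

Lemma for_loop x Z O c d a N ls st T m : okcomp d.+1 c a ->
  trv (inr d) < K -> size ls = d -> (forall l, nth 0 ls l <= Z) -> bnd m st ->
  m + dcost (fun q => sem x c (rcons ls q)) (fun q => cost x c (rcons ls q)) N st <= Z ->
  Enc K O x (vtrack st.1 (rcons ls N)) st.2 T ->
  let t := trv (inr d) in let st' := downto (fun q => sem x c (rcons ls q)) N st in
  exists2 T', runs (whileTM isSome (seqTM (mvn MLeft t) (seqTM (popTM K t)
                 (seqTM (comp d.+1 c) (mvn MRight t))))) T (O + Posz t)%R
     (dcost (fun q => sem x c (rcons ls q)) (fun q => cost x c (rcons ls q)) N st
        * ((a + 40 * K + 60) * Z.+1)) T' (O + Posz t)%R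
    & Enc K O x (vtrack st'.1 ls) st'.2 T'.
Proof.
move=> ok tK sls lZ B mZ E t; have t0 : 0 < t by [].
have vN st1 n : vtrack st1 (rcons ls n) t = n.
  by rewrite /t (vtrack_trv st1 (rcons ls n) (inr d)) /= nth_rcons sls ltnn eqxx.
have ad : addr K O 0 t = (O + Posz t)%R by rewrite /addr muln0 add0n.
elim: N st T m B mZ E => [|n IH] st T m B mZ E /=; have [h1 _] := E.
  exists T; last first.
    apply: Enc_ext E => i _ i0; rewrite /vtrack; case: ifP => // _.
    by rewrite nth_rcons; case: ltnP => // h; rewrite nth_default //; case: ifP.
  rewrite mul0n; apply: runs_while0.
  by rewrite -ad h1 // /trk vN.
have hs : isSome (T (O + Posz t)%R) by rewrite -ad h1 // /trk vN.
rewrite /= in mZ.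
have dn := dcost_ge (fun q => sem x c (rcons ls q)) (fun q => cost x c (rcons ls q)) n
  (sem x c (rcons ls n) st).
have [T1 r1 E1] : exists2 T1, fast Z (20 * K + 40) (popTM K t) T O T1 O &
    Enc K O x (set (vtrack st.1 (rcons ls n.+1)) t n) st.2 T1.
  by apply: pop_ok => //; lia.
have {}E1 : Enc K O x (vtrack st.1 (rcons ls n)) st.2 T1.
  by apply: Enc_ext E1 => i _ i0; rewrite (set_level _ _ n.+1) // sls.
have lZ' l : nth 0 (rcons ls n) l <= Z.
  by rewrite nth_rcons; case: ifP => // _; case: ifP => // _; lia.
have sz : size (rcons ls n) = d.+1 by rewrite size_rcons sls.
have [T2 r2 E2] := ok x Z O (rcons ls n) st T1 m sz lZ' B (ltac:(lia) : m + cost x c (rcons ls n) st <= Z) E1.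
have B2 := sem_bnd x c (rcons ls n) B.
have [T3 r3 E3] := IH _ T2 _ B2 (ltac:(lia)) E2.
exists T3 => //.
have b1 := @runs_mvL t T (O + Posz t)%R O (ltac:(lia)).
have b2 := @runs_mvR t T2 O _ erefl.
have b := runs_seq b1 (runs_seq r1 (runs_seq r2 b2)).
apply: runs_weak (runs_while1 hs b r3) _.
move: (cost x c (rcons ls n) st) (dcost _ _ n _) => k1 k2.
set W := (a + 40 * K + 60) * Z.+1.
have WE : W = a * Z.+1 + 40 * (K * Z.+1) + 60 * Z.+1 by rewrite /W; ring.
have kW : k1 * (a * Z.+1) <= k1 * W by rewrite leq_mul2l WE -addnA leq_addr orbT.
have KZ : K <= K * Z.+1 by apply: leq_pmulr.
have e0 : (20 * K + 40) * Z.+1 = 20 * (K * Z.+1) + 40 * Z.+1 by ring.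
have e1 : (1 + k1 + k2) * W = W + k1 * W + k2 * W by ring.
have tK' : t < K by [].
rewrite e0 e1; clearbody W t; clear - tK' kW KZ WE.
move: (k1 * (a * Z.+1)) (k1 * W) (k2 * W) (K * Z.+1) (a * Z.+1) kW KZ WE => *; lia.
Qed.

Lemma comp_ok c d : wfc d c -> exists a, okcomp d c a.
Proof.
elim: c d => [|i|b|c1 IH1 c2 IH2|u v c1 IH1 c2 IH2|u c1 IH1 c2 IH2|j c IH] d /=.
- move=> _; exists 1 => x Z O ls st T m _ _ _ _ E; exists T => //=.
  by rewrite mul1n; apply: fast_skip.
- move=> iK; exists (20 * K + 40) => x Z O ls st T m _ _ [B _] mZ E /=.
  have e : vtrack st.1 ls (trv (inl i)) = st.1 i by rewrite vtrack_trv.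
  have [|| T' r F] := @push_ok K O x Z K_gt0 _ _ _ (trv (inl i)) E.
  + by rewrite trv_gt0.
  + by rewrite e; have := B i; move: mZ => /=; lia.
  exists T'; first by rewrite mul1n.
  by apply: Enc_ext F => k _ _; rewrite set_counter e.
- move=> _; exists (20 * K + 40) => x Z O ls st T m _ _ [_ B] mZ E /=.
  have [|T' r F] := @out_ok K O x Z K_gt0 _ _ _ b E; first by move: mZ => /=; lia.
  by exists T' => //; rewrite mul1n.
- move=> /andP[/IH1[a1 ok1] /IH2[a2 ok2]]; exists (a1 + a2 + 1) => x Z O ls st T m sz lZ B mZ E.
  rewrite /= in mZ *.
  have [T1 r1 E1] := ok1 x Z O ls st T m sz lZ B (ltac:(lia)) E.
  have [T2 r2 E2] := ok2 x Z O ls _ T1 _ sz lZ (sem_bnd x c1 ls B) (ltac:(lia)) E1.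
  exists T2 => //; apply: runs_weak (runs_seq r1 r2) _.
  by apply: cost_seq; rewrite ?muln_gt0; lia.
- move=> /and4P[uK vK /IH1[a1 ok1] /IH2[a2 ok2]].
  exists (a1 + a2 + 40 * K + 80) => x Z O ls st T m sz lZ B mZ E.
  have eu : vtrack st.1 ls (trv u) = get st.1 ls u by rewrite vtrack_trv.
  have uZ : get st.1 ls u <= Z.
    by case: (u) => k /=; [case: (B) => h _; have := h k; lia | apply: lZ].
  have tu : 0 < trv u < K by rewrite trv_gt0.
  have te : isSome (trk x (vtrack st.1 ls) (trv v) (get st.1 ls u)) = (get st.1 ls u < get st.1 ls v).
    by rewrite /trk (gtn_eqF (trv_gt0 v)) vtrack_trv; case: ifP.
  rewrite /= in mZ *; case: ifP mZ te => hlt mZ te.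
    have [T1 r1 E1] := ok1 x Z O ls st T m sz lZ B (ltac:(lia)) E.
    exists T1 => //; apply: runs_weak (test_ok (Z := Z) (p := isSome) (u := trv v) (A := comp d c1) (B := comp d c2) K_gt0 E tu vK _ _) _.
    + by rewrite eu.
    + by rewrite eu te; exact: r1.
    by apply: cost_if; lia.
  have [T1 r1 E1] := ok2 x Z O ls st T m sz lZ B (ltac:(lia)) E.
  exists T1 => //; apply: runs_weak (test_ok (Z := Z) (p := isSome) (u := trv v) (A := comp d c1) (B := comp d c2) K_gt0 E tu vK _ _) _.
  + by rewrite eu.
  + by rewrite eu te; exact: r1.
  by apply: cost_if; lia.
- move=> /and3P[uK /IH1[a1 ok1] /IH2[a2 ok2]].
  exists (a1 + a2 + 40 * K + 80) => x Z O ls st T m sz lZ B mZ E.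
  have eu : vtrack st.1 ls (trv u) = get st.1 ls u by rewrite vtrack_trv.
  have uZ : get st.1 ls u <= Z.
    by case: (u) => k /=; [case: (B) => h _; have := h k; lia | apply: lZ].
  have tu : 0 < trv u < K by rewrite trv_gt0.
  have te : (trk x (vtrack st.1 ls) 0 (get st.1 ls u) == Some true) = nth false x (get st.1 ls u).
    rewrite /trk /=; have [h|h] := ltnP (get st.1 ls u) (size x).
      by rewrite (nth_map false) //; case: (nth _ _ _).
    by rewrite !nth_default ?size_map.
  rewrite /= in mZ *; case: ifP mZ te => hlt mZ te.
    have [T1 r1 E1] := ok1 x Z O ls st T m sz lZ B (ltac:(lia)) E.
    exists T1 => //; apply: runs_weak (test_ok (Z := Z) (p := fun s => s == Some true) (u := 0) (A := comp d c1) (B := comp d c2) K_gt0 E tu K_gt0 _ _) _.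
    + by rewrite eu.
    + by rewrite eu te; exact: r1.
    by apply: cost_if; lia.
  have [T1 r1 E1] := ok2 x Z O ls st T m sz lZ B (ltac:(lia)) E.
  exists T1 => //; apply: runs_weak (test_ok (Z := Z) (p := fun s => s == Some true) (u := 0) (A := comp d c1) (B := comp d c2) K_gt0 E tu K_gt0 _ _) _.
  + by rewrite eu.
  + by rewrite eu te; exact: r1.
  by apply: cost_if; lia.
move=> /and3P[jK tK /IH[a ok]]; exists (a + 100 * K + 200) => x Z O ls st T m sz lZ B mZ E.
have ej : vtrack st.1 ls (trv (inl j)) = st.1 j by rewrite vtrack_trv.
have et : vtrack st.1 ls (trv (inr d)) = 0 by rewrite vtrack_trv /= nth_default // sz.
have jZ : st.1 j <= Z by case: B => h _; have := h j; lia.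
have [|||||T1 r1 E1] := @copy_ok K O x Z K_gt0 _ _ (trv (inl j)) (trv (inr d)) _ E.
- by rewrite trv_gt0.
- by rewrite trv_gt0.
- by apply/eqP => /= e; lia.
- by [].
- by rewrite ej.
have {}E1 : Enc K O x (vtrack st.1 (rcons ls (st.1 j))) st.2 T1.
  apply: Enc_ext E1 => i _ i0; rewrite (set_level _ _ 0) // sz ej /set; case: eqP => // _.
  rewrite /vtrack; case: ifP => // _; rewrite nth_rcons; case: ltnP => // h.
  by rewrite nth_default //; case: ifP.
have mZ' : m + dcost (fun q => sem x c (rcons ls q)) (fun q => cost x c (rcons ls q)) (st.1 j) st <= Z.
  by move: mZ => /=; move: (dcost _ _ _ _) => k; lia.
have [T2 r2 E2] := for_loop ok tK sz lZ B mZ' E1.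
exists T2 => //=.
have b1 := @runs_mvR (trv (inr d)) T1 O _ erefl.
have b2 := @runs_mvL (trv (inr d)) T2 (O + Posz (trv (inr d)))%R O (ltac:(lia)).
apply: runs_weak (runs_seq r1 (runs_seq b1 (runs_seq r2 b2))) _.
move: (dcost _ _ _ _) => k.
have KZ : K <= K * Z.+1 by apply: leq_pmulr.
have e0 : (50 * K + 60) * Z.+1 = 50 * (K * Z.+1) + 60 * Z.+1 by ring.
have e1 : (1 + k) * ((a + 100 * K + 200) * Z.+1) = k * ((a + 100 * K + 200) * Z.+1)
    + a * Z.+1 + 100 * (K * Z.+1) + 200 * Z.+1 by ring.
have kW : k * ((a + 40 * K + 60) * Z.+1) <= k * ((a + 100 * K + 200) * Z.+1).
  by rewrite leq_mul2l leq_mul2r; lia.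
have {}tK : trv (inr d) < K by [].
rewrite e0 e1; move: (trv (inr d)) tK => t tK; clear - KZ kW tK.
by move: (k * _) (k * _) (K * Z.+1) (a * Z.+1) kW KZ => *; lia.
Qed.

End Compile.

Lemma wfc_exists c d : exists K0, forall K, K0 <= K -> wfc K d c.
Proof.
elim: c d => [|i|b|c1 IH1 c2 IH2|u v c1 IH1 c2 IH2|u c1 IH1 c2 IH2|j c IH] d.
- by exists 0.
- by exists (trv (inl i)).+1 => K h.
- by exists 0.
- have [K1 h1] := IH1 d; have [K2 h2] := IH2 d; exists (K1 + K2) => K h /=.
  by rewrite h1 ?h2 //; lia.
- have [K1 h1] := IH1 d; have [K2 h2] := IH2 d; exists (K1 + K2 + trv u + trv v).+1 => K h.
  by rewrite /= h1 ?h2; [rewrite !andbT; apply/andP; split | |]; lia.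
- have [K1 h1] := IH1 d; have [K2 h2] := IH2 d; exists (K1 + K2 + trv u).+1 => K h.
  by rewrite /= h1 ?h2; [rewrite !andbT | |]; lia.
have [K1 h1] := IH d.+1; exists (K1 + trv (inl j) + trv (inr d)).+1 => K h.
by rewrite /= h1; [rewrite !andbT; apply/andP; split | ]; move: h => /=; lia.
Qed.

(** * Spreading the input over its track *)

Section Load.
Variable K : nat.
Hypothesis K_gt1 : 1 < K.

(** Moves one bit to track 0 and adds a mark to track 1, which is counter 0 and finally holds the
    length of the input. The blank left in place of the bit lets the head find its way back. *)
Definition load_body (b : bool) : TM :=
  seqTM (actTM (fun=> None) MRight) (seqTM (walk MRight 1) (seqTM (mvn MRight K.+1)
  (seqTM (walk MRight K) (seqTM (actTM (fun=> Some b) MRight) (seqTM (actTM (fun=> Some true) MLeft)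
  (seqTM (walk MLeft K) (seqTM (mvn MLeft 2) (seqTM (walk MLeft 1) (mvn MRight 1))))))))).

Definition loadTM : TM :=
  seqTM (whileTM isSome (ifTM (fun s => s == Some true) (load_body true) (load_body false)))
   (mvn MRight K.+1).

Section Word.
Variable x : seq bool.
Let n := size x.
Let O : int := Posz (n + 1 + K).

Definition loaded (j : nat) (T : tape) : Prop :=
  [/\ forall p i, i < K -> T (addr K O p i) = trk (take j x) (set (fun=> 0) 1 j) i p,
      forall q, q < n + 1 + K -> T (Posz q) = if j <= q then nth None (map Some x) q else None
    & forall k, T (Negz k) = None].

Lemma loaded0 : loaded 0 (input x).
Proof.
split=> // p i iK.
rewrite /addr /O -PoszD /input nth_default ?size_map /trk ?take0 ?nth_nil //; last by rewrite -/n; lia.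
by rewrite /set; case: (i == 0) => //; case: (i == 1).
Qed.

Lemma load_step j T : loaded j T -> j < n ->
  exists2 T', fast n (20 * K + 60) (load_body (nth false x j)) T (Posz j) T' (Posz j.+1)
    & loaded j.+1 T'.
Proof.
move=> [h1 h2 h3] jn; set b := nth false x j.
pose T1 := upd T (Posz j) None.
pose T2 := upd T1 (addr K O j 0) (Some b).
pose T3 := upd T2 (addr K O j 1) (Some true).
have K0 : 0 < K by apply: ltnW.
have K0' : 0 < K := K0.
have aO p i : addr K O p i = Posz (n + 1 + K + (K * p + i)) by rewrite /addr /O -PoszD.
have posne p i q : q < n + 1 + K -> Posz q != addr K O p i by rewrite aO; lia.
have T1a p i : T1 (addr K O p i) = T (addr K O p i).
  by rewrite /T1 upd_other // eq_sym posne //; lia.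
exists T3; last first.
  split=> [p i iK|q qn|k]; last 2 first.
  - rewrite /T3 upd_other ?posne // /T2 upd_other ?posne // /T1 /upd.
    case: eqP => [[->]|ne]; first by rewrite ltnn.
    by rewrite h2 // [j <= q]leq_eqVlt; case: (j =P q) ne => [->|].
  - by rewrite /T3 upd_other ?aO // /T2 upd_other ?aO // /T1 upd_other.
  rewrite /T3 {1}/upd; case: eqP => [/(addr_inj K0 iK K_gt1)[-> ->]|ne1].
    by rewrite /trk /= /set /= ltnSn.
  rewrite /T2 {1}/upd; case: eqP => [/(addr_inj K0 iK K0)[-> ->]|ne0].
    rewrite /trk eqxx (nth_map false) ?nth_take // size_take -/n; case: ifP; lia.
  rewrite T1a h1 // /trk /set; case: (i =P 0) => [i0|_].
    have pj : p != j by apply/eqP => pj; case: ne0; rewrite pj i0.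
    rewrite !map_take; have [lt|ge] := ltnP p j; first by rewrite !nth_take // ltnW.
    by rewrite !nth_default // size_take size_map -/n; case: ifP; lia.
  case: (i =P 1) => // i1.
  have pj : p != j by apply/eqP => pj; case: ne1; rewrite pj i1.
  by rewrite ltnS [p <= j]leq_eqVlt (negbTE pj).
have A1 : fast n 1 (actTM (fun=> None) MRight) T (Posz j) T1 (Posz j.+1).
  by apply: fast_act => //=; lia.
have som q : j < q < n -> isSome (T1 (Posz q)).
  move=> hq; rewrite /T1 upd_other; last by lia.
  by rewrite h2 ?ifT ?(nth_map false) //; lia.
have T1n : T1 (Posz n) = None.
  rewrite /T1 upd_other; last by lia.
  by rewrite h2 ?nth_default ?size_map -/n; [case: ifP | lia..].
have A2 : fast n (2 * 1 + 3) (walk MRight 1) T1 (Posz j.+1) T1 (Posz n).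
  apply: (@fast_walkR n 1 (n - j.+1)) => //; [lia|lia|].
  by move=> i hi; rewrite -PoszD; apply: som; lia.
have A3 : fast n (2 * K.+1 + 1) (mvn MRight K.+1) T1 (Posz n) T1 (addr K O 0 0).
  by apply: fast_mvR; rewrite aO; lia.
have A4 : fast n (2 * K + 3) (walk MRight K) T1 (addr K O 0 0) T1 (addr K O j 0).
  apply: (@fast_walkR n K j); [lia | by rewrite !aO; lia | |].
    move=> i hi; have -> : (addr K O 0 0 + Posz (K * i))%R = addr K O i 0 by rewrite !aO; lia.
    by rewrite T1a h1 // /trk /= (nth_map false) // size_take jn.
  by rewrite T1a h1 // /trk /= nth_default // size_map size_take jn.
have A5 : fast n 1 (actTM (fun=> Some b) MRight) T1 (addr K O j 0) T2 (addr K O j 1).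
  by apply: fast_act => //=; rewrite !aO; lia.
have A6 : fast n 1 (actTM (fun=> Some true) MLeft) T2 (addr K O j 1) T3 (addr K O j 0).
  by apply: fast_act => //=; rewrite !aO; lia.
have T3low q : q < n + 1 + K -> T3 (Posz q) = T1 (Posz q).
  by move=> qn; rewrite /T3 upd_other ?posne // /T2 upd_other ?posne.
have A7 : fast n (2 * K + 3) (walk MLeft K) T3 (addr K O j 0) T3 (Posz n.+1).
  apply: (@fast_walkL n K j.+1); [lia | by rewrite aO mulnS; lia | |].
    move=> i hi; have -> : (addr K O j 0 - Posz (K * i))%R = addr K O (j - i) 0.
      have : K * i <= K * j by rewrite leq_mul2l; lia.
      by rewrite !aO mulnBr; lia.
    rewrite /T3 upd_other; last by apply/eqP => /(addr_inj K0 K0 K_gt1)[].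
    rewrite /T2 /upd; case: eqP => // ne.
    have i0 : 0 < i by case: i ne hi => // -[]; rewrite subn0.
    by rewrite T1a h1 // /trk /= (nth_map false) // size_take jn; lia.
  rewrite T3low; last by lia.
  rewrite /T1 upd_other; last by lia.
  by rewrite h2 ?nth_default ?size_map -/n; [case: ifP | lia..].
(* The previous walk stops at [n + 1], one period left of [O]; two moves pass over the blank cell
   [n] to the last cell of the input. *)
have A8 : fast n (2 * 2 + 1) (mvn MLeft 2) T3 (Posz n.+1) T3 (Posz n.-1).
  by apply: fast_mvL; lia.
have A9 : fast n (2 * 1 + 3) (walk MLeft 1) T3 (Posz n.-1) T3 (Posz j).
  apply: (@fast_walkL n 1 (n.-1 - j)); [lia | lia | |].
    move=> i hi; have -> : (Posz n.-1 - Posz (1 * i))%R = Posz (n.-1 - i) by lia.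
    by rewrite T3low; [apply: som|]; lia.
  by rewrite T3low; [rewrite /T1 upd_same | lia].
have A10 : fast n (2 * 1 + 1) (mvn MRight 1) T3 (Posz j) T3 (Posz j.+1).
  by apply: fast_mvR; lia.
apply: fast_weak (fast_seq A1 (fast_seq A2 (fast_seq A3 (fast_seq A4 (fast_seq A5 (fast_seq A6
  (fast_seq A7 (fast_seq A8 (fast_seq A9 A10))))))))) _.
by lia.
Qed.

Lemma load_loop k j T : j + k = n -> loaded j T ->
  exists2 T', runs (whileTM isSome (ifTM (fun s => s == Some true) (load_body true) (load_body false)))
     T (Posz j) (k * ((20 * K + 70) * n.+1)) T' (Posz n) & loaded n T'.
Proof.
elim: k j T => [|k IH] j T jk L; case: (L) => h1 h2 h3.
  have -> : j = n by lia.
  exists T; last by have <- : j = n by lia.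
  by rewrite mul0n; apply: runs_while0; rewrite h2 ?nth_default ?size_map -/n; [case: ifP | lia..].
have jn : j < n by lia.
have [T1 r1 L1] := load_step L jn.
have [T2 r2 L2] := IH j.+1 T1 (ltac:(lia)) L1.
exists T2 => //.
have e : T (Posz j) = Some (nth false x j) by rewrite h2 ?leqnn ?(nth_map false) -/n //; lia.
have r : fast n (20 * K + 60 + 1) (ifTM (fun s => s == Some true) (load_body true) (load_body false))
    T (Posz j) T1 (Posz j.+1).
  case E: (nth false x j) r1 e => r1 e; first by apply: fast_ifT; rewrite ?e.
  by apply: fast_ifF; rewrite ?e.
have s : isSome (T (Posz j)) by rewrite e.
by apply: runs_weak (runs_while1 s r r2) _; rewrite mulSn; lia.
Qed.

Definition cnt0 : nat -> nat := set (fun=> 0) 0 n.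

Lemma load_ok : exists2 T, runs loadTM (input x) 0 ((20 * K + 100) * n.+1 * n.+1) T O
  & Enc K O x (vtrack cnt0 [::]) [::] T.
Proof.
have [T r [h1 h2 h3]] := load_loop (add0n n) loaded0.
exists T.
  have m := @runs_mvR K.+1 T (Posz n) O (ltac:(rewrite /O; lia)).
  apply: runs_weak (runs_seq r m) _.
  have -> : (20 * K + 100) * n.+1 * n.+1 =
    n * ((20 * K + 70) * n.+1) + ((20 * K + 70) * n.+1 + 30 * (n.+1 * n.+1)) by ring.
  have : 20 * K + 70 <= (20 * K + 70) * n.+1 by apply: leq_pmulr.
  by move: (_ * n.+1) (n * _) => *; lia.
split=> [p i iK|k].
  rewrite h1 // take_size /trk /vtrack /cnt0 /set; case: (i =P 0) => // i0.
  have [oi|oi] := boolP (odd i); last by rewrite nth_nil; case: (i =P 1) oi => [->|].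
  have -> : (i./2 == 0) = (i == 1) by move: oi i0; lia.
  by case: (i == 1).
rewrite nth_nil.
have [lt|ge] := ltnP k (n + 1 + K).
  have -> : (O - 1 - Posz k)%R = Posz (n + K - k) by rewrite /O; lia.
  rewrite h2; last by lia.
  have -> : (if k < K then None else None) = None :> option bool by case: ifP.
  by case: ifP => // nk; rewrite nth_default ?size_map.
have -> : (O - 1 - Posz k)%R = Negz (k - (n + 1 + K)) by rewrite /O; lia.
by rewrite h3; case: ifP.
Qed.

End Word.
End Load.

(** * Polynomial bounds and the output of programs *)

Definition polyb (g : nat -> nat) : Prop := exists a b, forall n, g n <= a * n.+1 ^ b.

Lemma polyb_le g h : (forall n, g n <= h n) -> polyb h -> polyb g.
Proof. by move=> le [a [b hb]]; exists a, b => n; apply: leq_trans (le n) (hb n). Qed.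

Lemma polyb_const c : polyb (fun=> c).
Proof. by exists c, 0 => n; rewrite expn0 muln1. Qed.

Lemma polyb_id : polyb (fun n => n).
Proof. by exists 1, 1 => n; rewrite expn1 mul1n. Qed.

Lemma polyb_mul g h : polyb g -> polyb h -> polyb (fun n => g n * h n).
Proof.
move=> [a [b hg]] [c [d hh]]; exists (a * c), (b + d) => n.
by rewrite expnD mulnACA leq_mul.
Qed.

Lemma polyb_add g h : polyb g -> polyb h -> polyb (fun n => g n + h n).
Proof.
move=> [a [b hg]] [c [d hh]]; exists (a + c), (b + d) => n; rewrite expnD mulnDl.
apply: leq_add.
  by apply: leq_trans (hg n) _; rewrite mulnA leq_pmulr // expn_gt0.
by apply: leq_trans (hh n) _; rewrite mulnCA leq_pmull // expn_gt0.
Qed.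

Lemma polyb_exp g k : polyb g -> polyb (fun n => g n ^ k).
Proof.
move=> hg; elim: k => [|k IH]; first exact: polyb_const.
by apply: polyb_le (polyb_mul hg IH) => n; rewrite expnS.
Qed.

(** The constant [k] takes care of [n <= 1], where powers of [n] do not grow. For [n >= 2], use
    $n+1\le n^2$ and $a\le n^a$. *)
Lemma polyb_bound g : polyb g -> exists k, forall n, g n <= n ^ k + k.
Proof.
move=> [a [b h]]; exists (a * 2 ^ b + a + 2 * b) => n; apply: leq_trans (h n) _.
case: n => [|[|n]].
- by rewrite exp1n muln1; have := leq_pmulr a (expn_gt0 2 b); move: (a * _) => *; lia.
- by rewrite exp1n; lia.
set N := n.+2.
have h1 : N.+1 ^ b <= N ^ (2 * b).
  by rewrite expnM; case: (b) => // b'; rewrite leq_exp2r // /N expnS expn1; nia.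
have h2 : a <= N ^ a by apply: ltnW; apply: ltn_expl.
apply: leq_trans (leq_mul h2 h1) _; rewrite -expnD.
apply: leq_trans (leq_addr _ _); rewrite leq_exp2l //; lia.
Qed.

(** The result is read from the head onwards, so the head has to stop on its first bit; the blank
    cells before [O] end the word. *)
Definition finTM K : TM := seqTM (mvn MLeft K.+1) (seqTM (walk MLeft 1) (mvn MRight 1)).

Lemma fin_ok K (K0 : 0 < K) O x v o T Z : Enc K O x v o T -> size o <= Z ->
  exists h, fast Z (2 * K + 40) (finTM K) T O T h /\
    forall i, i <= size o -> T (h + Posz i)%R = nth None (map Some o) i.
Proof.
move=> [h1 h2] oZ.
have h3 (k : nat) : K <= k -> T (O - 1 - Posz k)%R = nth None (map Some (rev o)) (k - K).
  by move=> kK; rewrite h2 ltnNge kK.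
set h := (O - Posz (K + size o))%R.
exists h; split.
  have A1 : fast Z (2 * K.+1 + 1) (mvn MLeft K.+1) T O T (O - 1 - Posz K)%R.
    by apply: fast_mvL; lia.
  have A2 : fast Z (2 * 1 + 3) (walk MLeft 1) T (O - 1 - Posz K)%R T (h - 1)%R.
    apply: (@fast_walkL Z 1 (size o)) => //; first by rewrite /h; lia.
      move=> j hj; have -> : (O - 1 - Posz K - Posz (1 * j) = O - 1 - Posz (K + j))%R by lia.
      by rewrite h3 ?leq_addr // addKn (nth_map false) // size_rev.
    have -> : (h - 1 = O - 1 - Posz (K + size o))%R by rewrite /h; lia.
    by rewrite h3 ?leq_addr // addKn nth_default // size_map size_rev.
  have A3 : fast Z (2 * 1 + 1) (mvn MRight 1) T (h - 1)%R T h by apply: fast_mvR; lia.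
  by apply: fast_weak (fast_seq A1 (fast_seq A2 A3)) _; lia.
move=> i; rewrite leq_eqVlt => /predU1P[->|io].
  rewrite nth_default ?size_map //; have := h2 (K - 1).
  have -> : (O - 1 - Posz (K - 1) = h + Posz (size o))%R by rewrite /h; lia.
  by move=> ->; rewrite ifT //; lia.
have -> : (h + Posz i = O - 1 - Posz (K + (size o - 1 - i)))%R by rewrite /h; lia.
rewrite h3 ?leq_addr // addKn map_rev nth_rev size_map; last by lia.
by congr nth; lia.
Qed.

Theorem prog_polytime (c : cmd) (f : seq bool -> seq bool) :
  (forall x, (sem x c [::] (cnt0 x, [::])).2 = f x) ->
  (exists2 g, polyb g & forall x, cost x c [::] (cnt0 x, [::]) <= g (size x)) ->
  polytime_fun f.
Proof.
move=> hf [g pg hg].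
have [K1 wf] := wfc_exists c 0.
pose K := (K1 + 2).
have K1' : 1 < K by rewrite /K; lia.
have K0 : 0 < K := ltnW K1'.
have [a ok] := comp_ok K0 (wf K (leq_addr _ _)).
pose M := seqTM (loadTM K) (seqTM (comp K 0 c) (finTM K)).
pose Z n := n + g n.
pose time n := ((20 * K + 100) * n.+1 * n.+1) + (g n * (a * (Z n).+1) + (2 * K + 40) * (Z n).+1 + 1) + 1.
have pZ : polyb (fun n => (Z n).+1).
  apply: polyb_le (polyb_add (polyb_const 1) (polyb_add polyb_id pg)) => n.
  by rewrite /Z; lia.
have pS : polyb (fun n => n.+1).
  by apply: polyb_le (polyb_add (polyb_const 1) polyb_id) => n; lia.
have pt : polyb time.
  have p1 := polyb_mul (polyb_mul (polyb_const (20 * K + 100)) pS) pS.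
  have p2 := polyb_mul pg (polyb_mul (polyb_const a) pZ).
  have p3 := polyb_mul (polyb_const (2 * K + 40)) pZ.
  exact: polyb_add (polyb_add p1 (polyb_add (polyb_add p2 p3) (polyb_const 1))) (polyb_const 1).
have [k hk] := polyb_bound pt.
exists M, k => x.
have [T1 r1 E1] := load_ok K1' x.
have lZ l : nth 0 [::] l <= Z (size x) by rewrite nth_nil.
have B : bnd (size x) (cnt0 x, [::]).
  by split=> //= i; rewrite /cnt0 /set; case: eqP.
have mZ : size x + cost x c [::] (cnt0 x, [::]) <= Z (size x) by rewrite leq_add2l hg.
have [T2 r2 E2] := ok x (Z (size x)) _ [::] (cnt0 x, [::]) T1 (size x) erefl lZ B mZ E1.
have [_ so] := sem_bnd x c [::] B.
have [h [r3 hh]] := fin_ok K0 E2 (leq_trans so mZ).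
have r := runs_seq r1 (runs_seq r2 r3).
have r' : runs M (input x) 0 (size x ^ k + k) T2 h.
  apply: runs_weak r _; apply: leq_trans (hk (size x)); rewrite /time.
  by rewrite leq_add2r leq_add2l leq_add2r leq_add2r leq_mul2r hg orbT.
have [cf [e hc]] := runs_exec r'.
exists cf; split=> //; rewrite -hf; apply: take_bits_nth => i hi.
by rewrite hc hh.
Qed.

(** * The reduction *)

Section Reduction.
Variables (M : TM) (k e : nat).

(* Bounds for an input of length n: length of the certificates, length of the words given to the
   verifier, its running time, width of the blank margins of a row, width of a row. *)
Definition nP n := n ^ k + k.
Definition nS n := 2 * n + 2 + nP n.
Definition nT n := nS n ^ e + e.
Definition nTm n := 2 * nT n + 3.
Definition nW n := 4 * nT n + nS n + 7.
(** A number is less than two to its own power, so it can serve as the digit width without a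
    logarithm. It depends on the machine only and is a constant of the program. *)
Definition bexp := 2 * 2 ^ ktiles M * ncol M.

Lemma WdE' x : Wd M x (nP (size x)) (nTm (size x)) = nW (size x).
Proof. by rewrite WdE /nW /nTm /nS; lia. Qed.

Definition rnum m n : nat -> nat -> seq bool :=
  num bexp (ncol M) (2 ^ m) (nW n) (@lcode M) (@rcode M) (@tcode M) (@bcode M).

Definition rini x c := code (@rowc M x (nP (size x)) (nTm (size x)) c).

Definition rtgt m x : seq bool := tgt bexp (ncol M) (2 ^ m) (nW (size x)) (rini x).

Definition rlen m n := 3 * bexp * (2 ^ m + nW n).

Definition red_word m x : seq bool :=
  instance_word m (ktiles M) (rlen m (size x)) (rnum m (size x)) (rtgt m x).

Lemma bexp_big : 2 * 2 ^ ktiles M * ncol M < 2 ^ bexp.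
Proof. exact: ltn_expl. Qed.

Lemma red_word_correct m x : 0 < m -> (nT (size x) + 3) * nW (size x) <= 2 ^ m ->
  (forall y, exists c, exec (size y ^ e + e) (init M y) = Some c) ->
  SW_Rev_problem (red_word m x) <->
  exists2 w, size w <= nP (size x) &
    exists2 c, exec (size (enc_pair x w) ^ e + e) (init M (enc_pair x w)) = Some c & tm_accept c.1.1.
Proof.
move=> m0 Gb halts; set n := size x.
have W0 : 1 < nW n by rewrite /nW; lia.
have WG : nW n <= 2 ^ m by apply: leq_trans Gb; rewrite -/n; nia.
have C0 := ncol_gt0 M; have K0 : 0 < 2 ^ ktiles M by rewrite expn_gt0.
have tb : 2 * nT n + 2 < nTm n by rewrite /nTm; lia.
have We := WdE' x.
rewrite instance_wordP //; last 2 first.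
- by move=> a i h; apply: (@size_num (2 ^ ktiles M)) => //; exact: bexp_big.
- by rewrite /rtgt size_tgt.
rewrite (@subset_sum_tiled (2 ^ ktiles M) bexp (ncol M) (2 ^ m) (nW n)) //; last 3 first.
- by move=> i; apply: hcode_le.
- by move=> i; apply: vcode_le.
- exact: bexp_big.
rewrite -We in W0 WG *; rewrite tiled_tiling ?expn_gt0 // ?(ltnW W0) //.
have time w : size w <= nP n -> size (enc_pair x w) ^ e + e <= nT n.
  move=> hw; rewrite /nT leq_add2r; case: (e) => // e'; rewrite leq_exp2r //.
  by rewrite /enc_pair !size_cat -/(dbl x) size_dbl /nS -/n /=; lia.
rewrite -We in Gb; split=> [[ta til]|[w sw [c run acc]]].
  have [w sw hw] := tiling_sound tb Gb til; exists w => //.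
  have [c run] := halts (enc_pair x w); exists c => //.
  by apply: hw run; apply: time.
exact: (tiling_complete tb Gb sw (time _ sw) run acc).
Qed.

End Reduction.

Section Programs.
Variable x : seq bool.

Fixpoint costN (N : nat) (c : cmd) : nat :=
  match c with
  | CSkip | CPush _ | COut _ => 1
  | CSeq c1 c2 => 1 + costN N c1 + costN N c2
  | CLt _ _ c1 c2 => 1 + (costN N c1 + costN N c2)
  | CX _ c1 c2 => 1 + (costN N c1 + costN N c2)
  | CFor _ c => 1 + N * (1 + costN N c)
  end.

Lemma sem_grows c ls st i : st.1 i <= (sem x c ls st).1 i.
Proof.
elim: c ls st => [|j|b|c1 IH1 c2 IH2|u v c1 IH1 c2 IH2|u c1 IH1 c2 IH2|j c IH] ls st //=.
- by rewrite /set; case: eqP => [->|].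
- by apply: leq_trans (IH1 ls st) (IH2 ls _).
- by case: ifP.
- by case: ifP.
move: (st.1 j) => N; elim: N st => //= N IHN st.
by apply: leq_trans (IH (rcons ls N) st) (IHN _).
Qed.

(** Counters never decrease, so a bound on their final values bounds the length of every loop. *)
Lemma cost_le N c ls st : (forall i, (sem x c ls st).1 i <= N) -> cost x c ls st <= costN N c.
Proof.
elim: c ls st => [|j|b|c1 IH1 c2 IH2|u v c1 IH1 c2 IH2|u c1 IH1 c2 IH2|j c IH] ls st //= h.
- have h1 : cost x c1 ls st <= costN N c1.
    by apply: IH1 => i; apply: leq_trans (h i); apply: sem_grows.
  by have := IH2 _ _ h; lia.
- by case: ifP h => _ h; [have := IH1 _ _ h | have := IH2 _ _ h]; lia.
- by case: ifP h => _ h; [have := IH1 _ _ h | have := IH2 _ _ h]; lia.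
have grow n s i : s.1 i <= (downto (fun q => sem x c (rcons ls q)) n s).1 i.
  by elim: n s => //= n IHn s; apply: leq_trans (sem_grows c (rcons ls n) s i) (IHn _).
have hN : st.1 j <= N by apply: leq_trans (grow _ _ _) (h j).
suff : dcost (fun q => sem x c (rcons ls q)) (fun q => cost x c (rcons ls q)) (st.1 j) st <=
    st.1 j * (1 + costN N c).
  by have : st.1 j * (1 + costN N c) <= N * (1 + costN N c) by [rewrite leq_mul2r hN orbT]; lia.
move: (st.1 j) h {hN} => n; elim: n st => //= n IHn st h.
have h1 : cost x c (rcons ls n) st <= costN N c.
  by apply: IH => i; apply: leq_trans (h i); apply: grow.
by have := IHn _ h; rewrite mulSn; lia.
Qed.

(* Programs that only print: their output str no longer depends on the evolution of the counters. *)
Fixpoint emitter (c : cmd) : bool :=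
  match c with
  | CSkip | COut _ => true
  | CPush _ => false
  | CSeq c1 c2 | CLt _ _ c1 c2 | CX _ c1 c2 => emitter c1 && emitter c2
  | CFor _ c => emitter c
  end.

Fixpoint str (c : cmd) (ls : seq nat) (cnt : nat -> nat) : seq bool :=
  match c with
  | CSkip | CPush _ => [::]
  | COut b => [:: b]
  | CSeq c1 c2 => str c2 ls cnt ++ str c1 ls cnt
  | CLt u v c1 c2 => if get cnt ls u < get cnt ls v then str c1 ls cnt else str c2 ls cnt
  | CX u c1 c2 => if nth false x (get cnt ls u) then str c1 ls cnt else str c2 ls cnt
  | CFor j c => flatten [seq str c (rcons ls q) cnt | q <- iota 0 (cnt j)]
  end.

Lemma sem_emitter c ls cnt o : emitter c -> sem x c ls (cnt, o) = (cnt, str c ls cnt ++ o).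
Proof.
elim: c ls o => [|j|b|c1 IH1 c2 IH2|u v c1 IH1 c2 IH2|u c1 IH1 c2 IH2|j c IH] ls o //=.
- by case/andP => e1 e2; rewrite IH1 // IH2 // catA.
- by case/andP => e1 e2; case: ifP => _; [apply: IH1 | apply: IH2].
- by case/andP => e1 e2; case: ifP => _; [apply: IH1 | apply: IH2].
move=> e; elim: (cnt j) o => [//|n IHn] o.
by rewrite [LHS]/= IH // IHn -[in RHS]addn1 iotaD map_cat flatten_cat /= cats0 add0n -catA.
Qed.

(* The order is reversed because outputs are prepended. *)
Definition ECat (a b : cmd) : cmd := CSeq b a.
Definition ELit (s : seq bool) : cmd := foldr (fun b c => ECat (COut b) c) CSkip s.
Definition ECats (cs : seq cmd) : cmd := foldr ECat CSkip cs.
Definition ERep (j : nat) (s : seq bool) : cmd := CFor j (ELit s).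

Lemma str_lit s ls cnt : str (ELit s) ls cnt = s.
Proof. by elim: s => //= b s ->. Qed.

Lemma str_cats cs ls cnt : str (ECats cs) ls cnt = flatten [seq str c ls cnt | c <- cs].
Proof. by elim: cs => //= c cs ->. Qed.

Lemma str_rep j s ls cnt : str (ERep j s) ls cnt = flatten (nseq (cnt j) s).
Proof.
rewrite /=; congr flatten; under eq_map => q do rewrite str_lit.
by elim: (cnt j) 0 => //= n IH a; rewrite IH.
Qed.

Lemma emitter_lit s : emitter (ELit s).
Proof. by elim: s => //= b s ->. Qed.

Lemma emitter_cats cs : all emitter cs -> emitter (ECats cs).
Proof. by elim: cs => //= c cs IH /andP[-> /IH ->]. Qed.

End Programs.

Lemma polyb_costN N c : polyb N -> polyb (fun n => costN (N n) c).
Proof.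
move=> pN; elim: c => [|j|b|c1 IH1 c2 IH2|u v c1 IH1 c2 IH2|u c1 IH1 c2 IH2|j c IH] /=;
  try exact: polyb_const.
- exact: polyb_add (polyb_add (polyb_const 1) IH1) IH2.
- exact: polyb_add (polyb_const 1) (polyb_add IH1 IH2).
- exact: polyb_add (polyb_const 1) (polyb_add IH1 IH2).
exact: polyb_add (polyb_const 1) (polyb_mul pN (polyb_add (polyb_const 1) IH)).
Qed.

(** * Computing the parameters in unary *)

Section Arith.
Variable x : seq bool.

Definition CPushes j c : cmd := iter c (CSeq (CPush j)) CSkip.
Definition CAdd j i c : cmd := CFor i (CPushes j c).
Definition CMul j i1 i2 : cmd := CFor i1 (CFor i2 (CPush j)).
(** Counters cannot be reset, so each power is accumulated in a fresh one: counter [b + r] receives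
    the power of exponent [r]. *)
Fixpoint CPow b i k : cmd :=
  if k is k'.+1 then CSeq (CPow b i k') (CMul (b + k'.+1) (b + k') i) else CPush b.

Lemma set_id f i : set f i (f i) = f.
Proof. by apply: functional_extensionality => j; rewrite /set; case: eqP => [->|]. Qed.

Lemma set_set f i a b : set (set f i a) i b = set f i b.
Proof. by apply: functional_extensionality => j; rewrite /set; case: eqP. Qed.

Lemma set_same f i a : set f i a i = a.
Proof. by rewrite /set eqxx. Qed.

Lemma set_other f i a j : j != i -> set f i a j = f j.
Proof. by rewrite /set => /negbTE->. Qed.

Lemma sem_pushes j c ls cnt o : sem x (CPushes j c) ls (cnt, o) = (set cnt j (cnt j + c), o).
Proof.
elim: c cnt => [|c IH] cnt; first by rewrite addn0 set_id.
by rewrite /= IH set_same set_set addnS addSn.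
Qed.

Lemma sem_add j i c ls cnt o : sem x (CAdd j i c) ls (cnt, o) = (set cnt j (cnt j + cnt i * c), o).
Proof.
rewrite /=; move: (cnt i) => n; elim: n cnt => [|n IH] cnt; first by rewrite mul0n addn0 set_id.
by rewrite /= sem_pushes IH set_same set_set mulSn addnA.
Qed.

Lemma sem_mul j i1 i2 ls cnt o : i2 != j ->
  sem x (CMul j i1 i2) ls (cnt, o) = (set cnt j (cnt j + cnt i1 * cnt i2), o).
Proof.
move=> ne; rewrite /=; move: (cnt i1) => n; elim: n cnt => [|n IH] cnt.
  by rewrite mul0n addn0 set_id.
have inner m cnt' : downto (fun q st => (set st.1 j (st.1 j).+1, st.2)) m (cnt', o)
    = (set cnt' j (cnt' j + m), o) :> state.
  elim: m cnt' => [|m IHm] cnt'; first by rewrite addn0 set_id.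
  by rewrite /= IHm set_same set_set addSn addnS.
by rewrite /= inner IH set_same set_set set_other // mulSn addnA.
Qed.

Definition pows cnt b i k : nat -> nat :=
  fun j => if b <= j <= b + k then cnt i ^ (j - b) else cnt j.

Lemma sem_pow b i k ls cnt o : i < b -> (forall r, r <= k -> cnt (b + r) = 0) ->
  sem x (CPow b i k) ls (cnt, o) = (pows cnt b i k, o).
Proof.
move=> ib; elim: k => [|k IH] h.
  congr (_, _); apply: functional_extensionality => j; rewrite /pows /set /=.
  have [->|ne] := eqVneq j b.
    by rewrite addn0 leqnn subnn -[b in cnt b]addn0 h.
  by rewrite ifF //; lia.
have hi : i != b + k.+1 by lia.
have -> : sem x (CPow b i k.+1) ls (cnt, o) =
  sem x (CMul (b + k.+1) (b + k) i) ls (sem x (CPow b i k) ls (cnt, o)) by [].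
rewrite IH; last by move=> r hr; apply: h; lia.
rewrite sem_mul //; congr (_, _); apply: functional_extensionality => j.
have e1 : pows cnt b i k (b + k.+1) = 0 by rewrite /pows ifF ?h //; lia.
have e2 : pows cnt b i k (b + k) = cnt i ^ k by rewrite /pows ifT ?addKn //; lia.
have e3 : pows cnt b i k i = cnt i by rewrite /pows ifF //; lia.
rewrite e1 e2 e3 /set; have [->|ne] := eqVneq j (b + k.+1).
  by rewrite /pows ifT ?addKn ?expnSr ?add0n //; lia.
by rewrite /pows; congr (if _ then _ else _); lia.
Qed.

(** A while loop run as a bounded loop: [X] rounds suffice because $X\le 2^X$. The inner loop reads
    its length [G] at entry and so doubles [G]. Stopping at the first power that reaches [X] keeps
    the unary value linear in [X]. *)
Definition CDouble X G m : cmd :=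
  CFor X (CLt (inl G) (inl X) (CSeq (CFor G (CPush G)) (CPush m)) CSkip).

Lemma sem_double X G m ls cnt o : X != G -> X != m -> G != m -> cnt G = 1 -> cnt m = 0 ->
  exists e, [/\ sem x (CDouble X G m) ls (cnt, o) = (set (set cnt G (2 ^ e)) m e, o),
    cnt X <= 2 ^ e & 2 ^ e <= maxn 1 (2 * cnt X)].
Proof.
move=> XG Xm Gm G1 m0.
pose f q (s : state) := sem x (CLt (inl G) (inl X) (CSeq (CFor G (CPush G)) (CPush m)) CSkip) (rcons ls q) s.
have -> : sem x (CDouble X G m) ls (cnt, o) = downto f (cnt X) (cnt, o) by [].
have inner n cnt' : downto (fun q st => (set st.1 G (st.1 G).+1, st.2)) n (cnt', o)
    = (set cnt' G (cnt' G + n), o) :> state.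
  elim: n cnt' => [|n IHn] cnt'; first by rewrite addn0 set_id.
  by rewrite /= IHn set_same set_set addSn addnS.
pose st e := set (set cnt G (2 ^ e)) m e.
have stX e : st e X = cnt X by rewrite /st !set_other.
have stG e : st e G = 2 ^ e by rewrite /st set_other // set_same.
have stm e : st e m = e by rewrite /st set_same.
have st0 : cnt = st 0.
  by apply: functional_extensionality => j; rewrite /st /set; case: eqP => [->|] //; case: eqP => [->|].
have stS e : set (set (st e) G (2 ^ e.+1)) m e.+1 = st e.+1.
  apply: functional_extensionality => j; rewrite /st /set; case: eqP => //.
  by case: eqP.
have fS q e : f q (st e, o) = (st (if 2 ^ e < cnt X then e.+1 else e), o).
  rewrite /f /= stX stG; case: ifP => // _; rewrite inner /= stG.
  by rewrite -[in RHS]stS set_other ?stm 1?eq_sym // addnn -mul2n -expnS.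
have main n : exists e, [/\ downto f n (st 0, o) = (st e, o), n <= e \/ cnt X <= 2 ^ e
   & 2 ^ e <= maxn 1 (2 * cnt X)].
  have gen e0 : 2 ^ e0 <= maxn 1 (2 * cnt X) -> exists e, [/\ downto f n (st e0, o) = (st e, o),
     e0 + n <= e \/ cnt X <= 2 ^ e & 2 ^ e <= maxn 1 (2 * cnt X)].
    elim: n e0 => [|n IH] e0 h0; first by exists e0; split=> //; left; rewrite addn0.
    rewrite /= fS; case: ifP => lt.
      have h1 : 2 ^ e0.+1 <= maxn 1 (2 * cnt X) by rewrite leq_max; apply/orP; right; rewrite expnS leq_mul2l ltnW.
      have [e [d h2 h3]] := IH _ h1; exists e; split=> //.
      by case: h2 => h2; [left; lia | right].
    have [e [d h2 h3]] := IH _ h0; exists e; split=> //; right.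
    case: h2 => // h2; apply: leq_trans (_ : 2 ^ e0 <= _); first by rewrite leqNgt lt.
    by rewrite leq_exp2l //; lia.
  by have [|e [h1 h2 h3]] := gen 0; [rewrite leq_max | exists e].
have [e [d h1 h2]] := main (cnt X); exists e; split=> //; first by rewrite {2}st0.
by case: h1 => // h1; apply: leq_trans h1 (ltnW _); apply: ltn_expl.
Qed.

End Arith.

Section Setup.
Variables (k e : nat).

Definition CSeqs (cs : seq cmd) : cmd := foldr CSeq CSkip cs.

(* Counters: 0 input length n, 1 nP, 2 nS, 3 nT, 4 nTm, 5 nW - 2, 6 (nT + 3) * nW, 7 the least power of
   two G = 2 ^ m that is at least counter 6, 8 m, 9 nW; powers of n from 10 on, then powers of nS. *)
Definition setup : cmd := CSeqs [::
  CPow 10 0 k; CAdd 1 (10 + k) 1; CPushes 1 k;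
  CAdd 2 0 2; CAdd 2 1 1; CPushes 2 2;
  CPow (11 + k) 2 e; CAdd 3 (11 + k + e) 1; CPushes 3 e;
  CAdd 4 3 2; CPushes 4 3;
  CAdd 5 3 4; CAdd 5 2 1; CPushes 5 5;
  CAdd 9 5 1; CPushes 9 2;
  CMul 6 3 9; CAdd 6 9 3;
  CPushes 7 1; CDouble 6 7 8].

(* p and q are the bases of the two tables of powers, None while a table is still empty. *)
Definition mk (v : seq nat) (p q : option nat) : nat -> nat := fun j =>
  if j < 10 then nth 0 v j
  else if j <= 10 + k then (if p is Some z then z ^ (j - 10) else 0)
  else if j <= 11 + k + e then (if q is Some z then z ^ (j - (11 + k)) else 0) else 0.

Lemma set_mk v p q j y : j < 10 -> set (mk v p q) j y = mk (set_nth 0 v j y) p q.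
Proof.
move=> j10; apply: functional_extensionality => i; rewrite /set /mk nth_set_nth /=.
by case: eqP => [->|]; rewrite ?j10.
Qed.

Lemma mk_small v p q j : j < 10 -> mk v p q j = nth 0 v j.
Proof. by rewrite /mk => ->. Qed.

Lemma mk_pow1 v z q : mk v (Some z) q (10 + k) = z ^ k.
Proof. by rewrite /mk leqnn addKn. Qed.

Lemma mk_pow2 v p z : mk v p (Some z) (11 + k + e) = z ^ e.
Proof.
rewrite /mk (_ : 11 + k + e < 10 = false); last by lia.
by rewrite (_ : 11 + k + e <= 10 + k = false) ?leqnn ?addKn //; lia.
Qed.

Lemma pows_mk1 v q : pows (mk v None q) 10 0 k = mk v (Some (nth 0 v 0)) q.
Proof.
apply: functional_extensionality => j; rewrite /pows.
have [h|h] := ltnP j 10; first by rewrite /mk h.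
rewrite mk_small // /mk ltnNge h /=.
by case: (j <= 10 + k).
Qed.

Lemma pows_mk2 v p : pows (mk v p None) (11 + k) 2 e = mk v p (Some (nth 0 v 2)).
Proof.
apply: functional_extensionality => j; rewrite /pows [RHS]/mk mk_small //.
case: ifP => [/andP[h1 h2]|h].
  rewrite (_ : j < 10 = false); last by lia.
  by rewrite (_ : j <= 10 + k = false) ?h2 //; lia.
rewrite /mk; case: ifP => // h3; case: ifP => // h4; case: ifP => // h5.
by move: h; rewrite h5 andbT; lia.
Qed.

Definition vals n m := [:: n; nP k n; nS k n; nT k e n; nTm k e n; 4 * nT k e n + nS k n + 5;
  (nT k e n + 3) * nW k e n; 2 ^ m; m; nW k e n].

Definition final n m := mk (vals n m) (Some n) (Some (nS k n)).

Lemma step_add x ls v p q o j i c : j < 10 ->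
  sem x (CAdd j i c) ls (mk v p q, o) = (mk (set_nth 0 v j (nth 0 v j + mk v p q i * c)) p q, o).
Proof. by move=> h; rewrite sem_add set_mk // mk_small. Qed.

Lemma step_pushes x ls v p q o j c : j < 10 ->
  sem x (CPushes j c) ls (mk v p q, o) = (mk (set_nth 0 v j (nth 0 v j + c)) p q, o).
Proof. by move=> h; rewrite sem_pushes set_mk // mk_small. Qed.

Lemma step_mul x ls v p q o j i1 i2 : j < 10 -> i1 < 10 -> i2 < 10 -> i2 != j ->
  sem x (CMul j i1 i2) ls (mk v p q, o)
  = (mk (set_nth 0 v j (nth 0 v j + nth 0 v i1 * nth 0 v i2)) p q, o).
Proof. by move=> h h1 h2 ne; rewrite sem_mul // set_mk // !mk_small. Qed.

Lemma sem_setup x ls : exists m, [/\ sem x setup ls (cnt0 x, [::]) = (final (size x) m, [::]),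
  (nT k e (size x) + 3) * nW k e (size x) <= 2 ^ m
  & 2 ^ m <= maxn 1 (2 * ((nT k e (size x) + 3) * nW k e (size x)))].
Proof.
set n := size x.
have init : cnt0 x = mk [:: n; 0; 0; 0; 0; 0; 0; 0; 0; 0] None None.
  apply: functional_extensionality => j; rewrite /cnt0 /set /mk.
  by do 10 (case: j => [|j] //=); do ?case: ifP.
have seqE c cs st : sem x (CSeqs (c :: cs)) ls st = sem x (CSeqs cs) ls (sem x c ls st) by [].
pose S v p q c v' p' q' := sem x c ls (mk v p q, [::]) = (mk v' p' q', [::]).
have s1 : S [:: n; 0; 0; 0; 0; 0; 0; 0; 0; 0] None None (CPow 10 0 k)
    [:: n; 0; 0; 0; 0; 0; 0; 0; 0; 0] (Some n) None.
  rewrite /S sem_pow ?pows_mk1 // => r hr.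
  by rewrite /mk ltnNge leq_addr /= leq_add2l hr.
have s2 : S [:: n; 0; 0; 0; 0; 0; 0; 0; 0; 0] (Some n) None (CAdd 1 (10 + k) 1)
    [:: n; n ^ k; 0; 0; 0; 0; 0; 0; 0; 0] (Some n) None.
  by rewrite /S step_add // mk_pow1 muln1.
have s3 : S [:: n; n ^ k; 0; 0; 0; 0; 0; 0; 0; 0] (Some n) None (CPushes 1 k)
    [:: n; nP k n; 0; 0; 0; 0; 0; 0; 0; 0] (Some n) None by rewrite /S step_pushes.
have s4 : S [:: n; nP k n; 0; 0; 0; 0; 0; 0; 0; 0] (Some n) None (CAdd 2 0 2)
    [:: n; nP k n; 2 * n; 0; 0; 0; 0; 0; 0; 0] (Some n) None.
  by rewrite /S step_add // mk_small // [nth _ _ 0]/= mulnC.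
have s5 : S [:: n; nP k n; 2 * n; 0; 0; 0; 0; 0; 0; 0] (Some n) None (CAdd 2 1 1)
    [:: n; nP k n; 2 * n + nP k n; 0; 0; 0; 0; 0; 0; 0] (Some n) None.
  by rewrite /S step_add // mk_small // [nth _ _ 1]/= muln1.
have s6 : S [:: n; nP k n; 2 * n + nP k n; 0; 0; 0; 0; 0; 0; 0] (Some n) None (CPushes 2 2)
    [:: n; nP k n; nS k n; 0; 0; 0; 0; 0; 0; 0] (Some n) None.
  by rewrite /S step_pushes //; congr (mk _ _ _, _); rewrite /= /nS addnAC.
have s7 : S [:: n; nP k n; nS k n; 0; 0; 0; 0; 0; 0; 0] (Some n) None (CPow (11 + k) 2 e)
    [:: n; nP k n; nS k n; 0; 0; 0; 0; 0; 0; 0] (Some n) (Some (nS k n)).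
  rewrite /S sem_pow ?pows_mk2 // => r hr.
  rewrite /mk (_ : 11 + k + r < 10 = false); last by lia.
  rewrite (_ : 11 + k + r <= 10 + k = false); last by lia.
  by rewrite leq_add2l hr.
have s8 : S [:: n; nP k n; nS k n; 0; 0; 0; 0; 0; 0; 0] (Some n) (Some (nS k n)) (CAdd 3 (11 + k + e) 1)
    [:: n; nP k n; nS k n; nS k n ^ e; 0; 0; 0; 0; 0; 0] (Some n) (Some (nS k n)).
  by rewrite /S step_add // mk_pow2 muln1.
have s9 : S [:: n; nP k n; nS k n; nS k n ^ e; 0; 0; 0; 0; 0; 0] (Some n) (Some (nS k n)) (CPushes 3 e)
    [:: n; nP k n; nS k n; nT k e n; 0; 0; 0; 0; 0; 0] (Some n) (Some (nS k n)) by rewrite /S step_pushes.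
have s10 : S [:: n; nP k n; nS k n; nT k e n; 0; 0; 0; 0; 0; 0] (Some n) (Some (nS k n)) (CAdd 4 3 2)
    [:: n; nP k n; nS k n; nT k e n; 2 * nT k e n; 0; 0; 0; 0; 0] (Some n) (Some (nS k n)).
  by rewrite /S step_add // mk_small // [nth _ _ 3]/= mulnC.
have s11 : S [:: n; nP k n; nS k n; nT k e n; 2 * nT k e n; 0; 0; 0; 0; 0] (Some n) (Some (nS k n)) (CPushes 4 3)
    [:: n; nP k n; nS k n; nT k e n; nTm k e n; 0; 0; 0; 0; 0] (Some n) (Some (nS k n)).
  by rewrite /S step_pushes.
have s12 : S [:: n; nP k n; nS k n; nT k e n; nTm k e n; 0; 0; 0; 0; 0] (Some n) (Some (nS k n)) (CAdd 5 3 4)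
    [:: n; nP k n; nS k n; nT k e n; nTm k e n; 4 * nT k e n; 0; 0; 0; 0] (Some n) (Some (nS k n)).
  by rewrite /S step_add // mk_small // [nth _ _ 3]/= mulnC.
have s13 : S [:: n; nP k n; nS k n; nT k e n; nTm k e n; 4 * nT k e n; 0; 0; 0; 0] (Some n) (Some (nS k n)) (CAdd 5 2 1)
    [:: n; nP k n; nS k n; nT k e n; nTm k e n; 4 * nT k e n + nS k n; 0; 0; 0; 0] (Some n) (Some (nS k n)).
  by rewrite /S step_add // mk_small // [nth _ _ 2]/= muln1.
set w2 := 4 * nT k e n + nS k n + 5.
have s14 : S [:: n; nP k n; nS k n; nT k e n; nTm k e n; 4 * nT k e n + nS k n; 0; 0; 0; 0] (Some n) (Some (nS k n)) (CPushes 5 5)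
    [:: n; nP k n; nS k n; nT k e n; nTm k e n; w2; 0; 0; 0; 0] (Some n) (Some (nS k n)).
  by rewrite /S step_pushes.
have s15 : S [:: n; nP k n; nS k n; nT k e n; nTm k e n; w2; 0; 0; 0; 0] (Some n) (Some (nS k n)) (CAdd 9 5 1)
    [:: n; nP k n; nS k n; nT k e n; nTm k e n; w2; 0; 0; 0; w2] (Some n) (Some (nS k n)).
  by rewrite /S step_add // mk_small // [nth _ _ 5]/= muln1.
have s16 : S [:: n; nP k n; nS k n; nT k e n; nTm k e n; w2; 0; 0; 0; w2] (Some n) (Some (nS k n)) (CPushes 9 2)
    [:: n; nP k n; nS k n; nT k e n; nTm k e n; w2; 0; 0; 0; nW k e n] (Some n) (Some (nS k n)).
  have eW : nW k e n = w2 + 2 by rewrite /nW /w2; lia.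
  by rewrite /S step_pushes // eW.
set X := nT k e n * nW k e n.
have s17 : S [:: n; nP k n; nS k n; nT k e n; nTm k e n; w2; 0; 0; 0; nW k e n] (Some n) (Some (nS k n)) (CMul 6 3 9)
    [:: n; nP k n; nS k n; nT k e n; nTm k e n; w2; X; 0; 0; nW k e n] (Some n) (Some (nS k n)).
  by rewrite /S step_mul.
set X' := (nT k e n + 3) * nW k e n.
have s18 : S [:: n; nP k n; nS k n; nT k e n; nTm k e n; w2; X; 0; 0; nW k e n] (Some n) (Some (nS k n)) (CAdd 6 9 3)
    [:: n; nP k n; nS k n; nT k e n; nTm k e n; w2; X'; 0; 0; nW k e n] (Some n) (Some (nS k n)).
  have eX : X' = X + nW k e n * 3 by rewrite /X' mulnDl [3 * _]mulnC.
  by rewrite /S step_add // mk_small // eX.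
have s19 : S [:: n; nP k n; nS k n; nT k e n; nTm k e n; w2; X'; 0; 0; nW k e n] (Some n) (Some (nS k n)) (CPushes 7 1)
    [:: n; nP k n; nS k n; nT k e n; nTm k e n; w2; X'; 1; 0; nW k e n] (Some n) (Some (nS k n)).
  by rewrite /S step_pushes.
pose cs := mk [:: n; nP k n; nS k n; nT k e n; nTm k e n; w2; X'; 1; 0; nW k e n] (Some n) (Some (nS k n)).
have [m [d h1 h2]] := @sem_double x 6 7 8 ls cs [::] isT isT isT erefl erefl.
exists m; split=> //.
rewrite init /setup !seqE s1 s2 s3 s4 s5 s6 s7 s8 s9 s10 s11 s12 s13 s14 s15 s16 s17 s18 s19.
by rewrite -/cs d /cs !set_mk.
Qed.

Definition bound n : nat :=
  n + nP k n + nS k n + nT k e n + nTm k e n + nW k e n + 3 * ((nT k e n + 3) * nW k e n) + 1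
  + n.+1 ^ k + (nS k n).+1 ^ e.

Lemma final_le n m i : 2 ^ m <= maxn 1 (2 * ((nT k e n + 3) * nW k e n)) -> final n m i <= bound n.
Proof.
move=> hm; have mm : m < 2 ^ m by apply: ltn_expl.
have {}hm : 2 ^ m <= 2 * ((nT k e n + 3) * nW k e n) + 1.
  by apply: leq_trans hm _; rewrite geq_max; lia.
have pw z a c : a <= c -> z ^ a <= z.+1 ^ c.
  move=> h; apply: (@leq_trans (z.+1 ^ a)); last by rewrite leq_pexp2l.
  by case: (a) => // a'; rewrite leq_exp2r.
rewrite /final /mk; case: ifP => [h|h10].
  move: hm mm; rewrite /bound /vals; move: (n.+1 ^ k) ((nS k n).+1 ^ e) (2 ^ m) => A B G.
  move: ((nT k e n + 3) * nW k e n) => X hm mm.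
  have hw : 4 * nT k e n + nS k n + 5 <= nW k e n by rewrite /nW; lia.
  do 10 (case: i h => [|i] h //=; first by lia).
case: ifP => [h|h].
  have h0 : i - 10 <= k by lia.
  by have := pw n _ _ h0; rewrite /bound; lia.
case: ifP => [h1|//].
have h0 : i - (11 + k) <= e by lia.
by have := pw (nS k n) _ _ h0; rewrite /bound; lia.
Qed.

Lemma polyb_bound' : polyb bound.
Proof.
have p0 := polyb_id.
have c1 z := polyb_const z.
have pP : polyb (nP k) := polyb_add (polyb_exp k p0) (c1 k).
have pS : polyb (nS k) := polyb_add (polyb_add (polyb_mul (c1 2) p0) (c1 2)) pP.
have pT : polyb (nT k e) := polyb_add (polyb_exp e pS) (c1 e).
have pM : polyb (nTm k e) := polyb_add (polyb_mul (c1 2) pT) (c1 3).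
have pW : polyb (nW k e) := polyb_add (polyb_add (polyb_mul (c1 4) pT) pS) (c1 7).
have pX := polyb_mul (c1 3) (polyb_mul (polyb_add pT (c1 3)) pW).
have q1 : polyb (fun n => n.+1 ^ k).
  apply: polyb_exp; apply: polyb_le (polyb_add (c1 1) p0) => n; lia.
have q2 : polyb (fun n => (nS k n).+1 ^ e).
  apply: polyb_exp; apply: polyb_le (polyb_add (c1 1) pS) => n; lia.
exact: polyb_add (polyb_add (polyb_add (polyb_add (polyb_add (polyb_add (polyb_add (polyb_add
  (polyb_add p0 pP) pS) pT) pM) pW) pX) (c1 1)) q1) q2.
Qed.

End Setup.

(** * Printing the instance *)

Lemma flatten_nseq_dbl a c b : flatten (nseq a (dbl (nseq c b))) = dbl (nseq (c * a) b).
Proof.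
elim: a => [|a IH]; first by rewrite muln0.
by rewrite mulnS nseqD dbl_cat -IH.
Qed.

Lemma map_iota_const (T : Type) (w : T) a c : [seq w | _ <- iota a c] = nseq c w.
Proof. by elim: c a => //= c IH a; rewrite IH. Qed.

Lemma flatten5 (T : Type) (a b c d f : seq T) : flatten [:: a; b; c; d; f] = a ++ b ++ c ++ d ++ f.
Proof. by rewrite /= cats0. Qed.

Lemma flatten10 (T : Type) (a b c d f g h u v w y : seq T) :
  flatten [:: a; b; c; d; f; g; h; u ++ v; w; y] = a ++ (b ++ c ++ d) ++ f ++ g ++ h ++ u ++ v ++ w ++ y.
Proof. by rewrite /= cats0 -!catA. Qed.

Lemma cat6 (T : Type) (a b c d e f g h : seq T) :
  a ++ b ++ c ++ d ++ e ++ f ++ g ++ h = ((a ++ b ++ c ++ d ++ e ++ f) ++ g) ++ h.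
Proof. by rewrite -!catA. Qed.

Lemma dbl_flatten ts : dbl (flatten ts) = flatten (map dbl ts).
Proof. by elim: ts => //= t ts IH; rewrite dbl_cat IH. Qed.

Lemma flatten_lt (T : Type) a G (w : seq T) : a <= G ->
  flatten [seq (if q < a then w else [::]) | q <- iota 0 G] = flatten (nseq a w).
Proof.
move=> h; rewrite -{1}(subnKC h) iotaD map_cat flatten_cat add0n.
have -> : flatten [seq (if q < a then w else [::]) | q <- iota a (G - a)] = [::].
  have : all (fun q => a <= q) (iota a (G - a)) by apply/allP => q; rewrite mem_iota => /andP[].
  by elim: (iota a _) => //= q s IH /andP[aq /IH ->]; rewrite ltnNge aq.
rewrite cats0; have : all (fun q => q < a) (iota 0 a) by apply/allP => q; rewrite mem_iota.
have -> : nseq a w = nseq (size (iota 0 a)) w by rewrite size_iota.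
by elim: (iota 0 a) => //= q s IH /andP[-> /IH ->].
Qed.

Lemma flatten_ge (T : Type) a G (w : seq T) : a <= G ->
  flatten [seq (if q < a then [::] else w) | q <- iota 0 G] = flatten (nseq (G - a) w).
Proof.
move=> h; rewrite -{1}(subnKC h) iotaD map_cat flatten_cat add0n.
have -> : flatten [seq (if q < a then [::] else w) | q <- iota 0 a] = [::].
  have : all (fun q => q < a) (iota 0 a) by apply/allP => q; rewrite mem_iota.
  by elim: (iota 0 a) => //= q s IH /andP[-> /IH ->].
rewrite cat0s; have : all (fun q => a <= q) (iota a (G - a)) by apply/allP => q; rewrite mem_iota => /andP[].
have -> : nseq (G - a) w = nseq (size (iota a (G - a))) w by rewrite size_iota.
by elim: (iota a _) => //= q s IH /andP[aq /IH ->]; rewrite ltnNge aq.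
Qed.

Lemma flatten_gt (T : Type) a G (w : seq T) : a < G ->
  flatten [seq (if a < q then w else [::]) | q <- iota 0 G] = flatten (nseq (G - 1 - a) w).
Proof.
move=> h; rewrite -subnDA add1n -(flatten_ge w h); congr flatten; apply: eq_map => q.
by rewrite ltnNge ltnS; case: (q <= a).
Qed.

Lemma flatten_mkseq_mul (T : Type) (F : nat -> seq T) G K :
  flatten (mkseq F (G * K)) = flatten [seq flatten [seq F (a * K + q) | q <- iota 0 K] | a <- iota 0 G].
Proof.
elim: G => [//|G IH]; rewrite -[in RHS]addn1 iotaD map_cat flatten_cat -IH /= cats0 add0n.
rewrite mulSn addnC /mkseq iotaD map_cat flatten_cat add0n; congr (_ ++ flatten _).
by rewrite -[X in iota X _]addn0 iotaDl -map_comp.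
Qed.

(** Loops can print runs whose length is a constant times [G], [a] or [G - 1 - a], plus a constant.
    The truncated difference that gives the number of low zeros in a value of bidder 2 is brought to
    this form; [h] tells the half of the items. *)
Lemma zeros_count K G a i (h : bool) : a < G -> i < K ->
  (if h then 0 else K * G) + (K * (G - 1 - a) + (K - i + 2)) = G * K + G * K + 2 - (h * (G * K) + (a * K + i)).
Proof.
move=> aG iK; have : K * (G - 1 - a) + K * a + K = K * G by nia.
rewrite ![_ * K]mulnC; move: (K * (G - 1 - a)) (K * a) (K * G) => u v w E.
by case: h => /=; lia.
Qed.

Lemma ones_count K G a i (h : bool) :
  (if h then K * G else 0) + (K * a + i.+1) = (h * (G * K) + (a * K + i)).+1.
Proof. by rewrite ![_ * K]mulnC; case: h; rewrite ?mul1n ?mul0n ?addnS. Qed.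

Lemma flatten_nth (T U : Type) (x0 : T) (F : T -> seq U) s :
  flatten [seq F (nth x0 s q) | q <- iota 0 (size s)] = flatten (map F s).
Proof. by rewrite -[in RHS](mkseq_nth x0 s) -map_comp. Qed.

Lemma flatten_dbl (U : Type) (F : bool -> seq U) s :
  flatten (map F (dbl s)) = flatten [seq F c ++ F c | c <- s].
Proof. by elim: s => //= c s IH; rewrite IH catA. Qed.

Lemma flatten_row0 (M : TM) (U : Type) (F : vcol M -> seq U) x P Tm :
  flatten (map F (row0 M x P Tm)) = flatten (nseq Tm (F (cell None None))) ++ F (launch M)
  ++ flatten [seq F (cell (Some c) None) ++ F (cell (Some c) None) | c <- x]
  ++ (F (cell (Some false) None) ++ F (cell (Some true) None))
  ++ flatten (nseq P (F (guess M))) ++ flatten (nseq Tm (F (cell None None))).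
Proof.
rewrite -(@flatten_dbl _ (fun c => F (cell (Some c) None))).
by rewrite /row0 !map_cat !flatten_cat /= !map_cat !flatten_cat /= -!map_comp !map_nseq cats0 -!catA.
Qed.

Section Emit.
Variables (M : TM) (k e : nat) (x : seq bool) (m : nat).
Hypothesis G_big : nW k e (size x) <= 2 ^ m.
Let n := size x.
Let cnt := final k e n m.
Let K := 2 ^ ktiles M.
Let b := bexp M.
Let C := ncol M.
Let k0 := ktiles M.
Let G := 2 ^ m.
Let W := nW k e n.
Let N := nit m k0.

Definition EB s := ELit (dbl s).
Definition EBrep j s := ERep j (dbl s).
(* Below, loop level 0 is a cell a < G of the helix; Elo repeats s a times and Ehi G - 1 - a times. *)
Definition Elo s := CFor 7 (CLt (inr 1) (inr 0) (EB s) CSkip).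
Definition Ehi s := CFor 7 (CLt (inr 0) (inr 1) (EB s) CSkip).
Definition fl phi (s : seq bool) := map (addb phi) s.

Fixpoint emits (cs : seq cmd) (ss : seq (seq bool)) ls : Prop :=
  match cs, ss with
  | c :: cs', s :: ss' => str x c ls cnt = s /\ emits cs' ss' ls
  | [::], [::] => True
  | _, _ => False
  end.

Lemma str_emits cs ss ls : emits cs ss ls -> str x (ECats cs) ls cnt = flatten ss.
Proof. by elim: cs ss => [|c cs IH] [|s ss] //= [-> /IH ->]. Qed.

Lemma str_emits_dbl cs ts ls : emits cs (map dbl ts) ls -> str x (ECats cs) ls cnt = dbl (flatten ts).
Proof. by move=> h; rewrite (str_emits h) dbl_flatten. Qed.

Lemma str_EB s ls : str x (EB s) ls cnt = dbl s.
Proof. exact: str_lit. Qed.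

Lemma str_EBrep j s ls : str x (EBrep j s) ls cnt = dbl (flatten (nseq (cnt j) s)).
Proof. by rewrite /EBrep str_rep dbl_flatten map_nseq. Qed.

Lemma str_EBrep1 j phi c ls : str x (EBrep j (nseq c phi)) ls cnt = dbl (nseq (c * cnt j) phi).
Proof. by rewrite /EBrep str_rep flatten_nseq_dbl. Qed.

Lemma cnt7 : cnt 7 = G. Proof. by []. Qed.

Lemma str_Elo phi c a : a <= G -> str x (Elo (nseq c phi)) [:: a] cnt = dbl (nseq (c * a) phi).
Proof.
move=> h; rewrite -flatten_nseq_dbl -(flatten_lt _ h) -cnt7 /Elo.
transitivity (flatten [seq (if q < a then str x (EB (nseq c phi)) [:: a; q] cnt else [::]) | q <- iota 0 (cnt 7)]).
  by [].
by congr flatten; apply: eq_map => q; rewrite str_EB.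
Qed.

Lemma str_Ehi phi c a : a < G -> str x (Ehi (nseq c phi)) [:: a] cnt = dbl (nseq (c * (G - 1 - a)) phi).
Proof.
move=> h; rewrite -flatten_nseq_dbl -(flatten_gt _ h) -cnt7 /Ehi.
transitivity (flatten [seq (if a < q then str x (EB (nseq c phi)) [:: a; q] cnt else [::]) | q <- iota 0 (cnt 7)]).
  by [].
by congr flatten; apply: eq_map => q; rewrite str_EB.
Qed.

Definition tA i := blkA b C (@lcode M) (@tcode M) i.
Definition tB i := blkB b (@rcode M) i.
Definition tC i := blkC b (@bcode M) i.

(** The cell [a] is a loop index, while the type [i] is a constant of the machine: the blocks are
    literal strings, and only the padding depends on the counters. *)
Definition numE phi i := ECats [:: Elo (nseq (3 * b) phi); EB (fl phi (tA i)); EB (fl phi (tB i));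
  EBrep 5 (nseq (3 * b) phi); EB (fl phi (tC i)); Ehi (nseq (3 * b) phi)].

Lemma cnt5 : cnt 5 = W - 2.
Proof.
have -> : cnt 5 = 4 * nT k e n + nS k n + 5 by [].
by rewrite /W /nW; lia.
Qed.

Lemma str_numE phi i a : a < G ->
  str x (numE phi i) [:: a] cnt = dbl (fl phi (rnum M k e m n a i)).
Proof.
move=> h; rewrite (@str_emits_dbl _ [:: nseq (3 * b * a) phi; fl phi (tA i); fl phi (tB i);
  nseq (3 * b * (W - 2)) phi; fl phi (tC i); nseq (3 * b * (G - 1 - a)) phi]); last first.
  do ?apply: conj; [exact: str_Elo (ltnW h) | exact: str_EB | exact: str_EB | | exact: str_EB | exact: str_Ehi | by []].
  by rewrite -cnt5; apply: str_EBrep1.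
have -> : rnum M k e m n a i = nseq (3 * b * a) false ++ tA i ++ tB i ++ nseq (3 * b * (W - 2)) false
  ++ tC i ++ nseq (3 * b * (G - 1 - a)) false by [].
move: (tA i) (tB i) (tC i) (3 * b * a) (3 * b * _) (3 * b * _) => A B D u v w.
by rewrite /fl !map_cat !map_nseq !addbF /= cats0.
Qed.

Definition pbitsE phi i := ECats [:: EB [:: true]; EBrep 8 (nseq 1 phi); numE phi i; EBrep 8 (nseq 1 phi);
  EB (nseq (k0 + 2) phi); EB (if phi then [:: false] else [:: true]);
  EBrep 8 (nseq (if phi then 1 else 0) true); EB (if phi then [:: true] else [::])].

Lemma cnt8 : cnt 8 = m. Proof. by []. Qed.

Lemma str_pbitsE phi i a : a < G ->
  str x (pbitsE phi i) [:: a] cnt = dbl (pbits m k0 (rnum M k e m n) phi a i).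
Proof.
move=> h; rewrite (@str_emits_dbl _ [:: [:: true]; nseq (1 * m) phi; fl phi (rnum M k e m n a i); nseq (1 * m) phi;
  nseq (k0 + 2) phi; if phi then [:: false] else [:: true]; nseq ((if phi then 1 else 0) * m) true;
  if phi then [:: true] else [::]]); last first.
  rewrite -{1 3 4}cnt8; do ?apply: conj; try exact: str_EB; try exact: str_EBrep1; last by [].
  exact: str_numE.
congr dbl; rewrite /pbits /= !mul1n cats0 -addnA [in RHS]nseqD -catA.
congr (_ :: _ ++ _ ++ _ ++ _ ++ _); case: phi => //.
by congr (_ :: _); rewrite mul1n; elim: (m) => //= z ->.
Qed.

(** The exponent [Dexp] regrouped by counters. Both the number of items and the length of the
    numbers contain a multiple of [G], and the constant [6 * b] compensates for counter 5 holding
    the width minus 2. *)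
Definition denE := ECats [:: EBrep 8 (nseq 4 false); EBrep 7 (nseq (3 * b + 2 * K) false);
  EBrep 5 (nseq (3 * b) false); EB (nseq (2 * k0 + 6 * b + 8) false); EB [:: true]].

Lemma str_denE ls : str x denE ls cnt = dbl (rcons (nseq (Dexp m k0 (rlen M k e m n)) false) true).
Proof.
rewrite (@str_emits_dbl _ [:: nseq (4 * m) false; nseq ((3 * b + 2 * K) * G) false;
  nseq (3 * b * (W - 2)) false; nseq (2 * k0 + 6 * b + 8) false; [:: true]]); last first.
  rewrite -{1}cnt8 -{1}cnt7 -cnt5; do ?apply: conj; try exact: str_EB; try exact: str_EBrep1; by [].
congr dbl; rewrite /= -cats1 !catA -!nseqD; congr (nseq _ _ ++ _).
have W2 : 2 <= W by rewrite /W /nW; lia.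
rewrite /Dexp /rlen /nit -/b -/G -/W -/K.
have : 3 * b * (W - 2) + 6 * b = 3 * b * W by rewrite mulnBr; nia.
by move: (3 * b * (W - 2)) => z hz; rewrite mulnDr -hz mulnDl; lia.
Qed.

Definition sep := ELit [:: false; true].
(* Separator, then the denominator 1 in the encoding of an integer value. *)
Definition sep1 := ELit [:: false; true; true; true; false; true].

Definition valE (half : bool) i := ECats (if half then
  [:: Ehi (nseq K false); EB (nseq (K - i + 2) false); EBrep 7 (nseq K true); Elo (nseq K true); EB (nseq i.+1 true)]
  else [:: EBrep 7 (nseq K false); Ehi (nseq K false); EB (nseq (K - i + 2) false); Elo (nseq K true); EB (nseq i.+1 true)]).

Lemma str_valE half i a : a < G -> i < K ->
  str x (valE half i) [:: a] cnt =
  dbl (nseq (N + 2 - (half * (G * K) + (a * K + i))) false ++ nseq (half * (G * K) + (a * K + i)).+1 true).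
Proof.
move=> aG iK.
have hN : N = G * K + G * K by rewrite /N /nit -/G -/K mul2n addnn.
have z := zeros_count half aG iK; have o := ones_count K G a i half; rewrite -hN in z.
rewrite /valE; move: z o; case: half => <- <-.
  rewrite (@str_emits_dbl _ [:: nseq (K * (G - 1 - a)) false; nseq (K - i + 2) false; nseq (K * G) true;
    nseq (K * a) true; nseq i.+1 true]); last first.
    do ?apply: conj; try exact: str_EB; [exact: str_Ehi | exact: str_EBrep1 | exact: str_Elo (ltnW aG) | by []].
  by rewrite flatten5 catA -!nseqD.
rewrite (@str_emits_dbl _ [:: nseq (K * G) false; nseq (K * (G - 1 - a)) false; nseq (K - i + 2) false;
    nseq (K * a) true; nseq i.+1 true]); last first.
  do ?apply: conj; try exact: str_EB; [exact: str_EBrep1 | exact: str_Ehi | exact: str_Elo (ltnW aG) | by []].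
by rewrite flatten5 add0n !nseqD -!catA.
Qed.

Let D := Dexp m k0 (rlen M k e m n).

Definition itemE phi i := ECats [:: ELit [:: false]; valE phi i; sep1; ELit [:: false]; pbitsE phi i;
  sep; denE; sep].

Lemma str_itemE phi i a : a < G -> i < K -> str x (itemE phi i) [:: a] cnt =
  encval N (phi * (G * K) + (a * K + i)) ++ encprob (pbits m k0 (rnum M k e m n) phi a i) D.
Proof.
move=> aG iK; rewrite (@str_emits _ [:: [:: false];
  dbl (nseq (N + 2 - (phi * (G * K) + (a * K + i))) false ++ nseq (phi * (G * K) + (a * K + i)).+1 true);
  [:: false; true; true; true; false; true];
  [:: false]; dbl (pbits m k0 (rnum M k e m n) phi a i); [:: false; true];
  dbl (rcons (nseq D false) true); [:: false; true]]); last first.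
  do ?apply: conj; try exact: str_lit; last by [].
  - exact: str_valE.
  - exact: str_pbitsE.
  - exact: str_denE.
rewrite /encval /encprob -/D; move: (dbl _) (dbl _) (dbl _) => u v w.
by rewrite /= -!catA.
Qed.

Definition itemsE phi := CFor 7 (ECats [seq itemE phi i | i <- iota 0 K]).

Lemma str_itemsE phi : str x (itemsE phi) [::] cnt =
  flatten (mkseq (fun j => encval N (phi * (G * K) + j)
    ++ encprob (pbits m k0 (rnum M k e m n) phi (j %/ K) (j %% K)) D) (G * K)).
Proof.
have K0 : 0 < K by rewrite expn_gt0.
rewrite flatten_mkseq_mul.
transitivity (flatten [seq str x (ECats [seq itemE phi i | i <- iota 0 K]) [:: a] cnt | a <- iota 0 G]).
  by [].
congr flatten; apply/eq_in_map => a; rewrite mem_iota => /andP[_ aG].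
rewrite str_cats -map_comp; congr flatten; apply/eq_in_map => i; rewrite mem_iota => /andP[_ iK].
by rewrite [LHS]str_itemE // divnMDl // (divn_small iK) addn0 modnMDl (modn_small iK).
Qed.

Definition topE := ECats [:: ELit [:: false]; EB [:: false; false]; EBrep 7 (nseq (2 * K) true); EB [:: true];
  sep1; ELit [:: false]; EBrep 7 (nseq (2 * K) true); EB (nseq 3 true); sep;
  EBrep 7 (nseq (2 * K) false); EB (nseq 3 false ++ [:: true]); sep].

Lemma NE : 2 * K * G = N.
Proof. by rewrite /N /nit mulnAC mulnA. Qed.

Lemma str_topE ls : str x topE ls cnt = encval N N ++ encprob (nseq (N + 3) true) (N + 3).
Proof.
rewrite (@str_emits _ [:: [:: false]; dbl [:: false; false]; dbl (nseq N true); dbl [:: true];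
  [:: false; true; true; true; false; true];
  [:: false]; dbl (nseq N true); dbl (nseq 3 true); [:: false; true];
  dbl (nseq N false); dbl (nseq 3 false ++ [:: true]); [:: false; true]]); last first.
  by do ?apply: conj; try exact: str_lit; rewrite -?NE; try exact: str_EBrep1.
rewrite /encval /encprob -addn1 addKn -(addn1 N) !nseqD -cats1 !dbl_cat.
move: (dbl (nseq N true)) (dbl (nseq N false)) => u v.
by rewrite /= -!catA.
Qed.

Let B (v : vcol M) := blk b 1 C (C - code v).
Let blank : vcol M := cell None None.
Let bc (c : bool) : vcol M := cell (Some c) None.

Definition tgtE phi := ECats [:: EBrep 4 (fl phi (B blank)); EB (fl phi (B (launch M)));
  CFor 0 (CX (inr 0) (EB (fl phi (B (bc true) ++ B (bc true)))) (EB (fl phi (B (bc false) ++ B (bc false)))));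
  EB (fl phi (B (bc false) ++ B (bc true))); EBrep 1 (fl phi (B (guess M))); EBrep 4 (fl phi (B blank));
  CFor 7 (CLt (inr 0) (inl 9) CSkip (EB (fl phi (blk b 1 C C)))); EBrep 9 (fl phi (blk b 0 0 0))].

Lemma fl_cat phi s1 s2 : fl phi (s1 ++ s2) = fl phi s1 ++ fl phi s2.
Proof. exact: map_cat. Qed.

Lemma fl_flatten phi ss : fl phi (flatten ss) = flatten (map (fl phi) ss).
Proof. exact: map_flatten. Qed.

Lemma fl_rep phi c s : fl phi (flatten (nseq c s)) = flatten (nseq c (fl phi s)).
Proof. by rewrite fl_flatten map_nseq. Qed.

Lemma rtgtE : rtgt M k e m x = flatten (nseq (nTm k e n) (B blank)) ++ B (launch M)
  ++ flatten [seq B (bc c) ++ B (bc c) | c <- x] ++ (B (bc false) ++ B (bc true))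
  ++ flatten (nseq (nP k n) (B (guess M))) ++ flatten (nseq (nTm k e n) (B blank))
  ++ flatten (nseq (G - W) (blk b 1 C C)) ++ flatten (nseq W (blk b 0 0 0)).
Proof.
have sz : size (row0 M x (nP k n) (nTm k e n)) = W := WdE' M k e x.
rewrite /rtgt /tgt /mkseq iotaD map_cat flatten_cat add0n.
have -> : iota 0 (2 ^ m) = iota 0 W ++ iota W (G - W) by rewrite -{1}(subnKC G_big) iotaD.
rewrite map_cat flatten_cat -/G.
have -> : flatten [seq blkT b C G W (rini M k e x) c | c <- iota 0 W] =
    flatten (map B (row0 M x (nP k n) (nTm k e n))).
  rewrite -(flatten_nth blank) sz; congr flatten; apply/eq_in_map => c; rewrite mem_iota => /andP[_ cW].
  by rewrite /blkT cW.
have -> : flatten [seq blkT b C G W (rini M k e x) c | c <- iota W (G - W)] = flatten (nseq (G - W) (blk b 1 C C)).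
  have -> : nseq (G - W) (blk b 1 C C) = [seq blk b 1 C C | c <- iota W (G - W)].
    by rewrite map_iota_const.
  congr flatten; apply/eq_in_map => c; rewrite mem_iota => /andP[Wc cG].
  by rewrite /blkT ltnNge Wc /= -[G](subnKC G_big) cG.
have -> : flatten [seq blkT b C G W (rini M k e x) c | c <- iota G W] = flatten (nseq W (blk b 0 0 0)).
  have -> : nseq W (blk b 0 0 0) = [seq blk b 0 0 0 | c <- iota G W].
    by rewrite map_iota_const.
  congr flatten; apply/eq_in_map => c; rewrite mem_iota => /andP[Gc cG].
  by rewrite /blkT !ltnNge Gc (leq_trans G_big Gc).
rewrite flatten_row0 -/(bc false) -/(bc true) -/blank.
by rewrite [RHS]cat6.
Qed.

Lemma dbl_fl8 phi s1 s2 s3 s4 s5 s6 s7 s8 :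
  dbl (fl phi (s1 ++ s2 ++ s3 ++ s4 ++ s5 ++ s6 ++ s7 ++ s8)) =
  flatten [:: dbl (fl phi s1); dbl (fl phi s2); dbl (fl phi s3); dbl (fl phi s4); dbl (fl phi s5);
    dbl (fl phi s6); dbl (fl phi s7); dbl (fl phi s8)].
Proof. by rewrite !fl_cat !dbl_cat /= cats0. Qed.

Lemma str_tgtE phi : str x (tgtE phi) [::] cnt = dbl (fl phi (rtgt M k e m x)).
Proof.
rewrite rtgtE dbl_fl8; apply: str_emits; do ?apply: conj; last by [].
- by rewrite fl_rep; apply: str_EBrep.
- exact: str_EB.
- rewrite fl_flatten dbl_flatten -!map_comp -(@flatten_nth _ _ false) -/n.
  pose w (c : bool) := fl phi (B (bc c) ++ B (bc c)).
  transitivity (flatten [seq (if nth false x q then str x (EB (w true)) [:: q] cnt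
    else str x (EB (w false)) [:: q] cnt) | q <- iota 0 (cnt 0)]); first by [].
  by congr flatten; apply: eq_map => q; rewrite !str_EB /w [RHS]/=; case: (nth false x q).
- exact: str_EB.
- by rewrite fl_rep; apply: str_EBrep.
- by rewrite fl_rep; apply: str_EBrep.
- have WG : W <= G by [].
  rewrite fl_rep dbl_flatten map_nseq -(flatten_ge _ WG) -cnt7.
  pose w := fl phi (blk b 1 C C).
  transitivity (flatten [seq (if q < W then [::] else str x (EB w) [:: q] cnt) | q <- iota 0 (cnt 7)]).
    by [].
  by congr flatten; apply: eq_map => q; rewrite str_EB.
by rewrite fl_rep; apply: str_EBrep.
Qed.

Definition thrE phi := ECats [:: EBrep 8 (nseq 1 true); EB [:: false]; tgtE phi; EBrep 8 (nseq 2 phi);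
  EB (nseq (k0 + 2) phi); EB (if phi then [:: false; true] else [:: true; false]); EBrep 8 (nseq 1 phi);
  EB (nseq k0 phi); EB (if phi then [:: false; true; true] else [:: true; true; true]);
  EBrep 7 (nseq (2 * K) false); EB [:: true; true; false]; EBrep 7 (nseq (2 * K) true)].

Lemma str_thrE phi : str x (thrE phi) [::] cnt = dbl (thr m k0 N (rtgt M k e m x) phi).
Proof.
rewrite (@str_emits_dbl _ [:: nseq (1 * m) true; [:: false]; fl phi (rtgt M k e m x); nseq (2 * m) phi;
  nseq (k0 + 2) phi; if phi then [:: false; true] else [:: true; false]; nseq (1 * m) phi; nseq k0 phi;
  if phi then [:: false; true; true] else [:: true; true; true]; nseq N false; [:: true; true; false];
  nseq N true]); last first.
  rewrite -NE.
  by do ?apply: conj; try exact: str_EB; try exact: str_EBrep1; try exact: str_tgtE.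
congr dbl; rewrite /thr -/(fl phi _) !mul1n.
have -> : 2 * m + k0 + 2 = 2 * m + (k0 + 2) by rewrite addnA.
rewrite [nseq (2 * m + _) _]nseqD [nseq (m + _) _]nseqD.
move: (fl _ _) (nseq m true) (nseq m phi) (nseq _ phi) (nseq _ phi) (nseq k0 phi) (nseq N _) (nseq N _) => *.
by rewrite /= cats0 -!catA.
Qed.

Definition probthr phi := ECats [:: ELit [:: false]; thrE phi; sep; denE; sep].

Lemma str_probthr phi : str x (probthr phi) [::] cnt = encprob (thr m k0 N (rtgt M k e m x) phi) D.
Proof.
rewrite (@str_emits _ [:: [:: false]; dbl (thr m k0 N (rtgt M k e m x) phi); [:: false; true];
  dbl (rcons (nseq D false) true); [:: false; true]]); last first.
  do ?apply: conj; try exact: str_lit; [exact: str_thrE | exact: str_denE | by []].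
by rewrite /encprob; do 2 (move: (dbl _) => ?).
Qed.

Definition emit := ECats [:: ELit (encdist dlow); EB [:: true]; EBrep 8 (nseq 1 false);
  EB (nseq k0 false ++ [:: true]); sep; itemsE false; itemsE true; topE; probthr false; probthr true].

Lemma str_emit : str x emit [::] cnt = red_word M k e m x.
Proof.
rewrite (@str_emits _ [:: encdist dlow; dbl [:: true]; dbl (nseq (1 * m) false); dbl (nseq k0 false ++ [:: true]);
  [:: false; true];
  flatten (mkseq (fun j => encval N (false * (G * K) + j)
    ++ encprob (pbits m k0 (rnum M k e m n) false (j %/ K) (j %% K)) D) (G * K));
  flatten (mkseq (fun j => encval N (true * (G * K) + j)
    ++ encprob (pbits m k0 (rnum M k e m n) true (j %/ K) (j %% K)) D) (G * K));
  encval N N ++ encprob (nseq (N + 3) true) (N + 3);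
  encprob (thr m k0 N (rtgt M k e m x) false) D; encprob (thr m k0 N (rtgt M k e m x) true) D]); last first.
  do ?apply: conj; try exact: str_lit; try exact: str_itemsE; try exact: str_probthr; try by [].
  - exact: str_EBrep1.
  - exact: str_topE.
rewrite /red_word /instance_word -/N -/n -/k0 -/K -/G -/D.
have -> : true * (G * K) = G * K by exact: mul1n.
have -> : dbl (true :: nseq (m + k0) false ++ [:: true]) =
    dbl [:: true] ++ dbl (nseq (1 * m) false) ++ dbl (nseq k0 false ++ [:: true]).
  by rewrite -!dbl_cat mul1n nseqD -!catA.
exact: flatten10.
Qed.

Lemma emitter_catsP cs : foldr (fun c P => emitter c /\ P) True cs -> emitter (ECats cs).
Proof. by elim: cs => //= c cs IH [-> /IH ->]. Qed.

Lemma emitter_emit : emitter emit.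
Proof.
have eL s : emitter (ELit s) := emitter_lit s.
have eE s : emitter (EB s) := eL _.
have eR j s : emitter (EBrep j s) := eL _.
have lo s : emitter (Elo s).
  have -> : emitter (Elo s) = emitter (EB s) && true by [].
  by rewrite eE.
have hi s : emitter (Ehi s).
  have -> : emitter (Ehi s) = emitter (EB s) && true by [].
  by rewrite eE.
have dE : emitter denE by apply: emitter_catsP; do ?apply: conj.
have nE phi i : emitter (numE phi i) by apply: emitter_catsP; do ?apply: conj.
have pE phi i : emitter (pbitsE phi i) by apply: emitter_catsP; do ?apply: conj.
have vE phi i : emitter (valE phi i) by apply: emitter_catsP; case: phi; do ?apply: conj.
have iE phi i : emitter (itemE phi i) by apply: emitter_catsP; do ?apply: conj; try exact: eL.
have isE phi : emitter (itemsE phi).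
  have -> : emitter (itemsE phi) = emitter (ECats [seq itemE phi i | i <- iota 0 K]) by [].
  apply: emitter_cats; rewrite all_map; apply/allP => i _; exact: iE.
have tE phi : emitter (tgtE phi).
  have e1 s1 s2 : emitter (CFor 0 (CX (inr 0) (EB s1) (EB s2))).
    have -> : emitter (CFor 0 (CX (inr 0) (EB s1) (EB s2))) = emitter (EB s1) && emitter (EB s2) by [].
    by rewrite !eE.
  have e2 s : emitter (CFor 7 (CLt (inr 0) (inl 9) CSkip (EB s))) by exact: eE.
  by apply: emitter_catsP; do ?apply: conj.
have hE phi : emitter (thrE phi) by apply: emitter_catsP; do ?apply: conj.
have prE phi : emitter (probthr phi) by apply: emitter_catsP; do ?apply: conj; try exact: eL.
have toE : emitter topE by apply: emitter_catsP; do ?apply: conj; try exact: eL.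
by apply: emitter_catsP; do ?apply: conj; try exact: eL.
Qed.

End Emit.

Definition reduction (M : TM) (k e : nat) : cmd := CSeq (setup k e) (emit M).

Lemma sem_seq x c1 c2 ls st : sem x (CSeq c1 c2) ls st = sem x c2 ls (sem x c1 ls st).
Proof. by []. Qed.

Lemma sem_reduction M k e x : exists m,
  [/\ sem x (reduction M k e) [::] (cnt0 x, [::]) = (final k e (size x) m, red_word M k e m x),
    (nT k e (size x) + 3) * nW k e (size x) <= 2 ^ m
    & 2 ^ m <= maxn 1 (2 * ((nT k e (size x) + 3) * nW k e (size x)))].
Proof.
have [m [h1 h2 h3]] := sem_setup k e x [::]; exists m; split; [|exact: h2|exact: h3].
have G_big : nW k e (size x) <= 2 ^ m by apply: leq_trans h2; rewrite leq_pmull ?addn3.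
have em : emitter (emit M) by apply: emitter_emit.
have := sem_emitter x [::] (final k e (size x) m) [::] em.
rewrite (str_emit M G_big) cats0 => h.
by rewrite /reduction sem_seq h1.
Qed.

Theorem theorem1 : NP_hard SW_Rev_problem.
Proof.
move=> L [V [k [[M [e dec]] LV]]].
have run := sem_reduction M k e; move: (reduction M k e) run => prog run.
exists (fun x => (sem x prog [::] (cnt0 x, [::])).2); split.
  apply: (@prog_polytime prog) => //.
  exists (fun n => costN (bound k e n) prog); first exact: polyb_costN (polyb_bound' k e).
  move=> x; have [m [h _ h3]] := run x.
  by apply: cost_le => i; rewrite h; apply: final_le.
move=> x; have [m [-> h2 _]] := run x.
(* The lower bound on [2 ^ m] exceeds 1, as a row has at least 7 cells. *)
have m0 : 0 < m by case: m h2 => //; rewrite /nW expn0; nia.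
rewrite [(_, _).2]/(red_word _ _ _ _ _).
rewrite red_word_correct //; last by move=> y; have [c [run_c _]] := dec y; exists c.
rewrite LV; split=> [[w [sw Vw]]|[w sw [c run_c acc]]]; exists w.
- by [].
- by have [c [run_c /proj2 acc]] := dec (enc_pair x w); exists c => //; apply: acc.
(* Execution is deterministic, so the accepting halt found by the tiling is the one that decides
   [V]. *)
split=> //; have [c' [run_c' /proj1 hV]] := dec (enc_pair x w).
by apply: hV; move: run_c'; rewrite run_c => -[<-].
Qed.
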